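(* Let $(b,0)$ be a connected weighted graph over $V$, let $m:V\to(0,\infty)$ and let $o\in V$ be the fixed reference vertex. The following assertions are equivalent: (i) $Q^{(D)}$ (on $\ell^2(V,m)$) is recurrent. (ii) $C_c(V)$ is dense in $\mathbf{D}$, i.e., $\mathbf{D}=\mathbf{D}_0$. (iii) The constant function $1$ can be approximated in $\mathbf{D}$ by functions of $C_c(V)$. (iv) $\operatorname{cap}(o)=\inf\{Q^{(D)}(v): v\in C_c(V),\ v(o)=1\}=0$. Moreover, in case (iii) holds, the approximating functions $e_n\in C_c(V)$ (with $\|e_n-1\|_o\to0$) can be chosen to satisfy $0\le e_n\le 1$.
   Context: $V$ is an infinite countable set. A weighted graph $(b,c)$ over $V$ consists of $b:V\times V\to[0,\infty)$ with $b(x,x)=0$, $b(x,y)=b(y,x)$ and $\sum_{y\in V}b(x,y)<\infty$ for all $x,y\in V$, and $c:V\to[0,\infty)$; $(b,0)$ means $c\equiv 0$. Write $x\sim y$ if $b(x,y)>0$. The graph is connected if any two vertices $x,y$ are joined by a finite sequence $x=x_0\sim x_1\sim\dots\sim x_n=y$. $C_c(V)$ is the set of finitely supported real functions on $V$; $\delta_x$ is the function equal to $1$ at $x$ and $0$ elsewhere. For $u:V\to\mathbb{R}$ let $\widetilde Q(u)=\frac12\sum_{x,y\in V}b(x,y)(u(x)-u(y))^2+\sum_{x\in V}c(x)u(x)^2\in[0,\infty]$, $\widetilde D=\{u:V\to\mathbb{R}:\widetilde Q(u)<\infty\}$, extended to a bilinear form on $\widetilde D$ in the natural way. For the fixed reference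 vertex $o\in V$, $\langle u,v\rangle_o=\widetilde Q(u,v)+u(o)v(o)$ is an inner product on $\widetilde D$ with norm $\|\cdot\|_o$. $\mathbf{D}$ denotes $\widetilde D$ with the topology generated by $\|\cdot\|_o$ (the Yamasaki space), and $\mathbf{D}_0$ is the closure of $C_c(V)$ in $\mathbf{D}$. For $m:V\to(0,\infty)$, $\ell^2(V,m)$ has inner product $\langle f,g\rangle=\sum_x f(x)g(x)m(x)$. The regular Dirichlet form $Q^{(D)}$ associated with the graph on $\ell^2(V,m)$ is the restriction of $\widetilde Q$ to the closure $D(Q^{(D)})$ of $C_c(V)$ in $\widetilde D\cap\ell^2(V,m)$ with respect to $\|u\|_Q=(\widetilde Q(u)+\|u\|_2^2)^{1/2}$; $Q^{(D)}(u)=Q^{(D)}(u,u)$. $L^{(D)}$ is the associated nonnegative self-adjoint operator ($u\in D(L^{(D)})$ and $L^{(D)}u=w$ iff $u\in D(Q^{(D)})$, $w\in\ell^2(V,m)$ and $Q^{(D)}(u,v)=\langle w,v\rangle$ for all $v\in D(Q^{(D)})$). $Q^{(D)}$ is called recurrent if its semigroup is, i.e. if $G(x,y)=\int_0^\infty e^{-tL^{(D)}}\delta_x(y)\,dt=\infty$ for all $x,y\in V$. *)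

(* Defs.v *)
From HB Require Import structures.
From mathcomp Require Import all_boot all_order all_algebra.
From mathcomp Require Import all_classical all_reals all_analysis.

Set Implicit Arguments.
Unset Strict Implicit.
Unset Printing Implicit Defensive.

Import Order.TTheory GRing.Theory Num.Theory.
Import numFieldNormedType.Exports.

Local Open Scope classical_set_scope.
Local Open Scope ring_scope.

(* Sum of an absolutely summable real family, as the difference of the sums of
   its positive and negative parts ([esum] itself is meaningful only for
   nonnegative families). *)
Definition rsum (R : realType) (I : choiceType) (f : I -> R) : R :=
  fine (\esum_(i in [set: I]) (f^\+ i)%:E - \esum_(i in [set: I]) (f^\- i)%:E)%E.

Section Graph.
Variables (R : realType) (V : countType).
Implicit Types (b : V -> V -> R) (c m : V -> R) (u v w f g : V -> R).

Record weighted_graph b c : Prop := WeightedGraph {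
  wg_b_ge0 : forall x y, 0 <= b x y;
  wg_b_diag : forall x, b x x = 0;
  wg_b_sym : forall x y, b x y = b y x;
  wg_b_sum : forall x, (\esum_(y in [set: V]) (b x y)%:E < +oo)%E;
  wg_c_ge0 : forall x, 0 <= c x
}.

Definition adjacent b : rel V := fun x y => 0 < b x y.

Definition connected_graph b : Prop :=
  forall x y, exists p : seq V, path (adjacent b) x p /\ last x p = y.

Definition delta (x : V) : V -> R := fun y => (y == x)%:R.

Definition Cc : set (V -> R) := [set u | finite_set [set x | u x != 0]].

Definition energy b c u : \bar R :=
  ((2^-1)%:E *
     \esum_(p in [set: V * V]) (b p.1 p.2 * (u p.1 - u p.2) ^+ 2)%:E
   + \esum_(x in [set: V]) (c x * u x ^+ 2)%:E)%E.

Definition Dtilde b c : set (V -> R) := [set u | (energy b c u < +oo)%E].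

(* The bilinear extension of [energy] to [Dtilde]; by Cauchy-Schwarz all sums
   converge absolutely there. *)
Definition form b c u v : R :=
  2^-1 * rsum (fun p : V * V =>
                 b p.1 p.2 * (u p.1 - u p.2) * (v p.1 - v p.2))
  + rsum (fun x => c x * u x * v x).

(* Closure of [A] in the space [X] for the topology of the norm [N] on [X]. *)
Definition norm_closure (X : set (V -> R)) (N : (V -> R) -> R)
    (A : set (V -> R)) : set (V -> R) :=
  [set u | X u /\ forall eps : R, 0 < eps -> exists2 v, A v & N (u \- v) < eps].

Definition inner_o b c (o : V) u v : R := form b c u v + u o * v o.

Definition norm_o b c o u : R := Num.sqrt (inner_o b c o u u).

Definition D0 b c o : set (V -> R) :=
  norm_closure (Dtilde b c) (norm_o b c o) Cc.

Definition ell2 m : set (V -> R) :=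
  [set f | (\esum_(x in [set: V]) (f x ^+ 2 * m x)%:E < +oo)%E].

Definition inner2 m f g : R := rsum (fun x => f x * g x * m x).

Definition norm2 m f : R := Num.sqrt (inner2 m f f).

Definition norm_Q b c m u : R := Num.sqrt (form b c u u + norm2 m u ^+ 2).

Definition dom_QD b c m : set (V -> R) :=
  norm_closure (Dtilde b c `&` ell2 m) (norm_Q b c m) Cc.

(* The quadratic form of the regular Dirichlet form, with the usual convention
   that a quadratic form is infinite outside of its domain. *)
Definition QD b c m u : \bar R :=
  if u \in dom_QD b c m then energy b c u else +oo%E.

(* Graph of the operator associated with the regular Dirichlet form:
   [LD b c m u w] means that u is in the domain of the operator, which maps
   it to w. *)
Definition LD b c m u w : Prop :=
  [/\ dom_QD b c m u, ell2 m w &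
      forall v, dom_QD b c m v -> form b c u v = inner2 m w v].

(* Strongly continuous semigroups of linear contractions on ell2 m.  Only the
   values of [T t f] for 0 <= t and f in ell2 m are relevant. *)
Record contraction_semigroup m (T : R -> (V -> R) -> (V -> R)) : Prop :=
  ContractionSemigroup {
  cs_ell2 : forall t f, 0 <= t -> ell2 m f -> ell2 m (T t f);
  cs_linear : forall t a f g, 0 <= t -> ell2 m f -> ell2 m g ->
    forall x, T t (fun y => a * f y + g y) x = a * T t f x + T t g x;
  cs_contraction : forall t f, 0 <= t -> ell2 m f ->
    norm2 m (T t f) <= norm2 m f;
  cs_0 : forall f, ell2 m f -> T 0 f = f;
  cs_add : forall s t f, 0 <= s -> 0 <= t -> ell2 m f ->
    T (s + t) f = T s (T t f);
  cs_continuous : forall f, ell2 m f ->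
    norm2 m (T t f \- f) @[t --> 0^'+] --> 0
}.

(* Graph of the infinitesimal generator, the derivative being taken in norm. *)
Definition generator m (T : R -> (V -> R) -> (V -> R)) u w : Prop :=
  [/\ ell2 m u, ell2 m w &
      norm2 m (fun x => t^-1 * (T t u x - u x) - w x) @[t --> 0^'+] --> 0].

(* [T t] = exp (- t L) for t >= 0: T is the semigroup whose generator is - L,
   domains included. *)
Definition semigroup_of m (L : (V -> R) -> (V -> R) -> Prop)
    (T : R -> (V -> R) -> (V -> R)) : Prop :=
  contraction_semigroup m T /\ forall u w, L u w <-> generator m T u (\- w).

(* The semigroup exp (- t L); for nonnegative self-adjoint L it exists, and it
   is unique on ell2 m because a contraction semigroup is determined by its
   generator. *)
Definition exp_semigroup m (L : (V -> R) -> (V -> R) -> Prop) :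
    R -> (V -> R) -> (V -> R) :=
  get [set T | semigroup_of m L T].

Definition green b c m (x y : V) : \bar R :=
  (\int[lebesgue_measure]_(t in `[0%R, +oo[)
     (exp_semigroup m (LD b c m) t (delta x) y)%:E)%E.

Definition recurrent b c m : Prop := forall x y, green b c m x y = +oo%E.

Definition capacity b c m (o : V) : \bar R :=
  ereal_inf [set QD b c m v | v in [set v | Cc v /\ v o = 1]].

(* Convergence of the sequence e to u in the Yamasaki space. *)
Definition yamasaki_cvg b c o (e : nat -> V -> R) u : Prop :=
  norm_o b c o (e n \- u) @[n --> \oo] --> 0.

End Graph.

Arguments Cc {R V}.

(* Main.v *)
(* Truncating to [0, 1] and a parallelogram argument show that, for a connected
   graph, (ii), (iii), (iv) and the addendum all hold as soon as o has capacity
   zero; what is left is to relate capacity zero to recurrence. For alpha > 0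
   let g = (L + alpha)^-1 delta_x. As g(y) is the Laplace transform at alpha of
   t |-> exp(-tL) delta_x (y), which is nonnegative, G(x, y) is infinite if and
   only if g(y) is unbounded as alpha varies. Testing the equation for g with
   finitely supported functions and with g itself shows that g(x) is unbounded
   if and only if x has capacity zero; and |u(x) - u(y)|^2 <= K Q(u), which holds
   because the graph is connected, propagates this from x to any y.

   That exp(-tL) exists, is determined by its generator and preserves
   nonnegative functions is read off the Euler approximations
   (1 + tL / 2^n)^(-2^n), which converge at a geometric rate on the domain of
   L^2 because (1 + hL)^-1 g = g - h L g + O(h^2) there. *)

Require Import Defs.
From HB Require Import structures.
From mathcomp Require Import all_boot all_order all_algebra.
From mathcomp Require Import finmap.
From mathcomp Require Import all_classical all_reals all_analysis.
From mathcomp Require Import measurable_realfun ring lra.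

Set Implicit Arguments.
Unset Strict Implicit.
Unset Printing Implicit Defensive.

Import Order.TTheory GRing.Theory Num.Theory.
Import numFieldNormedType.Exports.

Local Open Scope classical_set_scope.
Local Open Scope ring_scope.

(** * The Hille-Yosida theorem *)

(** [recurrent] speaks of a semigroup picked by [get], so nothing is known about it until existence
    and uniqueness are both proved. The only access to L is its weak form, hence everything is drawn
    from resolvents, in an abstract Banach space. Consistency errors of order h^2 need a second
    application of the operator; on its square's domain the constant is the norm of that second
    image, which resolvents do not increase, so N steps of length t/N cost O(t^2/N). Density and
    contractivity carry the conclusions to the whole space. Both the energy and the squared [ell2]
    norm are weighted sums of squares, over V x V and over V. Bounds on such sums survive pointwise
    limits, and a bound by the limit's own norm upgrades pointwise to norm convergence. With
    pointwise limits built by hand, these two facts replace completeness and weak compactness. The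
    limit alpha -> 0 is never taken on functions: a bound on g(y) uniform in alpha bounds G(x, y) by
    monotone convergence, and g(y) <= G(x, y) gives the converse. *)

Lemma iter_contraction_close (R : realType) (E : normedModType R)
    (F G : E -> E) (P : E -> Prop) (c : R) :
  (forall f g, `|G f - G g| <= `|f - g|) ->
  (forall g, P g -> P (F g)) -> (forall g, P g -> `|G g - F g| <= c) ->
  forall N g, P g -> `|iter N G g - iter N F g| <= N%:R * c.
Proof.
move=> G1 PF GF N g Pg.
have itG k f f' : `|iter k G f - iter k G f'| <= `|f - f'|.
  by elim: k => //= k; apply: le_trans; exact: G1.
elim: N g Pg => [|N IH] g Pg /=; first by rewrite subrr normr0 mul0r.
(* Telescoping through [iter N G (F g)]: the first defect is carried along by a contraction, and the
   induction hypothesis restarts at [F g], which still satisfies [P]. *)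
rewrite -!iterS !iterSr -(subrKA (iter N G (F g))).
apply: (le_trans (ler_normD _ _)); rewrite -natr1 mulrDl mul1r addrC.
by apply: lerD; [exact/IH/PF|exact/(le_trans (itG _ _ _))/GF].
Qed.

(* [A u w] means that [u] is in the domain of the operator and is mapped to
   [w]. *)
Record m_accretive (R : realType) (E : normedModType R) (A : E -> E -> Prop) :
    Prop := MAccretive {
  ma_linear : forall a u w u' w',
    A u w -> A u' w' -> A (a *: u + u') (a *: w + w');
  ma_accretive : forall h u w, 0 <= h -> A u w -> `|u| <= `|u + h *: w|;
  ma_range : forall h f, 0 < h -> exists u w, A u w /\ u + h *: w = f;
  ma_dense : forall f e, 0 < e -> exists u w, A u w /\ `|u - f| < e
}.

(** * Resolvents of an m-accretive operator *)

Section Resolvent.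
Variables (R : realType) (E : completeNormedModType R) (A : E -> E -> Prop).
Hypothesis maA : m_accretive A.

(** The map (1 + h A)^-1, chosen from the graph [A]. For h <= 0 it is the identity, the right value
    at h = 0, so that time 0 needs no separate treatment in the Euler products. *)
Definition resolvent (h : R) (f : E) : E :=
  if 0 < h then xget 0 [set u | exists2 w, A u w & u + h *: w = f] else f.

Local Notation J := resolvent.

Lemma resolventP h f : 0 < h -> exists2 w, A (J h f) w & J h f + h *: w = f.
Proof.
move=> h0; rewrite /J h0; case: xgetP => [_ -> //|no].
by have [u [w [Auw e]]] := ma_range maA f h0; case: (no u); exists w.
Qed.

Lemma resolvent0 f : J 0 f = f.
Proof. by rewrite /J ltxx. Qed.

Lemma accretiveN u w : A u w -> A (- u) (- w).
Proof.
move=> Auw; have := ma_linear maA (-2) Auw Auw.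
have e x : -2 *: x + x = - x :> E.
  by rewrite -{2}(scale1r x) -scalerDl -[RHS]scaleN1r;
    have -> : -2 + 1 = -1 :> R by ring.
by rewrite !e.
Qed.

Lemma accretiveB u w u' w' : A u w -> A u' w' -> A (u - u') (w - w').
Proof.
move=> Auw /accretiveN Auw'; have := ma_linear maA 1 Auw Auw'.
by rewrite !scale1r.
Qed.

(** Uniqueness of the solution: accretivity applied to the difference of two solutions bounds its
    norm by 0. *)
Lemma resolventK h u w : 0 <= h -> A u w -> J h (u + h *: w) = u.
Proof.
rewrite le_eqVlt => /predU1P[<- _|h0 Auw].
  by rewrite scale0r addr0 resolvent0.
have [w' Auw' e] := resolventP (u + h *: w) h0.
apply/eqP; rewrite -subr_eq0 -normr_le0.
apply: le_trans (ma_accretive maA (ltW h0) (accretiveB Auw' Auw)) _.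
by rewrite scalerBr addrACA -opprD e subrr normr0.
Qed.

Lemma resolvent_linear h a f g : J h (a *: f + g) = a *: J h f + J h g.
Proof.
have [h0|h0] := ltP 0 h; last by rewrite /J ltNge h0.
have [w Aw e] := resolventP f h0; have [w' Aw' e'] := resolventP g h0.
rewrite -{1}e -{1}e' -[RHS](resolventK (ltW h0) (ma_linear maA a Aw Aw')).
by congr J; rewrite !scalerDr !scalerA (mulrC a) addrACA.
Qed.

Lemma resolventB h f g : J h (f - g) = J h f - J h g.
Proof.
have := resolvent_linear h (-1) g f.
by rewrite !scaleN1r (addrC _ f) (addrC _ (J h f)).
Qed.

Lemma resolvent_norm h f : `|J h f| <= `|f|.
Proof.
have [h0|h0] := ltP 0 h; last by rewrite /J ltNge h0.
have [w Aw e] := resolventP f h0.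
by apply: le_trans (ma_accretive maA (ltW h0) Aw) _; rewrite e.
Qed.

Lemma resolvent_contraction h f g : `|J h f - J h g| <= `|f - g|.
Proof. by rewrite -resolventB resolvent_norm. Qed.

Lemma resolvent_sub h u w : 0 <= h -> A u w -> J h u = u - h *: J h w.
Proof.
move=> h0 Auw; have := resolvent_linear h h w u.
by rewrite (addrC _ u) resolventK// => {2}->; rewrite [RHS]addrC addKr.
Qed.

(** The resolvent commutes with the operator: [resolvent_sub] and the resolvent equation express
    [u - J h u] as [h *: J h w] and as [h *: w']. *)
Lemma resolvent_graph h u w : 0 <= h -> A u w -> A (J h u) (J h w).
Proof.
rewrite le_eqVlt => /predU1P[<-|h0 Auw]; first by rewrite !resolvent0.
have [w' Aw' e] := resolventP u h0.
suff -> : J h w = w' by [].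
apply: (scalerI (lt0r_neq0 h0)); apply: (addrI (J h u)).
by rewrite e {1}(resolvent_sub (ltW h0) Auw) subrK.
Qed.

Lemma resolventC h k f : 0 <= h -> 0 <= k -> J h (J k f) = J k (J h f).
Proof.
move=> h0; rewrite le_eqVlt => /predU1P[<-|k0]; first by rewrite !resolvent0.
have [w Aw e] := resolventP f k0.
rewrite -{2}e addrC resolvent_linear addrC.
by rewrite (resolventK (ltW k0) (resolvent_graph h0 Aw)).
Qed.

Lemma resolvent_domain h f : 0 < h -> exists w, A (J h f) w.
Proof. by move=> /(resolventP f)[w Aw _]; exists w. Qed.

Lemma resolvent_sub_norm h u w : 0 <= h -> A u w -> `|J h u - u| <= h * `|w|.
Proof.
move=> h0 Auw; rewrite (resolvent_sub h0 Auw) addrC addKr normrN normrZ.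
by rewrite ger0_norm// ler_wpM2l// resolvent_norm.
Qed.

(** On the domain the error is at most [h * |w|]; density and contractivity extend the convergence
    to every [f], without a rate. The [+ 1] in the choice of [h] covers [w = 0]. *)
Lemma resolvent_cvg f e : 0 < e -> exists2 h, 0 < h & `|J h f - f| <= e.
Proof.
move=> e0; have e3 : 0 < e / 3 by rewrite divr_gt0.
have [u [w [Auw uf]]] := ma_dense maA f e3.
have w1 : 0 < `|w| + 1 by rewrite ltr_wpDl.
exists (e / 3 / (`|w| + 1)); first by rewrite divr_gt0.
set h := _ / _; have h0 : 0 <= h by rewrite divr_ge0// ltW.
have -> : J h f - f = (J h f - J h u) + ((J h u - u) + (u - f)).
  by rewrite !subrKA.
have -> : e = e / 3 + (e / 3 + e / 3) by field.
apply: le_trans (ler_normD _ _) (lerD _ (le_trans (ler_normD _ _) (lerD _ _))).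
- by apply: le_trans (resolvent_contraction _ _ _) _; rewrite distrC ltW.
- apply: le_trans (resolvent_sub_norm h0 Auw) _.
  rewrite /h -mulrA ler_piMr ?(ltW e3)// mulrC ler_pdivrMr// mul1r.
  by rewrite lerDl.
- exact: ltW.
Qed.

(** The domain of the square of the operator, with the first and second images named because [|z|]
    is the constant in all estimates below. *)
Definition domain2 (g w z : E) : Prop := A g w /\ A w z.

(** For [u] in the domain, [J h u] is close to [u] and its image [J h w] is again in the domain. *)
Lemma domain2_dense f e : 0 < e ->
  exists g w z, domain2 g w z /\ `|g - f| <= e.
Proof.
move=> e0; have e2 : 0 < e / 2 by rewrite divr_gt0.
have [u [w [Auw uf]]] := ma_dense maA f e2.
have [h h0 hu] := resolvent_cvg u e2.
have [z Az] := resolvent_domain w h0.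
exists (J h u), (J h w), z; split.
  by split => //; apply: resolvent_graph => //; exact: ltW.
rewrite -(subrKA u) [leRHS]splitr.
by apply: le_trans (ler_normD _ _) (lerD _ (ltW uf)).
Qed.

Lemma resolvent_domain2 h g w z : 0 <= h -> domain2 g w z ->
  domain2 (J h g) (J h w) (J h z).
Proof. by move=> h0 [Agw Awz]; split; exact: resolvent_graph. Qed.

(** By [resolvent_sub] the remainder is [h *: (w - J h w)], and the bracket is itself of size at
    most [h * |z|]. *)
Lemma resolvent_taylor h g w z : 0 <= h -> domain2 g w z ->
  `|J h g - (g - h *: w)| <= h ^+ 2 * `|z|.
Proof.
move=> h0 [Agw Awz]; rewrite (resolvent_sub h0 Agw).
rewrite opprB addrC subrKA -scalerBr normrZ distrC ger0_norm//.
by rewrite expr2 -mulrA ler_wpM2l// resolvent_sub_norm.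
Qed.

(** Both sides agree with [g - (h + k) *: w] to first order. The defects are h^2, k^2, h k and (h +
    k)^2 times [|z|], together at most 2 (h + k)^2 [|z|]. *)
Lemma resolvent2_taylor h k g w z : 0 <= h -> 0 <= k -> domain2 g w z ->
  `|J h (J k g) - J (h + k) g| <= 2 * (h + k) ^+ 2 * `|z|.
Proof.
move=> h0 k0 gwz; have hk0 : 0 <= h + k by exact: addr_ge0.
have z0 : 0 <= `|z| by [].
have e1 := resolvent_taylor hk0 gwz.
have e2 := resolvent_taylor k0 gwz.
have e3 := resolvent_taylor h0 (resolvent_domain2 k0 gwz).
have e4 := resolvent_sub_norm k0 gwz.2.
have e5 := resolvent_norm k z.
apply: le_trans (ler_distD (J k g - h *: J k w) _ _) _.
apply: le_trans (lerD e3 (ler_distD (g - k *: w - h *: J k w) _ _)) _.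
apply: le_trans (lerD (lexx _) (lerD _ (ler_distD (g - (h + k) *: w) _ _))) _.
- by rewrite opprB subrKA; exact: e2.
- have -> : `|g - k *: w - h *: J k w - (g - (h + k) *: w)| = h * `|J k w - w|.
    rewrite scalerDl (addrC (h *: w)) (opprD (k *: w)) (addrA g).
    rewrite (opprB _ (h *: w)) (addrC (_ - h *: J k w)) subrKA.
    by rewrite -scalerBr normrZ ger0_norm// distrC.
  rewrite [in leLHS](distrC _ (J (h + k) g)).
  have := ler_wpM2l h0 e4.
  have := ler_wpM2l (sqr_ge0 h) e5.
  have := mulr_ge0 (mulr_ge0 h0 k0) z0.
  lra.
Qed.
End Resolvent.

Lemma exists_half_pow_le (R : realType) (C e : R) : 0 <= C -> 0 < e ->
  exists N, forall n, (N <= n)%N -> C / 2 ^+ n <= e.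
Proof.
move=> C0 e0; exists (Num.bound (C / e)) => n Nn.
have Ce : C / e < n%:R.
  by apply: lt_le_trans (archi_boundP _) _;
    [rewrite divr_ge0// ltW|rewrite ler_nat].
have n2 : n%:R <= 2 ^+ n :> R by rewrite -natrX ler_nat ltnW// ltn_expl.
rewrite ler_pdivrMr ?exprn_gt0// mulrC -ler_pdivrMr//.
exact: le_trans (ltW Ce) n2.
Qed.

(** * Euler approximations and their limit *)

Section HilleYosida.
Variables (R : realType) (E : completeNormedModType R) (A : E -> E -> Prop).
Hypothesis maA : m_accretive A.

Local Notation J := (resolvent A).

(** Powers of two make consecutive approximations comparable: passing from n to n + 1 splits each
    step of length 2h into two of length h, which is the situation of [resolvent2_taylor]. *)
Definition euler (n : nat) (t : R) (f : E) : E :=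
  iter (2 ^ n) (J (t / 2 ^+ n)) f.

Let half_ge0 t n : 0 <= t -> 0 <= t / 2 ^+ n :> R.
Proof. by move=> t0; rewrite divr_ge0// exprn_ge0. Qed.

Lemma iter_resolvent_linear h N a f g :
  iter N (J h) (a *: f + g) = a *: iter N (J h) f + iter N (J h) g.
Proof. by elim: N => //= N ->; rewrite resolvent_linear. Qed.

Lemma iter_resolvent_norm h N f : `|iter N (J h) f| <= `|f|.
Proof. by elim: N => //= N; apply: le_trans; exact: resolvent_norm. Qed.

Lemma iter_resolvent_contraction h N f g :
  `|iter N (J h) f - iter N (J h) g| <= `|f - g|.
Proof.
by elim: N => //= N; apply: le_trans; exact: resolvent_contraction.
Qed.

Lemma iter_resolvent_sub h N u w : 0 <= h -> A u w ->
  `|iter N (J h) u - u| <= N%:R * h * `|w|.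
Proof.
move=> h0 Auw; elim: N => [|N IH] /=; first by rewrite subrr normr0 !mul0r.
rewrite -iterS iterSr -(subrKA (iter N (J h) u)) -natr1 mulrDl mul1r mulrDl.
rewrite addrC; apply: le_trans (ler_normD _ _) (lerD IH _).
apply: le_trans (iter_resolvent_contraction _ _ _ _) _.
exact: resolvent_sub_norm.
Qed.

Lemma iter_resolvent2_close h k N g w z : 0 <= h -> 0 <= k ->
  domain2 A g w z ->
  `|iter N (J h \o J k) g - iter N (J (h + k)) g|
    <= N%:R * (2 * (h + k) ^+ 2 * `|z|).
Proof.
(* The invariant keeps the second image below the initial [|z|], so every step has the same error
   bound. *)
move=> h0 k0 gwz; pose P g := exists w z', domain2 A g w z' /\ `|z'| <= `|z|.
apply: (@iter_contraction_close _ _ _ _ P); last by exists w, z.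
- move=> f f' /=; apply: le_trans (resolvent_contraction maA _ _ _) _.
  exact: resolvent_contraction.
- move=> g' [w' [z' [g'w'z' z'z]]]; exists (J (h + k) w'), (J (h + k) z').
  split; first by apply: resolvent_domain2 => //; exact: addr_ge0.
  exact: le_trans (resolvent_norm maA _ _) z'z.
- move=> g' [w' [z' [g'w'z' z'z]]].
  apply: le_trans (resolvent2_taylor maA h0 k0 g'w'z') _.
  by apply: ler_wpM2l => //; rewrite mulr_ge0// sqr_ge0.
Qed.

(** There are 2^n steps, each with error 2 (t / 2^n)^2 [|z|]. *)
Lemma euler_step n t g w z : 0 <= t -> domain2 A g w z ->
  `|euler n.+1 t g - euler n t g| <= 2 * t ^+ 2 * `|z| / 2 ^+ n.
Proof.
move=> t0 gwz; rewrite /euler expnSr iterM.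
have -> : t / 2 ^+ n = t / 2 ^+ n.+1 + t / 2 ^+ n.+1.
  by rewrite (exprS _ n); field; rewrite expf_neq0.
rewrite -[iter 2 _]/(J (t / 2 ^+ n.+1) \o J (t / 2 ^+ n.+1)).
apply: le_trans (iter_resolvent2_close _ (half_ge0 _ _) (half_ge0 _ _) gwz) _
  => //.
rewrite le_eqVlt; apply/orP; left; apply/eqP.
by rewrite natrX (exprS _ n); field; rewrite expf_neq0.
Qed.

Lemma euler_close n k t g w z : 0 <= t -> domain2 A g w z ->
  `|euler (n + k) t g - euler n t g| <= 4 * t ^+ 2 * `|z| / 2 ^+ n.
Proof.
move=> t0 gwz; set C := t ^+ 2 * `|z|.
have C0 : 0 <= C by rewrite mulr_ge0// sqr_ge0.
(* The subtracted term is the tail of the geometric series; without it the induction on [k] would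
   not close. *)
suff : `|euler (n + k) t g - euler n t g| <= 4 * C / 2 ^+ n - 4 * C / 2 ^+ (n +
  k).
  move=> /le_trans; apply; rewrite /C (mulrA 4) gerBl divr_ge0 ?exprn_ge0//.
  by rewrite -mulrA mulr_ge0.
elim: k => [|k IH]; first by rewrite addn0 !subrr normr0.
rewrite addnS -(subrKA (euler (n + k) t g)).
apply: le_trans (ler_normD _ _) _.
apply: le_trans (lerD (euler_step _ t0 gwz) IH) _.
rewrite /C le_eqVlt; apply/orP; left; apply/eqP.
by rewrite (exprS _ (n + k)); field; rewrite !expf_neq0.
Qed.

(** The rate holds only on [domain2], but the approximations are contractions uniformly in [n], so
    the Cauchy property passes to the closure. *)
Lemma is_cvg_euler t f : 0 <= t -> cvg (euler n t f @[n --> \oo]).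
Proof.
move=> t0; apply: cauchy_cvg; apply: cauchy_exP => e e0.
have e4 : 0 < e / 4 by rewrite divr_gt0.
have [g [w [z [gwz gf]]]] := domain2_dense maA f e4.
have C0 : 0 <= 4 * t ^+ 2 * `|z| by rewrite !mulr_ge0// sqr_ge0.
have [N HN] := exists_half_pow_le C0 e4.
exists (euler N t f); exists N => // n /= Nn; rewrite -ball_normE/=.
have -> : euler N t f - euler n t f = (euler N t f - euler N t g) +
    ((euler N t g - euler n t g) + (euler n t g - euler n t f)).
  by rewrite !subrKA.
apply: (@le_lt_trans _ _ (e / 4 + (e / 4 + e / 4))); last by lra.
apply: le_trans (ler_normD _ _) (lerD _ (le_trans (ler_normD _ _) (lerD _ _))).
- by apply: le_trans (iter_resolvent_contraction _ _ _ _) _; rewrite distrC.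
- rewrite distrC -(subnKC Nn); apply: le_trans (euler_close _ _ t0 gwz) _.
  exact: HN.
- exact: le_trans (iter_resolvent_contraction _ _ _ _) _.
Qed.

Definition hille_yosida (t : R) (f : E) : E := lim (euler n t f @[n --> \oo]).

Local Notation T := hille_yosida.

Lemma cvg_euler t f : 0 <= t -> euler n t f @[n --> \oo] --> T t f.
Proof. exact: is_cvg_euler. Qed.
Arguments cvg_euler {t} f _.

Lemma hille_yosida_linear t a f g : 0 <= t ->
  T t (a *: f + g) = a *: T t f + T t g.
Proof.
move=> t0; apply: cvg_lim => //.
under eq_fun do rewrite /euler iter_resolvent_linear.
by apply: cvgD; [apply: cvgZr|]; exact: cvg_euler.
Qed.

Lemma hille_yosida_norm t f : 0 <= t -> `|T t f| <= `|f|.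
Proof.
move=> t0.
have h : `|euler n t f| @[n --> \oo] --> `|T t f|.
  by apply: cvg_norm; exact: cvg_euler.
rewrite -(cvg_lim _ h)//; apply: limr_le; first by apply/cvg_ex; eexists;
  exact: h.
by near=> n; exact: iter_resolvent_norm.
Unshelve. all: by end_near. Qed.

Lemma hille_yosida0 f : T 0 f = f.
Proof.
apply: cvg_lim => //; rewrite (_ : (fun n => _) = cst f); first exact: cvg_cst.
apply/funext => n; rewrite /euler mul0r.
by elim: (2 ^ n)%N => //= N ->; rewrite resolvent0.
Qed.

Lemma hille_yosida_close n t g w z : 0 <= t -> domain2 A g w z ->
  `|T t g - euler n t g| <= 4 * t ^+ 2 * `|z| / 2 ^+ n.
Proof.
move=> t0 gwz.
have h : `|euler m t g - euler n t g| @[m --> \oo] --> `|T t g - euler n t g|.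
  by apply: cvg_norm; apply: cvgB; [exact: cvg_euler|exact: cvg_cst].
rewrite -(cvg_lim _ h)//; apply: limr_le; first by apply/cvg_ex; eexists;
  exact: h.
near=> m; have /subnKC <- : (n <= m)%N by near: m; exists n.
exact: euler_close t0 gwz.
Unshelve. all: by end_near. Qed.

Lemma hille_yosidaB t f g : 0 <= t -> T t (f - g) = T t f - T t g.
Proof.
move=> t0; have := hille_yosida_linear (-1) g f t0.
by rewrite !scaleN1r (addrC _ f) (addrC _ (T t f)).
Qed.

Lemma hille_yosida_contraction t f g : 0 <= t -> `|T t f - T t g| <= `|f - g|.
Proof. by move=> t0; rewrite -hille_yosidaB// hille_yosida_norm. Qed.

(** Reduces the semigroup law and the uniqueness of the semigroup to [domain2], where errors have a
    rate. *)
Lemma eq_domain2 (F G : E -> E) :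
  (forall f g, `|F f - F g| <= `|f - g|) ->
  (forall f g, `|G f - G g| <= `|f - g|) ->
  (forall g w z, domain2 A g w z -> F g = G g) -> F =1 G.
Proof.
move=> F1 G1 FG f; apply/eqP; rewrite -subr_eq0 -normr_le0.
apply/ler_addgt0Pr => e e0; rewrite add0r.
have e2 : 0 < e / 2 by rewrite divr_gt0.
have [g [w [z [gwz gf]]]] := domain2_dense maA f e2.
rewrite -(subrKA (F g)) [leRHS]splitr.
apply: le_trans (ler_normD _ _) (lerD _ _).
  by apply: le_trans (F1 _ _) _; rewrite distrC.
by rewrite (FG _ _ _ gwz); exact: le_trans (G1 _ _) _.
Qed.

Lemma iter_resolventM h k N f : 0 <= h -> 0 <= k ->
  iter N (J h \o J k) f = iter N (J h) (iter N (J k) f).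
Proof.
move=> h0 k0; elim: N => //= N ->; congr J.
by elim: N (iter N (J k) f) => //= N IH g; rewrite resolventC// IH.
Qed.

(** Resolvents commute, so the product of the approximations at [s] and [t] is the 2^n-th iterate of
    a product of two resolvents. This differs from the approximation at [s + t] by at most 2 (s +
    t)^2 [|z|] / 2^n. *)
Lemma hille_yosidaD s t f : 0 <= s -> 0 <= t -> T (s + t) f = T s (T t f).
Proof.
move=> s0 t0; have st0 : 0 <= s + t by exact: addr_ge0.
move: f; apply: eq_domain2.
- by move=> f g; exact: hille_yosida_contraction.
- move=> f g; apply: le_trans (hille_yosida_contraction _ _ s0) _.
  exact: hille_yosida_contraction.
move=> g w z gwz; apply/eqP; rewrite -subr_eq0 -normr_le0.
apply/ler_addgt0Pr => e e0; rewrite add0r.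
have e4 : 0 < e / 4 by rewrite divr_gt0.
have cv t' f : 0 <= t' -> \forall n \near \oo, `|T t' f - euler n t' f| <= e /
  4.
  move=> t'0; have /cvgrPdist_le := cvg_euler f t'0; exact.
have C0 : 0 <= 2 * (s + t) ^+ 2 * `|z| by rewrite !mulr_ge0// sqr_ge0.
have [N HN] := exists_half_pow_le C0 e4.
near \oo => n.
have e1 : `|T (s + t) g - euler n (s + t) g| <= e / 4.
  by near: n; exact: cv.
have e2 : `|T s (T t g) - euler n s (T t g)| <= e / 4.
  by near: n; exact: cv.
have e3 : `|T t g - euler n t g| <= e / 4.
  by near: n; exact: cv.
have e5 : `|euler n s (euler n t g) - euler n (s + t) g| <= e / 4.
  rewrite /euler -iter_resolventM ?half_ge0// mulrDl.
  apply: le_trans (iter_resolvent2_close _ (half_ge0 _ _) (half_ge0 _ _) gwz) _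
    => //.
  apply: le_trans (HN n _); last by near: n; exists N.
  rewrite le_eqVlt; apply/orP; left; apply/eqP.
  by rewrite natrX; field; rewrite expf_neq0.
have -> : T (s + t) g - T s (T t g) = (T (s + t) g - euler n (s + t) g) +
   ((euler n (s + t) g - euler n s (euler n t g)) +
   ((euler n s (euler n t g) - euler n s (T t g)) +
   (euler n s (T t g) - T s (T t g)))).
  by rewrite !subrKA.
have e6 := iter_resolvent_contraction (s / 2 ^+ n) (2 ^ n) (euler n t g) (T t
  g).
apply: (@le_trans _ _ (e / 4 + (e / 4 + (e / 4 + e / 4)))); last by lra.
apply: le_trans (ler_normD _ _) (lerD e1 (le_trans (ler_normD _ _) (lerD _
 (le_trans (ler_normD _ _) (lerD _ _))))).
- by rewrite distrC.
- by apply: le_trans e6 _; rewrite distrC.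
- by rewrite distrC.
Unshelve. all: by end_near. Qed.
End HilleYosida.

(** * Contraction semigroups and their generators *)

Record csemigroup (R : realType) (E : normedModType R) (S : R -> E -> E) :
    Prop := CSemigroup {
  csg_linear : forall t a f g, 0 <= t ->
    S t (a *: f + g) = a *: S t f + S t g;
  csg_norm : forall t f, 0 <= t -> `|S t f| <= `|f|;
  csg_0 : forall f, S 0 f = f;
  csg_D : forall s t f, 0 <= s -> 0 <= t -> S (s + t) f = S s (S t f);
  csg_cvg : forall f, S t f @[t --> 0^'+] --> f
}.

Definition generates (R : realType) (E : normedModType R) (S : R -> E -> E)
  (u v : E) : Prop := t^-1 *: (S t u - u) @[t --> 0^'+] --> v.

Section Generates.
Variables (R : realType) (E : normedModType R) (S : R -> E -> E).

Lemma generatesP u v : generates S u v <->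
  forall e, 0 < e -> \forall t \near 0^'+, `|S t u - u - t *: v| <= e * t.
Proof.
have eqt t : 0 < t -> `|S t u - u - t *: v| = `|v - t^-1 *: (S t u - u)| * t.
  move=> t0; rewrite distrC.
  have -> : t *: v - (S t u - u) = t *: (v - t^-1 *: (S t u - u)).
    by rewrite scalerBr scalerA divff ?lt0r_neq0// scale1r.
  by rewrite normrZ gtr0_norm// mulrC.
split=> [/cvgrPdist_le h e e0|h].
  near=> t; rewrite eqt; last by near: t; exact: nbhs_right_gt.
  by apply: ler_wpM2r; [near: t; exact: nbhs_right_ge|near: t; exact: h].
apply/cvgrPdist_le => e e0; near=> t.
have t0 : 0 < t by near: t; exact: nbhs_right_gt.
by rewrite -(ler_pM2r t0) -eqt//; near: t; exact: h.
Unshelve. all: by end_near. Qed.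

Hypothesis csgS : csemigroup S.

Lemma csgB t f g : 0 <= t -> S t (f - g) = S t f - S t g.
Proof.
move=> t0; have := csg_linear csgS (-1) g f t0.
by rewrite !scaleN1r (addrC _ f) (addrC _ (S t f)).
Qed.

Lemma csgZ t a f : 0 <= t -> S t (a *: f) = a *: S t f.
Proof.
move=> t0; rewrite -[a *: f]addr0 csg_linear//.
suff -> : S t 0 = 0 by rewrite addr0.
by have := csgB 0 0 t0; rewrite !subrr.
Qed.

Lemma csg_contraction t f g : 0 <= t -> `|S t f - S t g| <= `|f - g|.
Proof. by move=> t0; rewrite -csgB// csg_norm. Qed.

Lemma csgMn t N f : 0 <= t -> S (N%:R * t) f = iter N (S t) f.
Proof.
move=> t0; elim: N => [|N IH] /=; first by rewrite mul0r csg_0.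
by rewrite -natr1 mulrDl mul1r addrC csg_D// ?IH// mulr_ge0.
Qed.

(** Cuts a fixed time [t] into [N] equal steps so short that the infinitesimal estimate at 0 applies
    to each of them. *)
Lemma generates_step u v t e : generates S u v -> 0 < t -> 0 < e ->
  exists2 N, (0 < N)%N &
    `|S (t / N%:R) u - u - (t / N%:R) *: v| <= e * (t / N%:R).
Proof.
move=> /generatesP gS t0 /gS [d /= d0 hd].
have dt : 0 <= t / d by rewrite divr_ge0 ?ltW.
exists (Num.bound (t / d)).+1 => //.
have h0 : 0 < t / (Num.bound (t / d)).+1%:R by rewrite divr_gt0.
apply: hd => //=; rewrite sub0r normrN gtr0_norm// ltr_pdivrMr//.
rewrite mulrC -ltr_pdivrMr//; apply: lt_le_trans (archi_boundP dt) _.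
by rewrite ler_nat.
Qed.

(** Discrete substitute for writing [S t u - u] as the integral of [S s v]: each of the [N] steps
    moves [u] by at most [h * |v| + e / t * h], and these add up to [t * |v| + e]. *)
Lemma generates_lipschitz u v t : generates S u v -> 0 <= t ->
  `|S t u - u| <= t * `|v|.
Proof.
move=> gS; rewrite le_eqVlt => /predU1P[<-|t0].
  by rewrite csg_0// subrr normr0 mul0r.
apply/ler_addgt0Pr => e e0; have et : 0 < e / t by rewrite divr_gt0.
have [N N0 hN] := generates_step gS t0 et.
set h := t / N%:R in hN; have h0 : 0 <= h by rewrite divr_ge0// ltW.
have tE : t = N%:R * h by rewrite /h mulrCA divff ?mulr1// pnatr_eq0 -lt0n.
have Sh : `|S h u - u| <= h * `|v| + e / t * h.
  rewrite -(subrK (h *: v) (S h u - u)).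
  apply: le_trans (ler_normD _ _) _; rewrite addrC.
  by apply: lerD => //; rewrite normrZ ger0_norm.
have SN k : `|iter k (S h) u - u| <= k%:R * `|S h u - u|.
  elim: k => [|k IH] /=; first by rewrite subrr normr0 mul0r.
  rewrite -(subrKA (S h u)) -natr1 mulrDl mul1r.
  apply: le_trans (ler_normD _ _) (lerD _ _) => //.
  exact: le_trans (csg_contraction _ _ _) IH.
rewrite {1}tE csgMn//; apply: le_trans (SN N) _.
apply: le_trans (ler_wpM2l _ Sh) _ => //.
rewrite mulrDr (mulrA N%:R) -tE (mulrCA N%:R) -tE.
by rewrite divfK// lt0r_neq0.
Qed.

(** The same subdivision for the second-order remainder [r], which is subadditive up to a cross
    term. *)
Lemma generates_taylor u v w t : generates S u v -> generates S v w ->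
  0 <= t -> `|S t u - u - t *: v| <= t ^+ 2 * `|w|.
Proof.
move=> gu gv; rewrite le_eqVlt => /predU1P[<-|t0].
  by rewrite csg_0// subrr scale0r subr0 normr0 expr0n mul0r.
apply/ler_addgt0Pr => e e0; have et : 0 < e / t by rewrite divr_gt0.
have [N N0 hN] := generates_step gu t0 et.
set h := t / N%:R in hN; have h0 : 0 <= h by rewrite divr_ge0// ltW.
have tE : t = N%:R * h by rewrite /h mulrCA divff ?mulr1// pnatr_eq0 -lt0n.
pose r s := `|S s u - u - s *: v|.
(* The cross term is [s' *: (S s v - v)], of size at most [s' * s * |w|] by [generates_lipschitz]
   applied to [v]. *)
have rD s s' : 0 <= s -> 0 <= s' -> r (s + s') <= r s' + r s + s' * s * `|w|.
  move=> s0 s'0; rewrite /r.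
  have -> : S (s + s') u - u - (s + s') *: v =
      S s (S s' u - u - s' *: v) + (S s u - u - s *: v) +
      s' *: (S s v - v).
    rewrite !csgB// csg_D// csgZ// (scalerDl v) scalerBr.
    rewrite [in RHS](addrAC (S s (S s' u))) -(addrA (S s u)) -(opprD u) subrKA.
    by rewrite [in RHS](addrAC (S s (S s' u))) subrKA !opprD !addrA.
  apply: le_trans (ler_normD _ _) (lerD _ _); last first.
    rewrite normrZ ger0_norm// -mulrA ler_wpM2l//.
    exact: generates_lipschitz.
  apply: le_trans (ler_normD _ _) (lerD _ _) => //.
  exact: csg_norm.
have w0 : 0 <= `|w| by [].
have rN k : r (k%:R * h) <= k%:R * r h + (k%:R * h) ^+ 2 * `|w|.
  elim: k => [|k IH].
    by rewrite !mul0r expr0n/= !mul0r /r csg_0// subrr scale0r subr0 normr0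
      add0r.
  rewrite -natr1 mulrDl mul1r.
  apply: le_trans (rD _ _ (mulr_ge0 (ler0n _ _) h0) h0) _.
  have k0 : 0 <= k%:R :> R by [].
  have := mulr_ge0 (mulr_ge0 h0 h0) w0.
  have := mulr_ge0 k0 (mulr_ge0 (mulr_ge0 h0 h0) w0).
  lra.
have := rN N; rewrite -tE => /le_trans; apply.
rewrite addrC lerD2l; apply: le_trans (ler_wpM2l _ hN) _ => //.
by rewrite mulrCA -tE divfK// lt0r_neq0.
Qed.
End Generates.

Section HilleYosidaTheorem.
Variables (R : realType) (E : completeNormedModType R) (A : E -> E -> Prop).
Hypothesis maA : m_accretive A.

Local Notation T := (hille_yosida A).
Local Notation J := (resolvent A).

Lemma hille_yosida_lipschitz t u w : 0 <= t -> A u w ->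
  `|T t u - u| <= t * `|w|.
Proof.
move=> t0 Auw.
have h : `|euler A n t u - u| @[n --> \oo] --> `|T t u - u|.
  by apply: cvg_norm; apply: cvgB; [exact: cvg_euler|exact: cvg_cst].
rewrite -(cvg_lim _ h)//; apply: limr_le; first by apply/cvg_ex; eexists;
  exact: h.
near=> n; have h0 : 0 <= t / 2 ^+ n by rewrite divr_ge0// exprn_ge0.
apply: le_trans (iter_resolvent_sub maA _ h0 Auw) _.
by rewrite natrX mulrCA divff ?mulr1// expf_neq0.
Unshelve. all: by end_near. Qed.

Lemma hille_yosida_csemigroup : csemigroup T.
Proof.
split.
- by move=> t a f g t0; exact: hille_yosida_linear.
- by move=> t f t0; exact: hille_yosida_norm.
- by move=> f; exact: hille_yosida0.
- by move=> s t f s0 t0; exact: hille_yosidaD.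
- move=> f; apply/cvgrPdist_le => e e0.
  have e3 : 0 < e / 3 by rewrite divr_gt0.
  have [u [w [Auw /ltW uf]]] := ma_dense maA f e3.
  have w1 : 0 < `|w| + 1 by rewrite ltr_wpDl.
  near=> t.
  have t0 : 0 <= t by near: t; exact: nbhs_right_ge.
  have tw : t * `|w| <= e / 3.
    apply: (@le_trans _ _ (t * (`|w| + 1))); first by rewrite ler_wpM2l// lerDl.
    by rewrite -ler_pdivlMr//; near: t; apply: nbhs_right_le; rewrite divr_gt0.
  have -> : f - T t f = (f - u) + ((u - T t u) + (T t u - T t f)).
    by rewrite !subrKA.
  have -> : e = e / 3 + (e / 3 + e / 3) by field.
  apply: le_trans (ler_normD _ _) (lerD _ (le_trans (ler_normD _ _) (lerD _
    _))).
  + by rewrite distrC.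
  + by rewrite distrC; apply: le_trans (hille_yosida_lipschitz t0 Auw) tw.
  + exact: le_trans (hille_yosida_contraction maA _ _ t0) uf.
Unshelve. all: by end_near. Qed.

(** The 5 is 4 + 1: the distance from [T t g] to the single Euler step [J t g] (the case [n = 0]),
    then the expansion of that step. *)
Lemma hille_yosida_taylor t g w z : 0 <= t -> domain2 A g w z ->
  `|T t g - g + t *: w| <= 5 * t ^+ 2 * `|z|.
Proof.
move=> t0 gwz; have := hille_yosida_close maA 0 t0 gwz.
rewrite /euler /= expr0 !divr1 => h1.
have h2 := resolvent_taylor maA t0 gwz.
have -> : T t g - g + t *: w = (T t g - J t g) + (J t g - (g - t *: w)).
  by rewrite subrKA opprB -addrA (addrC (- g)).
apply: le_trans (ler_normD _ _) (le_trans (lerD h1 h2) _); lra.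
Qed.

(** The expansion is available only on [domain2]. There [J h u] approximates [u] in the graph norm:
    its image is [J h w], close to [w], so both replacement errors are at most [t * |w - J h w|],
    small relative to [t]. *)
Lemma hille_yosida_generates u w : A u w -> generates T u (- w).
Proof.
move=> Auw; apply/generatesP => e e0.
have e3 : 0 < e / 3 by rewrite divr_gt0.
have [h h0 hw] := resolvent_cvg maA w e3.
have [z Az] := resolvent_domain maA w h0.
have ge : domain2 A (J h u) (J h w) z.
  by split => //; apply: resolvent_graph => //; exact: ltW.
have d : A (u - J h u) (w - J h w) by exact: accretiveB Auw ge.1.
have z1 : 0 < 5 * (`|z| + 1) by rewrite mulr_gt0// ltr_wpDl.
near=> t; have t0 : 0 <= t by near: t; exact: nbhs_right_ge.
have tz : t * (5 * `|z|) <= e / 3.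
  apply: (@le_trans _ _ (t * (5 * (`|z| + 1)))).
    by rewrite ler_wpM2l// ler_wpM2l// lerDl.
  by rewrite -ler_pdivlMr//; near: t; apply: nbhs_right_le; rewrite divr_gt0.
rewrite scalerN opprK.
have -> : T t u - u + t *: w = (T t (u - J h u) - (u - J h u)) +
  ((T t (J h u) - J h u + t *: J h w) + t *: (w - J h w)).
  rewrite hille_yosidaB// scalerBr (opprB u).
  rewrite [X in _ = _ + X]addrC (addrC _ (t *: J h w)) subrKA.
  by rewrite [X in _ = _ + X]addrC addrACA subrKA addrA subrKA.
have -> : e * t = t * (e / 3) + (t * (e / 3) + t * (e / 3)) by field.
apply: le_trans (ler_normD _ _) (lerD _ (le_trans (ler_normD _ _) (lerD _ _))).
- apply: le_trans (hille_yosida_lipschitz t0 d) _.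
  by rewrite ler_wpM2l// distrC.
- apply: le_trans (hille_yosida_taylor t0 ge) _.
  by apply: le_trans (ler_wpM2l t0 tz); lra.
- by rewrite normrZ ger0_norm// ler_wpM2l// distrC.
Unshelve. all: by end_near. Qed.

Lemma generatesB (S : R -> E -> E) u v u' v' : csemigroup S ->
  generates S u v -> generates S u' v' -> generates S (u - u') (v - v').
Proof.
move=> csgS gu gu'; apply: cvg_trans (cvgB gu gu').
apply: near_eq_cvg; near=> t.
have t0 : 0 <= t by near: t; exact: nbhs_right_ge.
rewrite -[LHS]/(t^-1 *: (S t u - u) - t^-1 *: (S t u' - u')) -scalerBr (csgB
  csgS _ _ t0).
by rewrite !opprD !opprK addrACA.
Unshelve. all: by end_near. Qed.

(* A generator is dissipative, hence has no eigenvalue 1. *)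
Lemma generates_id_eq0 (S : R -> E -> E) u : csemigroup S ->
  generates S u u -> u = 0.
Proof.
move=> csgS /generatesP gu; apply/eqP; rewrite -normr_le0.
apply/ler_addgt0Pr => e e0; rewrite add0r.
near (0 : R)^'+ => t.
have t0 : 0 < t by near: t; exact: nbhs_right_gt.
have h : `|S t u - u - t *: u| <= e * t by near: t; exact: gu.
have Su := csg_norm csgS u (ltW t0).
rewrite -(ler_pM2r t0).
have : `|(1 + t) *: u| <= `|S t u - u - t *: u| + `|S t u|.
  have -> : (1 + t) *: u = S t u - (S t u - u - t *: u).
    by rewrite scalerDl scale1r -addrA -opprD subKr.
  by rewrite [leRHS]addrC ler_normB.
rewrite normrZ gtr0_norm ?addr_gt0//; nra.
Unshelve. all: by end_near. Qed.

(** No proper extension of - A generates a semigroup: if [u'] in the domain solves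
    [u' + w' = u + w], then [u - u'] is fixed by the generator of [T], hence zero. *)
Theorem hille_yosida_generator u w : generates T u (- w) <-> A u w.
Proof.
split; last exact: hille_yosida_generates.
move=> gu; have [u' [w' [Auw' e]]] := ma_range maA (u + w) ltr01.
rewrite scale1r in e.
have := generatesB hille_yosida_csemigroup gu (hille_yosida_generates Auw').
have -> : - w - - w' = u - u'.
  by apply/eqP; rewrite opprK eq_sym subr_eq -addrA (addrC w') e (addrC u)
    addKr.
move=> /(generates_id_eq0 hille_yosida_csemigroup)/eqP.
rewrite subr_eq0 => /eqP uu'; move: e; rewrite -uu' => /addrI ww'.
by rewrite uu' -ww'.
Qed.

(** On [domain2], [S h] and [J h] share the first-order expansion [g - h *: w], each with error h^2
    [|z|]. Over 2^n steps this makes [S t] a limit of the Euler approximations too. *)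
Theorem hille_yosida_unique (S : R -> E -> E) : csemigroup S ->
  (forall u w, A u w -> generates S u (- w)) ->
  forall t, 0 <= t -> S t =1 T t.
Proof.
move=> csgS gS t t0; apply: (eq_domain2 maA).
- by move=> f g; exact: csg_contraction.
- by move=> f g; exact: hille_yosida_contraction.
move=> g w z gwz; apply/esym; apply: cvg_lim => //.
apply/cvgrPdist_le => e e0.
have C0 : 0 <= 2 * t ^+ 2 * `|z| by rewrite !mulr_ge0// sqr_ge0.
have [N HN] := exists_half_pow_le C0 e0.
exists N => // n /= Nn; apply: le_trans (HN n Nn).
pose h := t / 2 ^+ n; have h0 : 0 <= h by rewrite divr_ge0// exprn_ge0.
have tE : t = (2 ^ n)%:R * h.
  by rewrite /h natrX mulrCA divff ?mulr1// expf_neq0.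
rewrite {1}tE csgMn// /euler -/h.
pose P g := exists w z', domain2 A g w z' /\ `|z'| <= `|z|.
apply: le_trans (@iter_contraction_close _ _ _ _ P (2 * h ^+ 2 * `|z|) _ _ _ _
  _ _) _.
- by move=> f f'; exact: csg_contraction.
- move=> g' [w' [z' [g'w'z' z'z]]]; exists (J h w'), (J h z').
  split; first exact: resolvent_domain2.
  exact: le_trans (resolvent_norm maA _ _) z'z.
- move=> g' [w' [z' [g'w'z' z'z]]].
  have h1 := resolvent_taylor maA h0 g'w'z'; rewrite distrC in h1.
  (* The generator is the negative of [A], so it sends [g'] to [- w'] and [- w'] to [z']. *)
  have gN := gS _ _ (accretiveN maA g'w'z'.2); rewrite opprK in gN.
  have h2 : `|S h g' - (g' - h *: w')| <= h ^+ 2 * `|z'|.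
    rewrite opprB (addrC (h *: w')) addrA -[h *: w']opprK -scalerN.
    by have := generates_taylor csgS (gS _ _ g'w'z'.1) gN h0.
  rewrite -(subrKA (g' - h *: w')).
  apply: le_trans (ler_normD _ _) (le_trans (lerD h2 h1) _).
  by have := ler_wpM2l (sqr_ge0 h) z'z; lra.
- by exists w, z.
- rewrite le_eqVlt; apply/orP; left; apply/eqP.
  by rewrite natrX /h; field; rewrite expf_neq0.
Qed.

(** Invariance is inherited by Euler products and then by their limits; it is meant for the cone of
    nonnegative functions. *)
Lemma hille_yosida_closed (K : E -> Prop) :
  (forall u w h, 0 < h -> A u w -> K (u + h *: w) -> K u) ->
  (forall (u : nat -> E) l, (forall n, K (u n)) -> u n @[n --> \oo] --> l -> K
    l) ->
  forall t f, 0 <= t -> K f -> K (T t f).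
Proof.
move=> KJ Kcl t f t0 Kf.
apply: (Kcl (fun n => euler A n t f)); last exact: cvg_euler.
move=> n.
rewrite /euler; elim: (2 ^ n)%N => //= N KN.
have [h0|h0] := ltP 0 (t / 2 ^+ n); last by rewrite {1}/resolvent ltNge h0.
have [w Aw e] := resolventP maA (iter N (J (t / 2 ^+ n)) f) h0.
by apply: KJ h0 Aw _; rewrite e.
Qed.

End HilleYosidaTheorem.

Lemma near0_norm (R : realFieldType) (P : R -> Prop) :
  (\forall h \near 0^'+, P h) -> \forall h \near (0 : R)^', P `|h|.
Proof.
move=> [d /= d0 hd]; exists d => //= h; rewrite /ball_/= sub0r normrN => hd' h0.
apply: hd => /=; last by rewrite normr_gt0.
by rewrite sub0r normrN normr_id.
Qed.

(** * Continuity and two-sided differentiability of orbits *)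

Section Laplace.
Variables (R : realType) (E : normedModType R) (S : R -> E -> E).
Hypothesis csgS : csemigroup S.

(** Contractivity moves the right continuity at 0 to every time: the increment between two times is
    bounded by the increment from 0 over the same length. *)
Lemma csemigroup_continuous f t : 0 < t -> {for t, continuous (S^~ f)}.
Proof.
move=> t0; apply/cvgrPdist_le => e e0.
have Sf : \forall h \near 0^'+, `|f - S h f| <= e.
  by have /cvgrPdist_le := @csg_cvg _ _ _ csgS f; exact.
have main s r : 0 <= s -> 0 < r -> `|f - S r f| <= e -> `|S (s + r) f - S s f|
  <= e.
  move=> s0 /ltW r0 hr; rewrite csg_D//.
  by apply: le_trans (csg_contraction csgS _ _ s0) _; rewrite distrC.
move: Sf => [d /= d0 hd].
near=> s; have s0 : 0 < s by near: s; exact: lt_nbhsr.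
have std : `|t - s| < d by near: s; exists d.
have [->|] := eqVneq s t; first by rewrite subrr normr0; exact: ltW.
rewrite neq_lt => /orP[st|ts].
  have := main s (t - s) (ltW s0); rewrite subrKC; apply;
    first by rewrite subr_gt0.
  by apply: hd; rewrite /= ?sub0r ?normrN// subr_gt0.
rewrite distrC; have := main t (s - t) (ltW t0); rewrite subrKC; apply.
  by rewrite subr_gt0.
by apply: hd; rewrite /= ?sub0r ?normrN 1?distrC// subr_gt0.
Unshelve. all: by end_near. Qed.

(** The generator gives only a right derivative at 0. For h > 0 factor out [S t]; for h = -k < 0
    factor out [S (t - k)], at the extra cost [k * |S k v - v|], whence the two halves of [e]. *)
Lemma csemigroup_diff u v t : generates S u v -> 0 < t ->
  forall e, 0 < e ->
  \forall h \near 0^', `|S (h + t) u - S t u - h *: S t v| <= e * `|h|.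
Proof.
move=> gS t0 e e0; have e2 : 0 < e / 2 by rewrite divr_gt0.
have g1 : \forall h \near (0 : R)^', `|S `|h| u - u - `|h| *: v| <= e / 2 *
  `|h|.
  apply: (@near0_norm _ (fun h => `|S h u - u - h *: v| <= e / 2 * h)).
  by move/generatesP : gS; exact.
have g2 : \forall h \near (0 : R)^', `|v - S `|h| v| <= e / 2.
  apply: (@near0_norm _ (fun h => `|v - S h v| <= e / 2)).
  by have /cvgrPdist_le := @csg_cvg _ _ _ csgS v; exact.
near=> h.
have h1 : `|S `|h| u - u - `|h| *: v| <= e / 2 * `|h| by near: h.
have h2 : `|v - S `|h| v| <= e / 2 by near: h.
have ht : `|h| < t by near: h; apply: dnbhs0_lt.
have t0' := ltW t0.
have th0 : 0 <= t + h by move: ht; rewrite ltr_norml => /andP[]; lra.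
have [h0|h0] := leP 0 h.
  rewrite ger0_norm// in h1 h2 *.
  rewrite (addrC h) csg_D// -(csgZ csgS)// -!(csgB csgS)//.
  apply: le_trans (csg_norm csgS _ t0') _.
  by apply: le_trans h1 _; rewrite ler_wpM2r//; lra.
rewrite ltr0_norm// in h1 h2 *; set k := - h in h1 h2 *.
have k0 : 0 <= k by rewrite oppr_ge0 ltW.
have tE : t = (h + t) + k by rewrite /k addrAC subrr add0r.
have hk : h = - k by rewrite /k opprK.
rewrite addrC in th0; set s := h + t in th0 tE *; clearbody s k.
have Et z : S t z = S s (S k z) by rewrite {1}tE csg_D.
have -> : S s u - S t u - h *: S t v =
    S s (k *: (S k v - v)) - S s (S k u - u - k *: v).
  rewrite !Et hk scaleNr opprK !(csgZ csgS)// !(csgB csgS)// !(csgZ csgS)//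
    scalerBr.
  by rewrite (opprB _ (k *: S s v)) (opprB _ (S s u)) subrKA [RHS]addrC.
apply: le_trans (ler_normB _ _) _.
apply: le_trans (lerD (csg_norm csgS _ th0) (le_trans (csg_norm csgS _ th0)
  h1)) _.
rewrite normrZ ger0_norm// distrC.
apply: le_trans (lerD (ler_wpM2l k0 h2) (lexx _)) _.
by rewrite le_eqVlt; apply/orP; left; apply/eqP; field.
Unshelve. all: by end_near. Qed.
End Laplace.

(** * Sums and weighted square-summable families *)

Section Rsum.
Variables (R : realType) (I : choiceType).
Implicit Types (f g h : I -> R) (X : {fset I}).

Lemma esum_le_fin f (C : R) : (forall i, 0 <= f i) ->
  (\esum_(i in [set: I]) (f i)%:E <= C%:E)%E <->
  (forall X, \sum_(i <- X) f i <= C).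
Proof.
move=> f0; split=> [h X|h].
  rewrite -lee_fin -sumEFin; apply: le_trans h; apply: esum_ge.
  exists [set` X]; first by split => //; exact: finite_fset.
  by rewrite fsbig_finite//= set_fsetK.
apply: ge_ereal_sup => _ [X [finX _] <-].
by rewrite fsbig_finite//= sumEFin lee_fin.
Qed.

Definition absum f : Prop := (\esum_(i in [set: I]) `|f i|%:E < +oo)%E.

Lemma absumP f : absum f <-> exists C, forall X, \sum_(i <- X) `|f i| <= C.
Proof.
split=> [fS|[C fC]]; last first.
  by apply: le_lt_trans (ltry C); apply/esum_le_fin.
exists (fine (\esum_(i in [set: I]) `|f i|%:E)); apply/esum_le_fin => //.
rewrite fineK//; apply/fin_numPlt; rewrite fS andbT.
by apply: lt_le_trans (ltNyr 0) _; apply: esum_ge0 => i _; rewrite lee_fin.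
Qed.

Lemma absum_le f g : (forall i, `|f i| <= `|g i|) -> absum g -> absum f.
Proof.
by move=> fg; apply: le_lt_trans; apply: le_esum => i _; rewrite lee_fin.
Qed.

Lemma absumD f g : absum f -> absum g -> absum (fun i => f i + g i).
Proof.
move=> /absumP[C fC] /absumP[D gD]; apply/absumP; exists (C + D) => X.
apply: le_trans (lerD (fC X) (gD X)); rewrite -big_split/=.
by apply: ler_sum => i _; exact: ler_normD.
Qed.

Lemma absumZ a f : absum f -> absum (fun i => a * f i).
Proof.
move=> /absumP[C fC]; apply/absumP; exists (`|a| * C) => X.
apply: le_trans (ler_wpM2l _ (fC X)) => //; rewrite mulr_sumr.
by apply: ler_sum => i _; rewrite normrM.
Qed.

Lemma absum_fin_num f : (forall i, 0 <= f i) -> absum f ->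
  \esum_(i in [set: I]) (f i)%:E \is a fin_num.
Proof.
move=> f0 fS; apply/fin_numPlt; apply/andP; split.
  by apply: lt_le_trans (ltNyr 0) _; apply: esum_ge0 => i _; rewrite lee_fin.
apply: le_lt_trans fS; apply: le_esum => i _.
by rewrite lee_fin ler_norm.
Qed.

(** Any splitting into two nonnegative summable families computes [rsum]. Additivity rests on this,
    since the positive part of a sum is not the sum of the positive parts. *)
Lemma rsumB f g : (forall i, 0 <= f i) -> (forall i, 0 <= g i) ->
  absum f -> absum g ->
  rsum (fun i => f i - g i) = fine (\esum_(i in [set: I]) (f i)%:E)
                            - fine (\esum_(i in [set: I]) (g i)%:E).
Proof.
move=> f0 g0 fS gS; rewrite /rsum -fineB ?absum_fin_num//.
have sm (h : I -> R) : absum h -> summable [set: I] (EFin \o h).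
  by rewrite /absum/summable/=.
rewrite -(@esumB _ _ setT (EFin \o f) (EFin \o g) (sm _ fS) (sm _ gS));
  last 2 first.
- by move=> i _; rewrite lee_fin.
- by move=> i _; rewrite lee_fin.
have -> : ((EFin \o f) \- (EFin \o g))%E = EFin \o (fun i => f i - g i).
  by apply/funext => i.
by rewrite funerpos funerneg.
Qed.

Lemma ge0_rsum f : (forall i, 0 <= f i) -> absum f ->
  (rsum f)%:E = (\esum_(i in [set: I]) (f i)%:E)%E.
Proof.
move=> f0 fS; have s0 : absum (fun=> 0 : R).
  by apply: absum_le fS => i; rewrite normr0.
have := rsumB f0 (fun=> lexx 0) fS s0.
under [X in rsum X]eq_fun do rewrite subr0.
move=> ->; rewrite [X in _ - fine X]esum1//= subr0 fineK//.
exact: absum_fin_num.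
Qed.

Lemma absum_pos f : absum f -> absum f^\+.
Proof.
apply: absum_le => i; rewrite ger0_norm ?funrpos_ge0//.
by rewrite -[leRHS]/((Num.norm \o f) i) -funrposDneg lerDl funrneg_ge0.
Qed.

Lemma absum_neg f : absum f -> absum f^\-.
Proof.
apply: absum_le => i; rewrite ger0_norm ?funrneg_ge0//.
by rewrite -[leRHS]/((Num.norm \o f) i) -funrposDneg lerDr funrpos_ge0.
Qed.

Lemma rsumE f : absum f -> rsum f = fine (\esum_(i in [set: I]) (f^\+ i)%:E)
                                 - fine (\esum_(i in [set: I]) (f^\- i)%:E).
Proof.
move=> fS; rewrite -rsumB//; first by rewrite -[in LHS](funrposBneg f).
- exact: absum_pos.
- exact: absum_neg.
Qed.

Let fine_esumD f g : (forall i, 0 <= f i) -> (forall i, 0 <= g i) ->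
    absum f -> absum g ->
  fine (\esum_(i in [set: I]) (f i + g i)%:E) =
  fine (\esum_(i in [set: I]) (f i)%:E) + fine (\esum_(i in [set: I]) (g i)%:E).
Proof.
move=> f0 g0 fS gS; rewrite -fineD ?absum_fin_num// -esumD//; move=> i _;
by rewrite lee_fin.
Qed.

Lemma rsumD f g : absum f -> absum g ->
  rsum (fun i => f i + g i) = rsum f + rsum g.
Proof.
move=> fS gS.
have -> : (fun i => f i + g i) =
    (fun i => (f^\+ i + g^\+ i) - (f^\- i + g^\- i)).
  apply/funext => i; rewrite -{1}(funrposBneg f) -{1}(funrposBneg g).
  by rewrite opprD addrACA.
have [fp gp] := (absum_pos fS, absum_pos gS).
have [fn gn] := (absum_neg fS, absum_neg gS).
rewrite rsumB.
- by rewrite !fine_esumD// !rsumE// opprD addrACA.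
- by move=> i; rewrite addr_ge0.
- by move=> i; rewrite addr_ge0.
- exact: absumD.
- exact: absumD.
Qed.

Lemma rsumN f : absum f -> rsum (fun i => - f i) = - rsum f.
Proof.
move=> fS; rewrite [in RHS]rsumE// opprB -rsumB//.
- congr rsum; apply/funext => i; rewrite -{1}(funrposBneg f).
  by rewrite -[LHS]/(- (f^\+ i - f^\- i)) opprB.
- exact: absum_neg.
- exact: absum_pos.
Qed.

Let fine_esumZ a f : 0 <= a -> (forall i, 0 <= f i) -> absum f ->
  fine (\esum_(i in [set: I]) (a * f i)%:E) =
  a * fine (\esum_(i in [set: I]) (f i)%:E).
Proof.
move=> a0 f0 fS; have -> : \esum_(i in [set: I]) (a * f i)%:E =
    (a%:E * \esum_(i in [set: I]) (f i)%:E)%E.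
  rewrite /esum -ereal_supZl//; last first.
    by apply/set0P; exists (\sum_(i \in set0) (f i)%:E)%E; exists set0 => //;
      split.
  rewrite image_comp; congr ereal_sup; apply: eq_imagel => X [finX _] /=.
  by rewrite !fsbig_finite//= !sumEFin -EFinM mulr_sumr.
by rewrite fineM// absum_fin_num.
Qed.

Lemma rsumZ a f : absum f -> rsum (fun i => a * f i) = a * rsum f.
Proof.
have pos c : 0 <= c -> absum f -> rsum (fun i => c * f i) = c * rsum f.
  move=> c0 fS.
  have -> : (fun i => c * f i) = (fun i => c * f^\+ i - c * f^\- i).
    by apply/funext => i; rewrite -mulrBr -{1}(funrposBneg f).
  rewrite rsumB.
  - rewrite !fine_esumZ//; last 2 first.
    + exact: absum_neg.
    + exact: absum_pos.
    by rewrite -mulrBr -rsumE.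
  - by move=> i; rewrite mulr_ge0.
  - by move=> i; rewrite mulr_ge0.
  - exact/absumZ/absum_pos.
  - exact/absumZ/absum_neg.
move=> fS; have [a0|/ltW a0] := leP 0 a; first exact: pos.
have -> : (fun i => a * f i) = (fun i => - ((- a) * f i)).
  by apply/funext => i; rewrite mulNr opprK.
rewrite rsumN; last exact: absumZ.
by rewrite pos ?oppr_ge0// mulNr opprK.
Qed.

Lemma rsum_ge0 f : (forall i, 0 <= f i) -> absum f -> 0 <= rsum f.
Proof.
move=> f0 fS; rewrite -lee_fin ge0_rsum//; apply: esum_ge0 => i _.
by rewrite lee_fin.
Qed.

Lemma sum_le_rsum f X : (forall i, 0 <= f i) -> absum f ->
  \sum_(i <- X) f i <= rsum f.
Proof. by move=> f0 fS; move: X; apply/esum_le_fin => //; rewrite ge0_rsum. Qed.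

Lemma rsum_le f C : (forall i, 0 <= f i) -> (forall X, \sum_(i <- X) f i <= C)
  ->
  absum f /\ rsum f <= C.
Proof.
move=> f0 fC; have fS : absum f.
  apply/absumP; exists C => X.
  by under eq_bigr do rewrite ger0_norm//.
by split => //; rewrite -lee_fin ge0_rsum//; apply/esum_le_fin.
Qed.

Lemma ler_rsum f g : (forall i, 0 <= f i) -> (forall i, f i <= g i) -> absum g
  ->
  absum f /\ rsum f <= rsum g.
Proof.
move=> f0 fg gS; apply: rsum_le => // X.
apply: le_trans (sum_le_rsum X _ gS); first exact: ler_sum.
by move=> i; exact: le_trans (fg i).
Qed.

Lemma rsum_finite_supp f X : (forall i, i \notin X -> f i = 0) ->
  absum f /\ rsum f = \sum_(i <- X) f i.
Proof.
have pos g : (forall i, 0 <= g i) -> (forall i, i \notin X -> g i = 0) ->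
    absum g /\ rsum g = \sum_(i <- X) g i.
  move=> g0 gX; have [gS gle] : absum g /\ rsum g <= \sum_(i <- X) g i.
    apply: rsum_le => // Y.
    rewrite (big_fsetID _ (mem X)) /= [X in _ + X]big1_fset ?addr0; last first.
      by move=> i; rewrite !inE/= => /andP[_ /gX].
    apply: (@le_trans _ _ (\sum_(i <- Y `&` X) g i)%fset).
      by rewrite le_eqVlt; apply/orP; left; apply/eqP; apply: eq_fbigl => i;
        rewrite !inE.
    rewrite [leRHS](big_fsetID _ (mem Y))/= ler_wpDr ?sumr_ge0//.
    by rewrite le_eqVlt; apply/orP; left; apply/eqP; apply: eq_fbigl => i;
      rewrite !inE andbC.
  by split => //; apply/eqP; rewrite eq_le gle sum_le_rsum.
move=> fX.
have [|pS pE] := pos f^\+ (funrpos_ge0 f); first by move=> i /fX fi;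
  rewrite /funrpos fi maxxx.
have [|nS nE] := pos f^\- (funrneg_ge0 f); first by move=> i /fX fi;
  rewrite /funrneg fi oppr0 maxxx.
have fE : f = (fun i => f^\+ i + -1 * f^\- i).
  by apply/funext => i; rewrite mulN1r -{1}(funrposBneg f).
have nS' : absum (fun i => -1 * f^\- i) by exact: absumZ.
split; first by rewrite fE; exact: absumD.
rewrite [in LHS]fE rsumD// rsumZ// pE nE mulr_sumr -big_split/=.
by apply: eq_bigr => i _; rewrite [in RHS]fE.
Qed.

End Rsum.

(** For b > 0 evaluate at the minimiser -c/b. For b = 0 the polynomial is affine, and if c were
    nonzero it would take the value -1 at -(a + 1)/(2c). *)
Lemma discriminant_le (R : realFieldType) (a b c : R) : 0 <= b ->
  (forall t, 0 <= a + 2 * t * c + t ^+ 2 * b) -> c ^+ 2 <= a * b.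
Proof.
rewrite le_eqVlt => /predU1P[<-|b0] h.
  have [->|c0] := eqVneq c 0; first by rewrite expr0n/= mulr0.
  have := h (- (a + 1) / (2 * c)).
  have -> : a + 2 * (- (a + 1) / (2 * c)) * c + (- (a + 1) / (2 * c)) ^+ 2 * 0
    = -1.
    by field.
  lra.
have := h (- c / b).
have -> : a + 2 * (- c / b) * c + (- c / b) ^+ 2 * b = (a * b - c ^+ 2) / b.
  by field; exact: lt0r_neq0.
by rewrite pmulr_lge0 ?invr_gt0// subr_ge0.
Qed.

(** The domain is explicit because [rsum] is linear only on summable families, and because [Dtilde],
    [ell2] and their intersection all occur. Definiteness is not asked for: the energy vanishes on
    constants. *)
Record semi_inner (R : realType) (X : lmodType R) (D : X -> Prop)
    (B : X -> X -> R) : Prop := SemiInner {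
  si_dom : forall a u v, D u -> D v -> D (a *: u + v);
  si_dom0 : D 0;
  si_linear : forall a u v w, D u -> D v -> D w ->
    B (a *: u + v) w = a * B u w + B v w;
  si_sym : forall u v, B u v = B v u;
  si_ge0 : forall u, D u -> 0 <= B u u
}.

Section SemiInner.
Variables (R : realType) (X : lmodType R) (D : X -> Prop) (B : X -> X -> R).
Hypothesis siB : semi_inner D B.

Lemma si_domZ a u : D u -> D (a *: u).
Proof. by move=> Du; rewrite -[_ *: _]addr0;
  apply: (si_dom siB) (si_dom0 siB). Qed.

Lemma si_domD u v : D u -> D v -> D (u + v).
Proof. by move=> Du Dv; rewrite -[u]scale1r; exact: (si_dom siB). Qed.

Lemma si_domN u : D u -> D (- u).
Proof. by move=> Du; rewrite -scaleN1r; exact: si_domZ. Qed.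

Lemma si_domB u v : D u -> D v -> D (u - v).
Proof. by move=> Du Dv; apply: si_domD => //; exact: si_domN. Qed.

Lemma siDl u v w : D u -> D v -> D w -> B (u + v) w = B u w + B v w.
Proof.
by move=> Du Dv Dw; rewrite -[u in LHS]scale1r (si_linear siB)// mul1r.
Qed.

Lemma siZl a u w : D u -> D w -> B (a *: u) w = a * B u w.
Proof.
move=> Du Dw; rewrite -[a *: u]addr0 (si_linear siB)//;
  last exact: (si_dom0 siB).
suff -> : B 0 w = 0 by rewrite addr0.
have := siDl (si_dom0 siB) (si_dom0 siB) Dw.
by rewrite addr0 -[LHS]addr0 => /addrI.
Qed.

Lemma siNl u w : D u -> D w -> B (- u) w = - B u w.
Proof. by move=> Du Dw; rewrite -scaleN1r siZl// mulN1r. Qed.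

Lemma siBl u v w : D u -> D v -> D w -> B (u - v) w = B u w - B v w.
Proof. by move=> Du Dv Dw; rewrite siDl ?siNl//; exact: si_domN. Qed.

Lemma siDr u v w : D u -> D v -> D w -> B w (u + v) = B w u + B w v.
Proof. by move=> Du Dv Dw; rewrite !(si_sym siB w) siDl. Qed.

Lemma siZr a u w : D u -> D w -> B w (a *: u) = a * B w u.
Proof. by move=> Du Dw; rewrite !(si_sym siB w) siZl. Qed.

Lemma siBr u v w : D u -> D v -> D w -> B w (u - v) = B w u - B w v.
Proof. by move=> Du Dv Dw; rewrite !(si_sym siB w) siBl. Qed.

Lemma si_sqD a u v : D u -> D v ->
  B (u + a *: v) (u + a *: v) = B u u + 2 * a * B u v + a ^+ 2 * B v v.
Proof.
move=> Du Dv; have Dav := si_domZ a Dv.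
rewrite siDl//; last exact: si_domD.
rewrite !siDr// !siZl// !siZr// (si_sym siB v u); ring.
Qed.

Lemma si_sqZ a u : D u -> B (a *: u) (a *: u) = a ^+ 2 * B u u.
Proof.
by move=> Du; rewrite siZl ?siZr ?mulrA//; exact: si_domZ.
Qed.

Lemma si_sqB u v : D u -> D v ->
  B (u - v) (u - v) = B u u - 2 * B u v + B v v.
Proof. by move=> Du Dv; rewrite -scaleN1r si_sqD//; ring. Qed.

Lemma si_sqBC u v : D u -> D v -> B (u - v) (u - v) = B (v - u) (v - u).
Proof. by move=> Du Dv; rewrite !si_sqB// (si_sym siB u v); ring. Qed.

Lemma si_parallelogram u v : D u -> D v ->
  B (u - v) (u - v) = 2 * B u u + 2 * B v v - B (u + v) (u + v).
Proof.
move=> Du Dv; have := si_sqD 1 Du Dv; rewrite scale1r => ->.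
by rewrite si_sqB//; ring.
Qed.

Lemma si_cauchy_schwarz u v : D u -> D v -> B u v ^+ 2 <= B u u * B v v.
Proof.
move=> Du Dv; apply: discriminant_le => [|t]; first exact: (si_ge0 siB).
by rewrite -si_sqD//; apply: (si_ge0 siB); apply: si_domD => //; exact: si_domZ.
Qed.

Lemma si_cauchy_schwarz_sqrt u v : D u -> D v ->
  `|B u v| <= Num.sqrt (B u u) * Num.sqrt (B v v).
Proof.
move=> Du Dv; rewrite -sqrtr_sqr -sqrtrM ?(si_ge0 siB)//.
by rewrite ler_wsqrtr// si_cauchy_schwarz.
Qed.

Lemma si_triangle u v : D u -> D v ->
  Num.sqrt (B (u + v) (u + v)) <= Num.sqrt (B u u) + Num.sqrt (B v v).
Proof.
move=> Du Dv; rewrite -[leRHS]ger0_norm ?addr_ge0 ?sqrtr_ge0// -sqrtr_sqr.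
have := si_sqD 1 Du Dv; rewrite scale1r => ->.
have := le_trans (ler_norm _) (si_cauchy_schwarz_sqrt Du Dv).
move=> h; apply: ler_wsqrtr; rewrite sqrrD !sqr_sqrtr ?(si_ge0 siB)//.
by rewrite mulr1 expr1n mul1r lerD2r lerD2l -[leRHS]mulr_natl ler_pM2l.
Qed.

Lemma si_sqD_le u v : D u -> D v ->
  B (u + v) (u + v) <= 2 * B u u + 2 * B v v.
Proof.
move=> Du Dv; have := si_ge0 siB (si_domB Du Dv).
by rewrite si_parallelogram// subr_ge0.
Qed.

End SemiInner.

Lemma semi_innerD (R : realType) (X : lmodType R) (D D' : X -> Prop)
    (B B' : X -> X -> R) (h : R) : 0 <= h -> semi_inner D B ->
  semi_inner D' B' ->
  semi_inner (fun u => D u /\ D' u) (fun u v => h * B u v + B' u v).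
Proof.
move=> h0 [d d0 l s g] [d' d'0 l' s' g']; split.
- by move=> a u v [Du D'u] [Dv D'v]; split; [exact: d|exact: d'].
- by [].
- move=> a u v w [Du D'u] [Dv D'v] [Dw D'w]; rewrite l// l'//; ring.
- by move=> u v; rewrite s s'.
- by move=> u [Du D'u]; rewrite addr_ge0 ?mulr_ge0 ?g ?g'.
Qed.

(** * Weighted square-summable families *)

Section WeightedIp.
Variables (R : realType) (I : choiceType) (W : I -> R).
Hypothesis W0 : forall i, 0 <= W i.
Implicit Types f g h : I -> R.

Definition sqsum f : Prop := absum (fun i => W i * f i ^+ 2).

Definition ip f g : R := rsum (fun i => W i * f i * g i).

Lemma sqsum_absum f g : sqsum f -> sqsum g -> absum (fun i => W i * f i * g i).
Proof.
move=> fS gS; apply: absum_le (absumD fS gS) => i.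
rewrite -mulrDr -mulrA !normrM ler_wpM2l//.
rewrite [leRHS]ger0_norm ?addr_ge0 ?sqr_ge0// -(real_normK (num_real (f i))).
rewrite -(real_normK (num_real (g i))).
have := sqr_ge0 (`|f i| - `|g i|); have := mulr_ge0 (normr_ge0 (f i))
  (normr_ge0 (g i)).
nra.
Qed.

Lemma ipE f : ip f f = rsum (fun i => W i * f i ^+ 2).
Proof. by congr rsum; apply/funext => i; rewrite -mulrA. Qed.

Lemma sqsum_finite_supp f (X : {fset I}) : (forall i, i \notin X -> f i = 0) ->
  sqsum f.
Proof.
move=> fX; apply: (proj1 (@rsum_finite_supp _ _ _ X _)) => i /fX ->.
by rewrite expr0n/= mulr0.
Qed.

Lemma semi_inner_ip : semi_inner sqsum ip.
Proof.
split.
- move=> a f g fS gS; apply: absum_le (absumD (absumZ (2 * a ^+ 2) fS) (absumZ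
    2 gS)) => i.
  rewrite -[(_ + _) i]/(a * f i + g i) !ger0_norm.
  + have := mulr_ge0 (W0 i) (sqr_ge0 (a * f i - g i)); nra.
  + have f0 := mulr_ge0 (W0 i) (sqr_ge0 (f i)).
    have g0 := mulr_ge0 (W0 i) (sqr_ge0 (g i)).
    by apply: addr_ge0; apply: mulr_ge0 => //; apply: mulr_ge0 => //;
      exact: sqr_ge0.
  + by rewrite mulr_ge0// sqr_ge0.
- by apply: (@sqsum_finite_supp _ fset0).
- move=> a f g h fS gS hS; rewrite /ip -rsumZ; last exact: sqsum_absum.
  rewrite -rsumD; [|exact/absumZ/sqsum_absum|exact: sqsum_absum].
  congr rsum; apply/funext => i; rewrite -[(_ + _) i]/(a * f i + g i); ring.
- by move=> f g; congr rsum; apply/funext => i; rewrite mulrAC.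
- move=> f fS; rewrite ipE; apply: rsum_ge0 => // i.
  by rewrite mulr_ge0// sqr_ge0.
Qed.

Lemma sum_le_ip f (X : {fset I}) : sqsum f ->
  \sum_(i <- X) W i * f i ^+ 2 <= ip f f.
Proof.
by move=> fS; rewrite ipE; apply: sum_le_rsum => // i;
  rewrite mulr_ge0// sqr_ge0.
Qed.

Lemma ip_le f C : (forall X : {fset I}, \sum_(i <- X) W i * f i ^+ 2 <= C) ->
  sqsum f /\ ip f f <= C.
Proof.
by move=> fC; rewrite ipE; apply: rsum_le => // i; rewrite mulr_ge0// sqr_ge0.
Qed.

Lemma ler_ip f g : (forall i, `|f i| <= `|g i|) -> sqsum g ->
  sqsum f /\ ip f f <= ip g g.
Proof.
move=> fg gS; rewrite !ipE; apply: ler_rsum => // i.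
  by rewrite mulr_ge0// sqr_ge0.
by rewrite ler_wpM2l// -(real_normK (num_real (f i))) -(real_normK (num_real (g
  i))) lerXn2r ?nnegrE.
Qed.

Lemma esum_ip f : sqsum f ->
  (\esum_(i in [set: I]) (W i * f i ^+ 2)%:E)%E = (ip f f)%:E.
Proof. by move=> fS; rewrite ipE ge0_rsum// => i;
  rewrite mulr_ge0// sqr_ge0. Qed.

Lemma sqsumP f :
  sqsum f <-> (\esum_(i in [set: I]) (W i * f i ^+ 2)%:E < +oo)%E.
Proof.
rewrite /sqsum /absum; suff -> : (fun i => `|W i * f i ^+ 2|%:E) =
  (fun i => (W i * f i ^+ 2)%:E) by [].
by apply/funext => i; rewrite ger0_norm// mulr_ge0// sqr_ge0.
Qed.

Lemma sq_le_ip f i : sqsum f -> W i * f i ^+ 2 <= ip f f.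
Proof. by move=> /(sum_le_ip [fset i]%fset); rewrite big_seq_fset1. Qed.

Lemma cvg_sum_sqr (T : Type) (F : set_system T) (PF : ProperFilter F)
    (u : T -> I -> R) f (X : {fset I}) :
  (forall i, u t i @[t --> F] --> f i) ->
  \sum_(i <- X) W i * u t i ^+ 2 @[t --> F] --> \sum_(i <- X) W i * f i ^+ 2.
Proof.
move=> uf; apply: cvg_big => [|i _]; first exact: add_continuous.
by apply: cvgMl_tmp; rewrite expr2; under eq_fun do rewrite expr2; exact: cvgM.
Qed.

(** Each finite partial sum converges, and a common bound on partial sums bounds the whole. The
    filter is arbitrary, to serve sequences as well as Cauchy filters. *)
Lemma ip_fatou (T : Type) (F : set_system T) (PF : ProperFilter F)
    (u : T -> I -> R) f C :
  (forall i, u t i @[t --> F] --> f i) ->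
  (\forall t \near F, sqsum (u t) /\ ip (u t) (u t) <= C) ->
  sqsum f /\ ip f f <= C.
Proof.
move=> uf uC; apply: ip_le => X.
have h := @cvg_sum_sqr _ _ PF _ _ X uf.
rewrite -(cvg_lim _ h)//; apply: limr_le; first by apply/cvg_ex; eexists;
  exact: h.
near=> t; have [uS uC'] : sqsum (u t) /\ ip (u t) (u t) <= C by near: t.
exact: le_trans (sum_le_ip _ uS) uC'.
Unshelve. all: by end_near. Qed.

(* By the parallelogram law, [ip (u - f)] is small because [ip (u + f)] is at
   least about [4 * ip f f], by Fatou. *)
Lemma ip_cvg_of_le (T : Type) (F : set_system T) (PF : ProperFilter F)
    (u : T -> I -> R) f :
  sqsum f -> (forall i, u t i @[t --> F] --> f i) ->
  (forall e, 0 < e ->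
    \forall t \near F, sqsum (u t) /\ ip (u t) (u t) <= ip f f + e) ->
  forall e, 0 < e -> \forall t \near F, ip (u t - f) (u t - f) <= e.
Proof.
move=> fS uf uC e e0; have e8 : 0 < e / 8 by rewrite divr_gt0.
(* In the parallelogram identity the errors are 2 (e / 8) from the norm of [u t], 4 (e / 8) from the
   tail outside [X] and e / 4 from the convergence on [X]: together [e]. *)
have [X fX] : exists X : {fset I}, ip f f - e / 8 < \sum_(i <- X) W i * f i ^+
  2.
  apply: contrapT => /forallNP noX; have [_] : sqsum f /\ ip f f <= ip f f - e
    / 8.
    by apply: ip_le => X; rewrite leNgt; apply/negP; exact: noX.
  lra.
have h : \sum_(i <- X) W i * (u t i + f i) ^+ 2 @[t --> F] -->
    \sum_(i <- X) W i * (f i + f i) ^+ 2.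
  apply: (@cvg_sum_sqr _ _ PF (fun t i => u t i + f i) (fun i => f i + f i)) =>
    i.
  by apply: cvgD; [exact: uf|exact: cvg_cst].
have h4 : \sum_(i <- X) W i * (f i + f i) ^+ 2 = 4 * \sum_(i <- X) W i * f i ^+
  2.
  by rewrite mulr_sumr; apply: eq_bigr => i _; ring.
near=> t.
have [uS ule] : sqsum (u t) /\ ip (u t) (u t) <= ip f f + e / 8.
  by near: t; exact: uC.
have ht : 4 * \sum_(i <- X) W i * f i ^+ 2 - e / 4 <=
    \sum_(i <- X) W i * (u t i + f i) ^+ 2.
  rewrite -h4 lerBlDr -lerBlDl; near: t.
  have e4 : 0 < e / 4 by rewrite divr_gt0.
  move/cvgrPdist_le : h => /(_ _ e4); apply: filterS => t.
  exact: le_trans (ler_norm _).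
have := sum_le_ip X (si_domD semi_inner_ip uS fS).
rewrite (si_parallelogram semi_inner_ip uS fS); lra.
Unshelve. all: by end_near. Qed.

End WeightedIp.

(** * The energy form and the space of square-summable functions *)

Section GraphForms.
Variables (R : realType) (V : countType) (b : V -> V -> R) (m : V -> R).
Hypothesis b_graph : weighted_graph b (cst 0).
Hypothesis m_gt0 : forall x, 0 < m x.
Implicit Types u v f g : V -> R.

Local Notation D := (Dtilde b (cst 0)).
Local Notation Q := (Defs.form b (cst 0)).

(** With [gradient], this writes the energy as half a weighted square norm over ordered pairs; the
    half compensates for counting every edge twice. *)
Definition edge_weight (p : V * V) : R := b p.1 p.2.

Definition gradient u (p : V * V) : R := u p.1 - u p.2.

Lemma edge_weight_ge0 p : 0 <= edge_weight p.
Proof. exact: (wg_b_ge0 b_graph). Qed.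

Lemma m_ge0 x : 0 <= m x. Proof. exact: ltW. Qed.

Lemma ell2P f : ell2 m f <-> sqsum m f.
Proof.
rewrite (sqsumP m_ge0) /ell2 /=.
suff -> : (fun i => (f i ^+ 2 * m i)%:E) = (fun i => (m i * f i ^+ 2)%:E) by [].
by apply/funext => i; rewrite mulrC.
Qed.

Lemma inner2E f g : inner2 m f g = ip m f g.
Proof. by congr rsum; apply/funext => x; rewrite -[RHS]mulrA mulrC. Qed.

Let esum_cst0 u : (\esum_(x in [set: V]) ((cst 0 : V -> R) x * u x ^+ 2)%:E)%E
  = 0%E.
Proof. by rewrite esum1// => x _; rewrite mul0r. Qed.

Lemma DtildeP u : D u <-> sqsum edge_weight (gradient u).
Proof.
rewrite (sqsumP edge_weight_ge0) /Dtilde /energy /= esum_cst0 adde0.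
set S := esum _ _; have S0 : (0 <= S)%E.
  apply: esum_ge0 => p _; rewrite lee_fin mulr_ge0 ?sqr_ge0//.
  exact: edge_weight_ge0.
split=> [|SS]; last by rewrite lte_mul_pinfty ?lee_fin.
case: S S0 => [r _ _|_|//]; first by rewrite ltry.
by rewrite gt0_muley// lte_fin.
Qed.

Lemma formE u v : Q u v = 2^-1 * ip edge_weight (gradient u) (gradient v).
Proof.
rewrite /Defs.form; have -> : rsum (fun x => (cst 0 : V -> R) x * u x * v x) =
  0.
  have [|_ ->] := @rsum_finite_supp _ _ (fun x => (cst 0 : V -> R) x * u x * v
    x) fset0.
    by move=> x _; rewrite !mul0r.
  by rewrite big_seq_fset0.
by rewrite addr0.
Qed.

Lemma energyE u : D u -> energy b (cst 0) u = (Q u u)%:E.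
Proof.
move=> /DtildeP uS; rewrite /energy esum_cst0 adde0 formE EFinM.
by rewrite -(esum_ip edge_weight_ge0 uS).
Qed.

Lemma semi_inner_ell2 : semi_inner (ell2 m) (inner2 m).
Proof.
have [d d0 l s g] := semi_inner_ip m_ge0; split.
- by move=> a u v /ell2P uS /ell2P vS; apply/ell2P; exact: d.
- exact/ell2P.
- by move=> a u v w /ell2P uS /ell2P vS /ell2P wS; rewrite !inner2E; exact: l.
- by move=> u v; rewrite !inner2E.
- by move=> u /ell2P uS; rewrite inner2E; exact: g.
Qed.

Lemma semi_inner_form : semi_inner D Q.
Proof.
have [d d0 l s g] := semi_inner_ip edge_weight_ge0.
have gl a u v : gradient (a *: u + v) = a *: gradient u + gradient v.
  apply/funext => p; rewrite /gradient.
  rewrite -[(a *: u + v) p.1]/(a * u p.1 + v p.1).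
  rewrite -[(a *: u + v) p.2]/(a * u p.2 + v p.2).
  rewrite -[RHS]/(a * (u p.1 - u p.2) + (v p.1 - v p.2)); ring.
split.
- by move=> a u v /DtildeP uS /DtildeP vS; apply/DtildeP; rewrite gl; exact: d.
- apply/DtildeP; have -> // : gradient 0 = 0.
  by apply/funext => p; rewrite /gradient subrr.
- move=> a u v w /DtildeP uS /DtildeP vS /DtildeP wS.
  by rewrite !formE gl l//; ring.
- by move=> u v; rewrite !formE s.
- by move=> u /DtildeP uS; rewrite formE mulr_ge0 ?g.
Qed.

Lemma semi_inner_o o : semi_inner D (inner_o b (cst 0) o).
Proof.
have [d d0 l s g] := semi_inner_form; split => //.
- move=> a u v w uS vS wS; rewrite /inner_o l//.
  rewrite -[(a *: u + v) o]/(a * u o + v o); ring.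
- by move=> u v; rewrite /inner_o s mulrC.
- by move=> u uS; rewrite /inner_o addr_ge0 ?g// -expr2 sqr_ge0.
Qed.

Lemma form_fatou (T : Type) (F : set_system T) (PF : ProperFilter F)
    (u : T -> V -> R) f C :
  (forall x, u t x @[t --> F] --> f x) ->
  (\forall t \near F, D (u t) /\ Q (u t) (u t) <= C) ->
  D f /\ Q f f <= C.
Proof.
move=> uf uC.
have uf' p : gradient (u t) p @[t --> F] --> gradient f p.
  by apply: cvgB; exact: uf.
have uC' : \forall t \near F, sqsum edge_weight (gradient (u t)) /\
    ip edge_weight (gradient (u t)) (gradient (u t)) <= 2 * C.
  apply: filterS uC => t [/DtildeP uS]; rewrite formE => h; split => //.
  by rewrite -ler_pdivrMl.
have [/DtildeP fD fC] := ip_fatou edge_weight_ge0 PF uf' uC'.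
by split => //; rewrite formE ler_pdivrMl.
Qed.

Lemma inner2_fatou (T : Type) (F : set_system T) (PF : ProperFilter F)
    (u : T -> V -> R) f C :
  (forall x, u t x @[t --> F] --> f x) ->
  (\forall t \near F, ell2 m (u t) /\ inner2 m (u t) (u t) <= C) ->
  ell2 m f /\ inner2 m f f <= C.
Proof.
move=> uf uC.
have uC' : \forall t \near F, sqsum m (u t) /\ ip m (u t) (u t) <= C.
  by apply: filterS uC => t [/ell2P uS]; rewrite inner2E.
by have [/ell2P fS] := ip_fatou m_ge0 PF uf uC'; rewrite inner2E.
Qed.

Lemma form_cvg_of_le (T : Type) (F : set_system T) (PF : ProperFilter F)
    (u : T -> V -> R) f :
  D f -> (forall x, u t x @[t --> F] --> f x) ->
  (forall e, 0 < e -> \forall t \near F, D (u t) /\ Q (u t) (u t) <= Q f f + e)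
    ->
  forall e, 0 < e -> \forall t \near F, Q (u t - f) (u t - f) <= e.
Proof.
move=> /DtildeP fD uf uC e e0; have e2 : 0 < 2 * e by rewrite mulr_gt0.
have gB t : gradient (u t - f) = gradient (u t) - gradient f.
  apply/funext => p; rewrite /gradient.
  rewrite -[(u t - f) p.1]/(u t p.1 - f p.1).
  rewrite -[(u t - f) p.2]/(u t p.2 - f p.2).
  rewrite -[RHS]/((u t p.1 - u t p.2) - (f p.1 - f p.2)); ring.
have uf' p : gradient (u t) p @[t --> F] --> gradient f p.
  by apply: cvgB; exact: uf.
apply: filterS (ip_cvg_of_le edge_weight_ge0 PF fD uf' _ e2) => [t|e' e'0].
  by rewrite formE gB ler_pdivrMl.
have e'2 : 0 < 2^-1 * e' by rewrite mulr_gt0.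
apply: filterS (uC _ e'2) => t [/DtildeP uS]; rewrite !formE -mulrDr => h'.
by split => //; rewrite ler_pM2l in h'.
Qed.

(** Normal contractions do not increase the energy, since edge weights are nonnegative. This covers
    absolute values, clamping to [0, 1] and subtraction of constants. *)
Lemma le_form u v : (forall x y, `|u x - u y| <= `|v x - v y|) -> D v ->
  D u /\ Q u u <= Q v v.
Proof.
move=> uv /DtildeP vS.
have [uS le] := ler_ip edge_weight_ge0 (fun p => uv p.1 p.2) vS.
by split; [exact/DtildeP|rewrite !formE ler_pM2l].
Qed.

(** Needed when [u] is truncated at the variable level [v]: each difference of the result is bounded
    by the larger of the two differences. *)
Lemma le_formD u v w :
  (forall x y, (w x - w y) ^+ 2 <= (u x - u y) ^+ 2 + (v x - v y) ^+ 2) ->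
  D u -> D v -> D w /\ Q w w <= Q u u + Q v v.
Proof.
move=> uvw /DtildeP uS /DtildeP vS.
have sq0 f (p : V * V) : 0 <= edge_weight p * gradient f p ^+ 2.
  by apply: mulr_ge0; [exact: edge_weight_ge0|exact: sqr_ge0].
have uvw' p : edge_weight p * gradient w p ^+ 2 <=
    edge_weight p * gradient u p ^+ 2 + edge_weight p * gradient v p ^+ 2.
  by rewrite -mulrDr; apply: ler_wpM2l; [exact: edge_weight_ge0|exact: uvw].
have [wS le] := ler_rsum (sq0 w) uvw' (absumD uS vS).
split; first exact/DtildeP.
by rewrite !formE -mulrDr ler_pM2l// !ipE -rsumD.
Qed.

Lemma delta_lin_ind (P : (V -> R) -> Prop) :
  P 0 -> (forall a x u, P u -> P (a *: delta R x + u)) ->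
  forall u, Cc u -> P u.
Proof.
move=> P0 Pd u uC.
have -> : u = \sum_(x <- fset_set [set x | u x != 0]) u x *: delta R x.
  apply/funext => y.
  rewrite fct_sumE; have [y0|y0] := eqVneq (u y) 0.
    rewrite y0 big1_fset// => x; rewrite in_fset_set// inE/= => ux _.
    rewrite -[LHS]/(u x * (y == x)%:R); case: eqVneq => [yx|]; rewrite ?mulr0//.
    by move: ux; rewrite -yx y0 eqxx.
  rewrite (big_fsetD1 y)/=; last by rewrite in_fset_set ?inE.
  rewrite -[X in X + _]/(u y * (y == y)%:R) eqxx mulr1 big1_fset ?addr0//.
  move=> x; rewrite !inE => /andP[/negbTE xy _] _.
  by rewrite -[LHS]/(u x * (y == x)%:R) eq_sym xy mulr0.
by elim: (enum_fset _) => [|x s IH]; rewrite ?big_nil// big_cons; exact: Pd.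
Qed.

Lemma sqsum_delta x : ell2 m (delta R x).
Proof.
apply/ell2P; apply: (@sqsum_finite_supp _ _ _ _ [fset x]%fset) => y.
by rewrite inE /delta => /negbTE ->.
Qed.

Lemma Dtilde_delta x : D (delta R x).
Proof.
apply/DtildeP.
have [C hC] : exists C, forall X : {fset V}, \sum_(y <- X) b x y <= C.
  have /absumP[C hC] : absum (b x).
    rewrite /absum; under eq_esum do rewrite ger0_norm ?(wg_b_ge0 b_graph)//.
    exact: (wg_b_sum b_graph).
  exists C => X; apply: le_trans (hC X); apply: ler_sum => y _.
  exact: ler_norm.
(* On pairs starting at [x] the second projection is injective, so this is a partial sum of [b x];
   likewise below for pairs ending at [x]. These are the only pairs on which the gradient of the
   delta can be nonzero. *)
have out (X : {fset V * V}) : \sum_(p <- X | p.1 == x) b x p.2 <= C.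
  rewrite big_fset_condE/=.
  have := hC [fset p.2 | p in [fset p in X | p.1 == x]]%fset.
  rewrite big_imfset//=.
  move=> [p1 p2] [q1 q2]; rewrite !inE/= => /andP[_ /eqP->] /andP[_ /eqP->].
  by move=> ->.
have inn (X : {fset V * V}) : \sum_(p <- X | p.2 == x) b x p.1 <= C.
  rewrite big_fset_condE/=.
  have := hC [fset p.1 | p in [fset p in X | p.2 == x]]%fset.
  rewrite big_imfset//=.
  move=> [p1 p2] [q1 q2]; rewrite !inE/= => /andP[_ /eqP->] /andP[_ /eqP->].
  by move=> ->.
apply: (proj1 (ip_le edge_weight_ge0 (C := C + C) _)) => X.
apply: le_trans (lerD (out X) (inn X)).
rewrite [X in _ <= X + _]big_mkcond [X in _ <= _ + X]big_mkcond -big_split/=.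
apply: ler_sum => -[p q] _; rewrite /edge_weight /gradient /delta/=.
have := wg_b_ge0 b_graph p q.
case: (eqVneq p x) => [->|_]; case: (eqVneq q x) => [->|_] /= h.
- by rewrite subrr expr0n/= mulr0 addr_ge0.
- by rewrite subr0 expr1n mulr1 addr0.
- by rewrite sub0r sqrrN expr1n mulr1 add0r (wg_b_sym b_graph).
- by rewrite subrr expr0n/= mulr0 addr0.
Qed.

Lemma Cc_Dtilde u : Cc u -> D u.
Proof.
apply: delta_lin_ind u => [|a x u uD]; first exact: (si_dom0 semi_inner_form).
by apply: (si_dom semi_inner_form) => //; exact: Dtilde_delta.
Qed.

Lemma Cc_ell2 u : Cc u -> ell2 m u.
Proof.
apply: delta_lin_ind u => [|a x u uD]; first exact: (si_dom0 semi_inner_ell2).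
by apply: (si_dom semi_inner_ell2) => //; exact: sqsum_delta.
Qed.

Lemma inner2_delta f x : ell2 m f -> inner2 m (delta R x) f = m x * f x.
Proof.
move=> fS; rewrite inner2E /ip.
have [|_ ->] := @rsum_finite_supp _ _ (fun y => m y * delta R x y * f y) [fset
  x]%fset.
  by move=> y; rewrite inE /delta => /negbTE ->; rewrite mulr0 mul0r.
by rewrite big_seq_fset1 /delta eqxx mulr1.
Qed.

Lemma sq_le_inner2 f x : ell2 m f -> m x * f x ^+ 2 <= inner2 m f f.
Proof. by move=> /ell2P fS; rewrite inner2E; exact: (sq_le_ip m_ge0). Qed.

Lemma sq_le_form u x y : D u -> b x y * (u x - u y) ^+ 2 <= 2 * Q u u.
Proof.
move=> /DtildeP uS; have := sq_le_ip edge_weight_ge0 (x, y) uS.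
by rewrite formE (mulrA 2) divff// mul1r.
Qed.

End GraphForms.

Section Cc.
Variables (R : realType) (V : countType).
Implicit Types u v : V -> R.

Lemma Cc_sub u v : (forall x, v x = 0 -> u x = 0) -> Cc v -> Cc u.
Proof.
move=> uv; apply: sub_finite_set => x /= /eqP ux.
by apply/eqP => vx; exact/ux/uv.
Qed.

Lemma Cc0 : Cc (0 : V -> R).
Proof. by apply: (@sub_finite_set _ _ set0) => // x /=; rewrite eqxx. Qed.

Lemma Cc_lin a u v : Cc u -> Cc v -> Cc (a *: u + v).
Proof.
move=> uC vC; apply: (@sub_finite_set _ _ ([set x | u x != 0] `|` [set x | v x
  != 0])).
  move=> x /=; rewrite -[(_ + _) x]/(a * u x + v x).
  have [->|] := eqVneq (u x) 0; last by left.
  by rewrite mulr0 add0r; right.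
by rewrite finite_setU.
Qed.

End Cc.

Lemma sqrtr_lt (R : rcfType) (a e : R) : 0 <= a -> 0 < e ->
  (Num.sqrt a < e) = (a < e ^+ 2).
Proof.
move=> a0 e0; rewrite -{1}(gtr0_norm e0) -sqrtr_sqr ltr_sqrt//.
by rewrite exprn_gt0.
Qed.

Lemma exists_inv_lt (R : realType) (C e : R) : 0 < e ->
  exists N, forall n, (N <= n)%N -> C / n.+1%:R < e.
Proof.
move=> e0; exists (Num.bound (`|C| / e)) => n Nn.
have Ce : 0 <= `|C| / e by rewrite divr_ge0// ltW.
rewrite ltr_pdivrMr// mulrC -ltr_pdivrMr//.
apply: le_lt_trans (lt_le_trans (archi_boundP Ce) _).
  by rewrite ler_pM2r ?invr_gt0// ler_norm.
by rewrite ler_nat leqW.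
Qed.

(** * The form domain and the variational solution *)

Section DirichletForm.
Variables (R : realType) (V : countType) (b : V -> V -> R) (m : V -> R).
Hypothesis b_graph : weighted_graph b (cst 0).
Hypothesis m_gt0 : forall x, 0 < m x.
Implicit Types u v f g w : V -> R.

Local Notation D := (Dtilde b (cst 0)).
Local Notation Q := (Defs.form b (cst 0)).
Local Notation dom := (dom_QD b (cst 0) m).
Local Notation L2 := (ell2 m).
Local Notation I2 := (inner2 m).

Let siQ := semi_inner_form b_graph.
Let siI := semi_inner_ell2 m_gt0.

Lemma norm2_sqr f : L2 f -> norm2 m f ^+ 2 = I2 f f.
Proof. by move=> fS; rewrite sqr_sqrtr// (si_ge0 siI). Qed.

Lemma dom_QDP u : dom u <-> [/\ D u, L2 u &
  forall e, 0 < e -> exists2 v, Cc v & Q (u - v) (u - v) + I2 (u - v) (u - v) <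
    e].
Proof.
have nQ v e : D u -> L2 u -> Cc v -> 0 < e -> (norm_Q b (cst 0) m (u \- v) < e)
  =
    (Q (u - v) (u - v) + I2 (u - v) (u - v) < e ^+ 2).
  move=> uD uS vC e0.
  have vD := si_domB siQ uD (Cc_Dtilde b_graph vC).
  have vS := si_domB siI uS (Cc_ell2 m_gt0 vC).
  rewrite /norm_Q -[u \- v]/(u - v) norm2_sqr//.
  have Q0 := si_ge0 siQ vD; have I0 := si_ge0 siI vS.
  by rewrite (sqrtr_lt (addr_ge0 Q0 I0) e0).
split=> [[[uD uS] h]|[uD uS h]].
  split => // e e0; have e1 : 0 < Num.sqrt e by rewrite sqrtr_gt0.
  have [v vC] := h _ e1; rewrite nQ// sqr_sqrtr ?ltW// => hv.
  by exists v.
split => // e e0; have [v vC hv] := h _ (exprn_gt0 2 e0).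
by exists v => //; rewrite nQ.
Qed.

Lemma Cc_dom v : Cc v -> dom v.
Proof.
move=> vC; apply/dom_QDP; split; [exact: Cc_Dtilde|exact: Cc_ell2|].
move=> e e0; exists v => //; rewrite subrr.
have Q0 := siZl siQ 0 (si_dom0 siQ) (si_dom0 siQ).
have I0 := siZl siI 0 (si_dom0 siI) (si_dom0 siI).
by rewrite scale0r mul0r in Q0; rewrite scale0r mul0r in I0;
  rewrite Q0 I0 addr0.
Qed.

Lemma dom_lin a u v : dom u -> dom v -> dom (a *: u + v).
Proof.
move=> /dom_QDP[uD uS uh] /dom_QDP[vD vS vh]; apply/dom_QDP; split.
- exact: (si_dom siQ).
- exact: (si_dom siI).
(* Splitting the square of a sum doubles each part, so each must be below e / 4; the [+ 1] covers
   [a = 0]. *)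
move=> e e0; have a0 : 0 < 4 * (a ^+ 2 + 1).
  by rewrite mulr_gt0// ltr_wpDl// sqr_ge0.
have e4 : 0 < e / 4 by rewrite divr_gt0.
have [u' u'C hu] := uh _ (divr_gt0 e0 a0).
have [v' v'C hv] := vh _ e4.
exists (a *: u' + v'); first exact: Cc_lin.
have -> : a *: u + v - (a *: u' + v') = a *: (u - u') + (v - v').
  by rewrite scalerBr opprD addrACA.
have u'D := si_domB siQ uD (Cc_Dtilde b_graph u'C).
have u'S := si_domB siI uS (Cc_ell2 m_gt0 u'C).
have v'D := si_domB siQ vD (Cc_Dtilde b_graph v'C).
have v'S := si_domB siI vS (Cc_ell2 m_gt0 v'C).
apply: le_lt_trans (lerD (si_sqD_le siQ (si_domZ siQ a u'D) v'D)
  (si_sqD_le siI (si_domZ siI a u'S) v'S)) _.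
rewrite (si_sqZ siQ)// (si_sqZ siI)//.
have X0 : 0 <= Q (u - u') (u - u') by exact: (si_ge0 siQ).
have Y0 : 0 <= I2 (u - u') (u - u') by exact: (si_ge0 siI).
have : a ^+ 2 * (Q (u - u') (u - u') + I2 (u - u') (u - u')) <= e / 4.
  apply: le_trans (ler_wpM2l (sqr_ge0 a) (ltW hu)) _.
  have a1 : 0 < a ^+ 2 + 1 by rewrite ltr_wpDl// sqr_ge0.
  have -> : a ^+ 2 * (e / (4 * (a ^+ 2 + 1))) = e / 4 * (a ^+ 2 / (a ^+ 2 + 1)).
    by field; exact: lt0r_neq0.
  rewrite ler_piMr//; first exact: ltW.
  rewrite ler_pdivrMr//.
  by rewrite mul1r lerDl.
lra.
Qed.

Lemma dom_D u : dom u -> D u. Proof. by move=> /dom_QDP[]. Qed.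
Lemma dom_L2 u : dom u -> L2 u. Proof. by move=> /dom_QDP[]. Qed.

Lemma inner2_ge0 f g : L2 f -> L2 g -> (forall x, 0 <= f x) ->
  (forall x, 0 <= g x) -> 0 <= I2 f g.
Proof.
move=> /(ell2P m_gt0) fS /(ell2P m_gt0) gS f0 g0; rewrite inner2E.
apply: rsum_ge0 => [x|]; first by rewrite !mulr_ge0// ltW.
exact: sqsum_absum.
Qed.

Let B h u v := h * Q u v + I2 u v.

Lemma semi_innerB h : 0 <= h -> semi_inner (fun u => D u /\ L2 u) (B h).
Proof. by move=> h0; exact: semi_innerD. Qed.

(* Minimise [h * Q v v + |v - f|^2]; a minimising sequence in [Cc] is Cauchy by
   the parallelogram law, and for nonnegative [f] replacing [v] by [|v|] does
   not increase the functional. *)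
Lemma variational_solution h f : 0 < h -> L2 f -> exists u,
  [/\ dom u, forall v, dom v -> h * Q u v + I2 u v = I2 f v &
      (forall x, 0 <= f x) -> forall x, 0 <= u x].
Proof.
move=> h0 fS; pose J v := B h v v - 2 * I2 f v.
have siB := semi_innerB (ltW h0).
have CD v : Cc v -> D v by exact: Cc_Dtilde.
have CS v : Cc v -> L2 v by exact: Cc_ell2.
have CB v : Cc v -> D v /\ L2 v by move=> vC; split; [exact: CD|exact: CS].
(* Completing the square: [J v] is h Q(v) + |v - f|^2 - |f|^2. *)
have Jlb v : Cc v -> - I2 f f <= J v.
  move=> vC; have := si_ge0 siI (si_domB siI (CS _ vC) fS).
  have := mulr_ge0 (ltW h0) (si_ge0 siQ (CD _ vC)).
  rewrite (si_sqB siI) ?(si_sym siI f v) /J /B; try exact: CS.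
  rewrite (si_sym siI f v); lra.
  exact: fS.
pose A : set R := [set J v | v in Cc].
pose d := inf A.
have Ainf : has_inf A.
  split; first by exists (J 0), 0 => //; exact: Cc0.
  by exists (- I2 f f) => _ [v vC <-]; exact: Jlb.
have dJ v : Cc v -> d <= J v by move=> vC; apply: (inf_lbound Ainf.2); exists v.
have minseq n : exists v, [/\ Cc v, J v <= d + n.+1%:R^-1 &
    (forall x, 0 <= f x) -> forall x, 0 <= v x].
  have n0 : 0 < n.+1%:R^-1 :> R by rewrite invr_gt0.
  have [_ [v vC <-] Jv] := inf_adherent n0 Ainf.
  have [f0|f0] := pselect (forall x, 0 <= f x); last first.
    by exists v; split => //; exact: ltW.
  pose v' x := `|v x|.
  have v'C : Cc v' by apply: Cc_sub vC => x vx; rewrite /v' vx normr0.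
  exists v'; split => [//||_ x]; last exact: normr_ge0.
  apply: le_trans (ltW Jv).
  have [_ Qv'] : D v' /\ Q v' v' <= Q v v.
    by apply: le_form (CD _ vC) => // x y; exact: ler_dist_dist.
  have Iv' : I2 v' v' = I2 v v.
    congr rsum; apply/funext => x; congr (_ * _).
    by rewrite -!expr2 real_normK// num_real.
  have Ifv : 0 <= I2 f (v' - v).
    apply: inner2_ge0 => // [|x]; first by apply: (si_domB siI); exact: CS.
    by rewrite -[(_ - _) x]/(`|v x| - v x) subr_ge0 ler_norm.
  rewrite (siBr siI) in Ifv; try by [exact: CS|].
  rewrite /J /B Iv' lerB// ?ler_pM2l// ?lerD2r ?ler_pM2l//; lra.
have [v hv] := choice minseq.
have vC n : Cc (v n) by case: (hv n).
(* Since [J] is at least [d] at the midpoint, B(v_n - v_k) = 2 J(v_n) + 2 J(v_k) - 4 J((v_n + v_k) /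
   2) is at most twice the two excesses over [d]. *)
have vB n k : B h (v n - v k) (v n - v k) <= 2 / n.+1%:R + 2 / k.+1%:R.
  have [_ Jn _] := hv n; have [_ Jk _] := hv k.
  rewrite (si_parallelogram siB (CB _ (vC n)) (CB _ (vC k))).
  have nkC : Cc (2^-1 *: (v n + v k)).
    rewrite -[_ *: _]addr0; apply: Cc_lin; last exact: (Cc_sub _ (vC 0%N)).
    by rewrite -[v n]scale1r; exact: Cc_lin.
  have := dJ _ nkC; rewrite /J.
  rewrite (si_sqZ siB); last by apply: (si_domD siB); exact: CB.
  rewrite (siZr siI) ?(siDr siI)//; try by [exact: CS|apply: (si_domD siI);
    exact: CS].
  have -> : (2^-1 : R) ^+ 2 = 4^-1 by field.
  rewrite /J in Jn Jk; set a := B _ _ _; set c := B _ (v n) _ in Jn *.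
  set p := n.+1%:R^-1 in Jn *; set q := k.+1%:R^-1 in Jk *.
  by move: (B h (v k) (v k)) Jn Jk => ck; lra.
have vI n k : I2 (v n - v k) (v n - v k) <= B h (v n - v k) (v n - v k).
  rewrite lerDr mulr_ge0 ?(ltW h0)// (si_ge0 siQ)//.
  by apply: (si_domB siQ); exact: CD.
have vQ n k : Q (v n - v k) (v n - v k) <= h^-1 * B h (v n - v k) (v n - v k).
  rewrite ler_pdivlMl// lerDl (si_ge0 siI)//.
  by apply: (si_domB siI); exact: CS.
have inv_le (C : R) n k : (n <= k)%N -> 0 <= C -> C / k.+1%:R <= C / n.+1%:R.
  by move=> nk C0; rewrite ler_wpM2l// lef_pV2 ?posrE// ler_nat.
have vB' n k : (n <= k)%N -> B h (v n - v k) (v n - v k) <= 4 / n.+1%:R.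
  move=> nk; apply: le_trans (vB n k) _.
  have := inv_le 2 _ _ nk (ler0n _ _).
  by move: (n.+1%:R^-1) (k.+1%:R^-1) => p q; lra.
have cv x : cvg (v n x @[n --> \oo]).
  apply: cauchy_cvg; apply: cauchy_exP => e e0.
  have em : 0 < e ^+ 2 * m x by rewrite mulr_gt0// exprn_gt0.
  have [N hN] := exists_inv_lt 4 em.
  exists (v N x); exists N => // n /= Nn; rewrite -ball_normE/=.
  have vS : L2 (v N - v n) by apply: (si_domB siI); exact: CS.
  have := le_trans (sq_le_inner2 m_gt0 x vS) (le_trans (vI _ _) (vB' _ _ Nn)).
  rewrite -[(_ - _) x]/(v N x - v n x) => le1.
  have := le_lt_trans le1 (hN N (leqnn N)).
  rewrite mulrC ltr_pM2r// -(real_normK (num_real (v N x - v n x))).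
  by rewrite ltr_pXn2r ?nnegrE// ltW.
pose u x := lim (v n x @[n --> \oo]).
have vu x : v n x @[n --> \oo] --> u x by exact: cv.
have vnu n x : (v n - v k) x @[k --> \oo] --> (v n - u) x.
  by apply: cvgB => //; exact: cvg_cst.
(* Letting k tend to infinity, Fatou turns the Cauchy bounds into bounds on [v n - u], which also
   place [u] in both spaces. *)
have limI n : L2 (v n - u) /\ I2 (v n - u) (v n - u) <= 4 / n.+1%:R.
  apply: (inner2_fatou m_gt0 _ (vnu n)); exists n => // k /= nk.
  split; first by apply: (si_domB siI); exact: CS.
  exact: le_trans (vI _ _) (vB' _ _ nk).
have limQ n : D (v n - u) /\ Q (v n - u) (v n - u) <= h^-1 * (4 / n.+1%:R).
  apply: (form_fatou b_graph _ (vnu n)); exists n => // k /= nk.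
  split; first by apply: (si_domB siQ); exact: CD.
  by apply: le_trans (vQ _ _) _; rewrite ler_pM2l ?invr_gt0// vB'.
have uE : u = v 0%N - (v 0%N - u) by rewrite subKr.
have uD : D u by rewrite uE; apply: (si_domB siQ);
  [exact: CD|exact: (limQ 0%N).1].
have uS : L2 u by rewrite uE; apply: (si_domB siI);
  [exact: CS|exact: (limI 0%N).1].
have udom : dom u.
  apply/dom_QDP; split => // e e0.
  have [N hN] := exists_inv_lt ((h^-1 + 1) * 4) e0.
  exists (v N) => //; apply: le_lt_trans (hN N (leqnn N)).
  rewrite (si_sqBC siQ uD (CD _ (vC N))) (si_sqBC siI uS (CS _ (vC N))).
  by rewrite mulrDl mul1r mulrDl -(mulrA h^-1); apply: lerD;
    [exact: (limQ N).2|exact: (limI N).2].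
exists u; split => //; last first.
  move=> f0 x; apply: limr_ge => //; near=> n.
  by have [_ _] := hv n; exact.
pose G w := h * Q u w + I2 u w - I2 f w.
have GB w : D w -> L2 w -> G w = B h u w - I2 f w by [].
have GC w : Cc w -> G w = 0.
  move=> wC; have [wD wS] := CB _ wC.
  have B0 : 0 <= B h w w by apply: (si_ge0 siB).
  (* Stationarity through the discriminant: J(v_n + t w) >= d >= J(v_n) - 1/(n+1), so in the limit 2
     t G(w) + t^2 B(w, w) is nonnegative for all t. Its constant term being 0, [G w] vanishes. *)
  suff : G w ^+ 2 <= 0 * B h w w.
    by rewrite mul0r => G0; apply/eqP; rewrite -sqrf_eq0 eq_le G0 sqr_ge0.
  apply: discriminant_le => // t; rewrite add0r.
  have hn n : - n.+1%:R^-1 <= 2 * t * (B h (v n) w - I2 f w) + t ^+ 2 * B h w w.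
    have [_ Jn _] := hv n.
    have vtC : Cc (v n + t *: w) by rewrite addrC; exact: Cc_lin.
    have := dJ _ vtC; rewrite /J (si_sqD siB _ (CB _ (vC n)) (conj wD wS)).
    rewrite (siDr siI) ?(siZr siI)//; try by [exact: CS|apply: (si_domZ siI)].
    move: Jn; rewrite /J; move: (n.+1%:R^-1) => p.
    move: (B h (v n) (v n)) (B h (v n) w) (B h w w) => b1 b2 b3; lra.
  have cG : 2 * t * (B h (v n) w - I2 f w) + t ^+ 2 * B h w w + n.+1%:R^-1
      @[n --> \oo] --> 2 * t * G w + t ^+ 2 * B h w w + 0.
    apply: cvgD; last exact: cvg_harmonic.
    apply: cvgD; last exact: cvg_cst.
    apply: cvgMl_tmp; rewrite GB//; apply: cvgB; last exact: cvg_cst.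
    apply/cvgrPdist_lt => e e0.
    have e1 : 0 < e ^+ 2 by rewrite exprn_gt0.
    have [N hN] := exists_inv_lt ((h * h^-1 + 1) * 4 * B h w w) e1.
    exists N => // n /= Nn.
    have [[D1 Q1] [S1 I1]] := (limQ n, limI n).
    rewrite distrC -(siBl siB)//; try exact: CB.
    have := si_cauchy_schwarz siB (conj D1 S1) (conj wD wS).
    rewrite -(ltr_pXn2r (n := 2)) ?nnegrE ?(ltW e0)// real_normK ?num_real//.
    move=> /le_lt_trans; apply; apply: le_lt_trans (hN n Nn).
    rewrite mulrAC; apply: ler_wpM2r => //.
    rewrite mulrDl mulrDl mul1r -!mulrA; apply: lerD => //.
    by rewrite ler_pM2l.
  rewrite -[leRHS]addr0 -(cvg_lim _ cG)//; apply: limr_ge.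
    by apply/cvg_ex; eexists; exact: cG.
  by near=> n; rewrite -lerBlDr sub0r; exact: hn.
move=> w /dom_QDP[wD wS hw]; apply/eqP; rewrite -subr_eq0 -/(G w) -normr_le0.
apply/ler_addgt0Pr => e e0; rewrite add0r.
(* A bound for [G] relative to the form norm, by Cauchy-Schwarz and B_h <= (h + 1)(Q + |.|^2); it
   extends [G = 0] from [Cc] to the domain. The final 1 makes [K] positive. *)
pose K := Num.sqrt (B h u u) * Num.sqrt (h + 1) + Num.sqrt (I2 f f) + 1.
have K0 : 0 < K by rewrite ltr_wpDl// addr_ge0 ?mulr_ge0 ?sqrtr_ge0.
have eK : 0 < (e / K) ^+ 2 by rewrite exprn_gt0// divr_gt0.
have [w' w'C hw'] := hw _ eK.
have [w'D w'S] := CB _ w'C.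
have [dD dS] : D (w - w') /\ L2 (w - w').
  by split; [exact: (si_domB siQ)|exact: (si_domB siI)].
have uDS : D u /\ L2 u by [].
have -> : G w = B h u (w - w') - I2 f (w - w').
  have := GC _ w'C; rewrite !GB//.
  rewrite (siBr siB (conj wD wS) (conj w'D w'S) uDS) (siBr siI wS w'S fS).
  move: (B h u w) (B h u w') (I2 f w) (I2 f w') => x1 x2 x3 x4; lra.
have Q0 := si_ge0 siQ dD; have I0 := si_ge0 siI dS.
have eK0 : 0 <= e / K by rewrite divr_ge0 ?ltW.
have sqB : Num.sqrt (B h (w - w') (w - w')) <= Num.sqrt (h + 1) * (e / K).
  rewrite -(ger0_norm eK0) -(sqrtr_sqr (e / K)) -sqrtrM ?addr_ge0 ?(ltW h0)//.
  apply: ler_wsqrtr; apply: le_trans (ler_wpM2l _ (ltW hw')); last first.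
    by rewrite addr_ge0 ?ltW.
  by have := mulr_ge0 (ltW h0) I0; rewrite /B; lra.
have sqI : Num.sqrt (I2 (w - w') (w - w')) <= e / K.
  rewrite -(ger0_norm eK0) -sqrtr_sqr; apply: ler_wsqrtr.
  by apply: le_trans (ltW hw'); rewrite lerDr.
apply: le_trans (ler_normB _ _) _.
apply: le_trans (lerD (si_cauchy_schwarz_sqrt siB uDS (conj dD dS))
  (si_cauchy_schwarz_sqrt siI fS dS)) _.
have s1 := ler_wpM2l (sqrtr_ge0 (B h u u)) sqB.
have s2 := ler_wpM2l (sqrtr_ge0 (I2 f f)) sqI.
apply: le_trans (lerD s1 s2) _; rewrite mulrA -mulrDl mulrCA.
by rewrite ler_piMr ?(ltW e0)// ler_pdivrMr// mul1r /K lerDl.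
Unshelve. all: by end_near.
Qed.

End DirichletForm.

(** * [ell2] as a complete normed module *)

Definition ell2_pred (R : realType) (V : countType) (m : V -> R) :
  {pred V -> R} := fun f => `[< ell2 m f >].

(** A separate type, so that square-summable functions can carry the [norm2] structure. Positivity
    of [m] is a parameter of the type because the norm separates points only thanks to it. *)
Record l2space (R : realType) (V : countType) (m : V -> R)
  (m_gt0 : forall x, 0 < m x) := L2Space {
  l2fun : V -> R;
  l2fun_mem : l2fun \in ell2_pred m
}.

Section L2Space.
Variables (R : realType) (V : countType) (m : V -> R).
Hypothesis m_gt0 : forall x, 0 < m x.

Lemma ell2_submod : submod_closed (ell2_pred m).
Proof.
have [d d0 _ _ _] := semi_inner_ell2 m_gt0; split; first exact/asboolP.
by move=> a f g /asboolP fS /asboolP gS; apply/asboolP; exact: d.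
Qed.

HB.instance Definition _ := GRing.isSubmodClosed.Build R (V -> R) (ell2_pred m)
  ell2_submod.
HB.instance Definition _ := [isSub for @l2fun R V m m_gt0].
HB.instance Definition _ := [Choice of l2space m_gt0 by <:].
HB.instance Definition _ := [SubChoice_isSubLmodule of l2space m_gt0 by <:].

Local Notation E := (l2space m_gt0).
Let siI := semi_inner_ell2 m_gt0.

Lemma l2funP (f : E) : ell2 m (l2fun f).
Proof. exact/asboolP/(l2fun_mem f). Qed.

Lemma l2fun_inj : injective (@l2fun R V m m_gt0).
Proof. exact: val_inj. Qed.

Definition to_l2 (f : V -> R) (fS : ell2 m f) : E := L2Space m_gt0 (asboolT fS).

Let norm (f : E) : R := norm2 m (l2fun f).

Lemma l2funD (f g : E) : l2fun (f + g) = l2fun f + l2fun g.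
Proof. by []. Qed.
Lemma l2funZ a (f : E) : l2fun (a *: f) = a *: l2fun f.
Proof. by []. Qed.
Lemma l2funB (f g : E) : l2fun (f - g) = l2fun f - l2fun g.
Proof. by []. Qed.

Let norm_triangle (f g : E) : norm (f + g) <= norm f + norm g.
Proof. by apply: (si_triangle siI); exact: l2funP. Qed.

Let norm_scale a (f : E) : norm (a *: f) = `|a| * norm f.
Proof.
rewrite /norm /norm2 l2funZ (si_sqZ siI); last exact: l2funP.
by rewrite sqrtrM ?sqr_ge0// sqrtr_sqr.
Qed.

Lemma norm2_sq_ge f x : ell2 m f -> Num.sqrt (m x) * `|f x| <= norm2 m f.
Proof.
move=> fS; rewrite -sqrtr_sqr -sqrtrM ?(ltW (m_gt0 x))// /norm2;
  apply: ler_wsqrtr.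
exact: sq_le_inner2.
Qed.

Let norm_eq0 (f : E) : norm f = 0 -> f = 0.
Proof.
move=> f0; apply: l2fun_inj; apply/funext => x.
have := norm2_sq_ge x (l2funP f); rewrite -/(norm f) f0.
by rewrite pmulr_rle0 ?sqrtr_gt0// normr_le0 => /eqP.
Qed.

HB.instance Definition _ := Lmodule_isNormed.Build R (l2space m_gt0)
  norm_triangle norm_scale norm_eq0.

Lemma l2_normE (f : E) : `|f| = norm2 m (l2fun f).
Proof. by []. Qed.

Lemma l2fun_le (f : E) x : `|l2fun f x| <= `|f| / Num.sqrt (m x).
Proof.
rewrite ler_pdivlMr ?sqrtr_gt0// mulrC.
exact: norm2_sq_ge (l2funP f).
Qed.

(** Point evaluations are continuous, so a Cauchy filter has a pointwise limit; Fatou along the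
    filter shows that it lies in [ell2] and is the norm limit. *)
Lemma l2_complete (F : set_system E) : ProperFilter F -> cauchy F -> cvg F.
Proof.
move=> PF /cauchy_ballP cF.
have cF2 e : 0 < e -> \forall f \near F, \forall g \near F, `|f - g| <= e.
  move=> e0; apply: nearP_dep; apply: filterS (cF _ e0) => -[f g] /=.
  by rewrite -ball_normE/= => /ltW.
have cv x : cvg (l2fun f x @[f --> F]).
  apply: cauchy_cvg; apply: cauchy_exP => e e0.
  have e1 : 0 < e / 2 * Num.sqrt (m x) by rewrite !mulr_gt0// sqrtr_gt0.
  near F => f; exists (l2fun f x).
  have : \forall g \near F, `|f - g| <= e / 2 * Num.sqrt (m x).
    by near: f; exact: cF2.
  apply: filterS => g fg; rewrite -ball_normE/=.
  apply: (@le_lt_trans _ _ (e / 2)); last by lra.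
  apply: le_trans (l2fun_le (f - g) x) _.
  by rewrite ler_pdivrMr// sqrtr_gt0.
pose u x := lim (l2fun f x @[f --> F]).
have fatou e : 0 < e -> \forall f \near F, ell2 m (l2fun f - u) /\
    inner2 m (l2fun f - u) (l2fun f - u) <= e ^+ 2.
  move=> e0; apply: filterS (cF2 _ e0) => f fg.
  apply: (@inner2_fatou _ _ _ m_gt0 _ F PF (fun g => l2fun (f - g))).
    by move=> x; apply: cvgB; [exact: cvg_cst|exact: cv].
  apply: filterS fg => g fg; split; first exact: l2funP.
  rewrite -(norm2_sqr m_gt0 (l2funP _)).
  by rewrite lerXn2r ?nnegrE ?sqrtr_ge0// ltW.
have uS : ell2 m u.
  have [g [ug _]] := filter_ex (fatou _ ltr01).
  rewrite -(subKr (l2fun g) u); apply: (si_domB siI) => //; exact: l2funP.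
apply/cvg_ex; exists (to_l2 uS); apply/cvgrPdist_le => e e0.
apply: filterS (fatou e e0) => f [fS fe]; rewrite distrC l2_normE /norm2.
by rewrite -(gtr0_norm e0) -sqrtr_sqr ler_wsqrtr.
Unshelve. all: by end_near. Qed.

HB.instance Definition _ := Uniform_isComplete.Build (l2space m_gt0)
  l2_complete.

End L2Space.

Section Operator.
Variables (R : realType) (V : countType) (b : V -> V -> R) (m : V -> R).
Hypothesis b_graph : weighted_graph b (cst 0).
Hypothesis m_gt0 : forall x, 0 < m x.

Local Notation D := (Dtilde b (cst 0)).
Local Notation Q := (Defs.form b (cst 0)).
Local Notation dom := (dom_QD b (cst 0) m).
Local Notation L2 := (ell2 m).
Local Notation I2 := (inner2 m).
Local Notation E := (l2space m_gt0).
Local Notation L := (LD b (cst 0) m).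

Let siQ := semi_inner_form b_graph.
Let siI := semi_inner_ell2 m_gt0.

Lemma Cc_dense_ell2 f e : L2 f -> 0 < e ->
  exists2 v, Cc v & I2 (f - v) (f - v) < e.
Proof.
move=> fS e0.
have [X fX] : exists X : {fset V}, I2 f f - e < \sum_(x <- X) m x * f x ^+ 2.
  apply: contrapT => /forallNP noX.
  have [_] : sqsum m f /\ ip m f f <= ip m f f - e.
    apply: (ip_le (m_ge0 m_gt0)) => X; rewrite leNgt -inner2E.
    exact/negP/noX.
  lra.
pose v x : R := if x \in X then f x else 0.
have vC : Cc v.
  apply: (@sub_finite_set _ _ [set` X]) => // x /=; rewrite /v.
  by case: ifP => //; rewrite eqxx.
have vS : L2 v by exact: Cc_ell2.
exists v => //; rewrite (si_sqB siI)//.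
have sX (g : V -> R) : (forall x, x \in X -> g x = f x) ->
    I2 g v = \sum_(x <- X) m x * f x ^+ 2.
  move=> gX; have [|_ e1] := @rsum_finite_supp _ _ (fun x => g x * v x * m x) X.
    by move=> x xX; rewrite /v (negbTE xX) mulr0 mul0r.
  rewrite /inner2 e1 !big_seq; apply: eq_bigr => x xX.
  by rewrite gX// /v xX; ring.
rewrite !sX//; last by move=> x xX; rewrite /v xX.
by move: fX; set S := \sum_(x <- X) _; lra.
Qed.

Definition l2operator (u w : E) : Prop := L (l2fun u) (l2fun w).

Local Notation A := l2operator.

Lemma LD_linear a u w u' w' : L u w -> L u' w' ->
  L (a *: u + u') (a *: w + w').
Proof.
move=> [uD wS uw] [u'D w'S u'w']; split.
- exact: dom_lin.
- exact: (si_dom siI).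
- move=> v vD; have vS := dom_L2 b_graph m_gt0 vD.
  rewrite (si_linear siI)// (si_linear siQ) ?uw ?u'w'//;
  exact: (dom_D b_graph m_gt0).
Qed.

(** [variational_solution] is the weak form of u + h L u = f; the image of [u] is read off as (f -
    u) / h. *)
Lemma LD_range h f : 0 < h -> L2 f -> exists u w,
  [/\ L u w, u + h *: w = f & (forall x, 0 <= f x) -> forall x, 0 <= u x].
Proof.
move=> h0 fS; have [u [ud uf u0]] := variational_solution b_graph m_gt0 h0 fS.
have uS := dom_L2 b_graph m_gt0 ud.
have fuS : L2 (f - u) by exact: (si_domB siI).
exists u, (h^-1 *: (f - u)); split => //.
- split => //; first exact: (si_domZ siI).
  move=> v vd; have vS := dom_L2 b_graph m_gt0 vd.
  rewrite (siZl siI)// (siBl siI)// -uf// addrK mulrA mulVf ?mul1r//.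
  exact: lt0r_neq0.
- by rewrite scalerA divff ?lt0r_neq0// scale1r addrC subrK.
Qed.

(** Accretivity expands |u + h w|^2 with <u, w> = Q(u) >= 0. Density needs an argument, as finitely
    supported functions may fail to lie in the operator domain: they are approximated by their
    resolvents. *)
Lemma l2operator_maccretive : m_accretive A.
Proof.
split.
- by move=> a u w u' w'; exact: LD_linear.
- move=> h u w h0 [ud wS uw]; rewrite !l2_normE /norm2.
  have uS := l2funP u.
  apply: ler_wsqrtr; rewrite l2funD l2funZ (si_sqD siI)//.
  rewrite -addrA lerDl (si_sym siI) -uw//.
  have uD := dom_D b_graph m_gt0 ud.
  have Q0 := si_ge0 siQ uD; have I0 := si_ge0 siI wS.
  by rewrite addr_ge0// mulr_ge0// ?sqr_ge0// mulr_ge0.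
- move=> h f h0; have [u [w [uw uf _]]] := LD_range h0 (l2funP f).
  have uS : L2 u by case: uw => ud _ _; exact: (dom_L2 b_graph m_gt0 ud).
  have wS : L2 w by case: uw.
  exists (to_l2 m_gt0 uS), (to_l2 m_gt0 wS); split => //.
  exact: l2fun_inj.
- move=> f e e0; have fS := l2funP f.
  have e4 : 0 < (e / 2) ^+ 2 by rewrite exprn_gt0// divr_gt0.
  have [v vC hv] := Cc_dense_ell2 fS e4.
  have vd := Cc_dom b_graph m_gt0 vC.
  have vD := dom_D b_graph m_gt0 vd; have vS := dom_L2 b_graph m_gt0 vd.
  have Qv := si_ge0 siQ vD.
  (* Chosen to make h Q(v) at most (e / 2)^2, since |u - v|^2 will be bounded by h Q(v). *)
  pose h := (e / 2) ^+ 2 / (Q v v + 1).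
  have h0 : 0 < h by rewrite divr_gt0// ltr_wpDl.
  have [u [w [[ud wS uw] uv _]]] := LD_range h0 vS.
  have uS : L2 u by exact: (dom_L2 b_graph m_gt0 ud).
  have uD : D u by exact: (dom_D b_graph m_gt0 ud).
  exists (to_l2 m_gt0 uS), (to_l2 m_gt0 wS); split => //.
  have uvS := si_domB siI uS vS.
  have vfS := si_domB siI vS fS.
  have uvd : dom (u - v).
    by rewrite addrC -scaleN1r; exact: dom_lin.
  have uvh : - h *: w = u - v by rewrite -uv opprD addrA subrr add0r scaleNr.
  have uvE : I2 (u - v) (u - v) = - h * Q u (u - v).
    by rewrite (uw _ uvd) -(siZl siI)// uvh.
  have uv2 : I2 (u - v) (u - v) <= (e / 2) ^+ 2.
    (* Nonnegativity of Q(u - v/2) gives - Q(u, u - v) <= Q(v) / 4. *)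
    have := si_ge0 siQ (si_domD siQ uD (si_domZ siQ (- 2^-1) vD)).
    rewrite uvE (si_sqD siQ)// (siBr siQ)// => h1.
    have h2 : h * Q v v <= (e / 2) ^+ 2.
      rewrite /h mulrAC -mulrA ler_piMr ?(ltW e4)// ler_pdivrMr ?ltr_wpDl//.
      by rewrite mul1r lerDl.
    apply: le_trans h2; have := ler_wpM2l (ltW h0) h1; rewrite mulr0.
    have := mulr_ge0 (ltW h0) Qv; rewrite sqrrN.
    have -> : (2^-1 : R) ^+ 2 = 4^-1 by field.
    move: h {h0 uv uvh uvE} (Q u u) (Q u v) (Q v v) => h' q1 q2 q3; lra.
  rewrite l2_normE /norm2 l2funB /= -(subrKA v).
  apply: le_lt_trans (si_triangle siI uvS vfS) _.
  rewrite (splitr e); apply: ler_ltD.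
    by rewrite -(ger0_norm (_ : 0 <= e / 2)) ?divr_ge0 ?(ltW e0)// -sqrtr_sqr
      ler_wsqrtr.
  rewrite sqrtr_lt ?divr_gt0// ?(si_ge0 siI)// (si_sqBC siI)//.
Qed.

End Operator.

(** * The heat semigroup and the Green function *)

Lemma cvg_norm2P (R : realType) (E : normedModType R) (T : Type)
    (F : set_system T) {FF : Filter F} (u : T -> E) (l : E) (r : T -> R) :
  (\forall t \near F, r t = `|u t - l|) ->
  (r t @[t --> F] --> (0 : R)) <-> (u t @[t --> F] --> l).
Proof.
move=> ru; split=> h.
- apply/cvgrPdist_le => e e0; move/cvgrPdist_le : h => /(_ e e0).
  apply: filterS2 ru => t -> ; rewrite sub0r normrN normr_id distrC.
  by [].
- apply/cvgrPdist_le => e e0; move/cvgrPdist_le : h => /(_ e e0).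
  by apply: filterS2 ru => t ->; rewrite sub0r normrN normr_id distrC.
Qed.

(** * From the abstract semigroup to [exp_semigroup] *)

Section Transfer.
Variables (R : realType) (V : countType) (b : V -> V -> R) (m : V -> R).
Hypothesis b_graph : weighted_graph b (cst 0).
Hypothesis m_gt0 : forall x, 0 < m x.

Local Notation L2 := (ell2 m).
Local Notation E := (l2space m_gt0).
Local Notation L := (LD b (cst 0) m).
Local Notation A := (@l2operator R V b m m_gt0).
Local Notation T := (hille_yosida A).

Let siI := semi_inner_ell2 m_gt0.
Let maA := l2operator_maccretive b_graph m_gt0.
Let csgT := hille_yosida_csemigroup maA.

Lemma l2operator_unique (u u' w w' : E) h : 0 < h ->
  A u w -> A u' w' -> u + h *: w = u' + h *: w' -> u = u'.
Proof.
move=> h0 Auw Auw' e; rewrite -(resolventK maA (ltW h0) Auw) e.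
exact: (resolventK maA (ltW h0)).
Qed.

(** The nonnegative cone is closed, and resolvents preserve it because the nonnegative solution of
    [LD_range] is the only solution. *)
Lemma hille_yosida_ge0 t (f : E) : 0 <= t -> (forall x, 0 <= l2fun f x) ->
  forall x, 0 <= l2fun (T t f) x.
Proof.
apply: (hille_yosida_closed maA (K := fun f => forall x, 0 <= l2fun f x)).
  move=> u w h h0 Auw uw0.
  have [u' [w' [Luw' e u'0]]] := LD_range b_graph m_gt0 h0 (l2funP (u + h *:
    w)).
  have uS : L2 u' by case: Luw' => ud _ _; exact: (dom_L2 b_graph m_gt0 ud).
  have wS : L2 w' by case: Luw'.
  have -> : u = to_l2 m_gt0 uS.
    apply: (@l2operator_unique _ _ w (to_l2 m_gt0 wS) h) => //.
    exact/l2fun_inj/esym.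
  exact: u'0.
move=> u l u0 ul x; apply/ler_addgt0Pr => e e0.
have e1 : 0 < e * Num.sqrt (m x) by rewrite mulr_gt0// sqrtr_gt0.
move/cvgrPdist_le : ul => /(_ _ e1)[N _ /(_ N (leqnn N))] /= h.
have := le_trans (l2fun_le (l - u N) x) (ler_wpM2r _ h).
rewrite mulfK ?lt0r_neq0 ?sqrtr_gt0// invr_ge0 sqrtr_ge0 => /(_ isT).
rewrite l2funB -[(_ - _) x]/(l2fun l x - l2fun (u N) x) ler_norml => /andP[+ _].
by have := u0 N x; lra.
Qed.

(** Zero outside [ell2], where [contraction_semigroup] imposes nothing. *)
Definition l2_extend (S : R -> E -> E) (t : R) (f : V -> R) : V -> R :=
  if pselect (L2 f) is left fS then l2fun (S t (to_l2 m_gt0 fS)) else 0.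

Lemma l2_extendE (S : R -> E -> E) t (f : E) : l2_extend S t (l2fun f) = l2fun
  (S t f).
Proof.
rewrite /l2_extend; case: pselect => [fS|]; last by move/(_ (l2funP f)).
by congr (l2fun (S t _)); exact: l2fun_inj.
Qed.

Lemma l2_ex f : L2 f -> exists g : E, l2fun g = f.
Proof. by move=> fS; exists (to_l2 m_gt0 fS). Qed.

Section Restrict.
Variables (S : R -> (V -> R) -> (V -> R)) (S' : R -> E -> E).
Hypothesis SE : forall t (f : E), 0 <= t -> S t (l2fun f) = l2fun (S' t f).

(** With [contraction_csemigroup], a dictionary used in both directions: to exhibit a semigroup with
    the required generator, and to apply abstract uniqueness to any other one. *)
Lemma generator_generates (u w : E) :
  generator m S (l2fun u) (l2fun w) <-> generates S' u w.
Proof.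
have near_eq : \forall t \near (0:R)^'+,
  norm2 m (fun x => t^-1 * (S t (l2fun u) x - l2fun u x) - l2fun w x)
   = `|t^-1 *: (S' t u - u) - w|.
  near=> t; have t0 : 0 <= t by near: t; exact: nbhs_right_ge.
  by rewrite SE.
split=> [[_ _ h]|h]; first exact/(cvg_norm2P near_eq).
by split; [exact: l2funP|exact: l2funP|exact/(cvg_norm2P near_eq)].
Unshelve. all: by end_near. Qed.

Lemma contraction_csemigroup : contraction_semigroup m S <-> csemigroup S'.
Proof.
have near_eq (f : E) : \forall t \near (0:R)^'+,
   norm2 m (S t (l2fun f) \- l2fun f) = `|S' t f - f|.
  near=> t; have t0 : 0 <= t by near: t; exact: nbhs_right_ge.
  by rewrite SE.
split=> [[c1 c2 c3 c4 c5 c6]|[c1 c2 c3 c4 c5]]; split.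
- move=> t a f g t0; apply: l2fun_inj; rewrite -SE//.
  apply/funext => x; have := c2 t a _ _ t0 (l2funP f) (l2funP g) x.
  by rewrite !SE.
- by move=> t f t0; rewrite !l2_normE -SE// c3//; exact: l2funP.
- by move=> f; apply: l2fun_inj; rewrite -SE// c4//; exact: l2funP.
- move=> s t f s0 t0; apply: l2fun_inj; rewrite -!SE ?addr_ge0//.
  by rewrite c5//; exact: l2funP.
- by move=> f; apply/(cvg_norm2P (near_eq f)); apply: c6; exact: l2funP.
- by move=> t f t0 /l2_ex[{}f <-]; rewrite SE//; exact: l2funP.
- move=> t a f g t0 /l2_ex[{}f <-] /l2_ex[{}g <-] x.
  by rewrite (SE (a *: f + g) t0) c1// !SE.
- by move=> t f t0 /l2_ex[{}f <-]; rewrite SE// -!l2_normE c2.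
- by move=> f /l2_ex[{}f <-]; rewrite SE// c3.
- by move=> s t f s0 t0 /l2_ex[{}f <-]; rewrite !SE ?addr_ge0// c4.
- by move=> f /l2_ex[{}f <-]; apply/(cvg_norm2P (near_eq f)); exact: c5.
Unshelve. all: by end_near. Qed.

End Restrict.

Lemma semigroup_of_LD : semigroup_of m L (l2_extend T).
Proof.
have SE t (f : E) : 0 <= t -> l2_extend T t (l2fun f) = l2fun (T t f).
  by move=> _; exact: l2_extendE.
split; first exact/(contraction_csemigroup SE).
move=> u w; split.
- move=> Luw; have [ud wS _] := Luw.
  have uS := dom_L2 b_graph m_gt0 ud.
  have [[f fE] [g gE]] := (l2_ex uS, l2_ex wS); subst u w.
  apply/(generator_generates SE f (- g)).
  exact: hille_yosida_generates.
- move=> guw; have [uS wS _] := guw.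
  have [[f fE] [g gE]] := (l2_ex uS, l2_ex wS); subst u.
  have -> : w = - l2fun g by rewrite gE; apply/funext => x; exact/esym/opprK.
  apply/(hille_yosida_generator maA f (- g)); rewrite opprK.
  by apply/(generator_generates SE); rewrite gE.
Qed.

Lemma semigroup_of_LD_unique S : semigroup_of m L S ->
  forall t (f : E), 0 <= t -> S t (l2fun f) = l2fun (T t f).
Proof.
move=> [csS gS].
(* The default 0 can be reached only for t < 0, since [cs_ell2] applies to all other times. *)
pose S' t (f : E) : E := if pselect (L2 (S t (l2fun f))) is left h
  then to_l2 m_gt0 h else 0.
have SE t (f : E) : 0 <= t -> S t (l2fun f) = l2fun (S' t f).
  move=> t0; rewrite /S'; case: pselect => //= h.
  by case: h; apply: (cs_ell2 csS) => //; exact: l2funP.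
move=> t f t0; rewrite SE// (hille_yosida_unique maA _ _ t0)//.
  exact/(contraction_csemigroup SE).
move=> u w Auw; apply/(generator_generates SE u (- w)).
exact/gS.
Qed.

(** Existence makes the [get] meet its specification, and uniqueness then determines its values on
    [ell2] for t >= 0. *)
Theorem exp_semigroupE t (f : E) : 0 <= t ->
  exp_semigroup m L t (l2fun f) = l2fun (T t f).
Proof.
apply: semigroup_of_LD_unique; rewrite /exp_semigroup.
by apply: (@getPex _ [set S | semigroup_of m L S]); exists (l2_extend T);
  exact: semigroup_of_LD.
Qed.

End Transfer.

(** * Laplace transform of the heat semigroup *)

Section Green.
Variables (R : realType) (V : countType) (b : V -> V -> R) (m : V -> R).
Hypothesis b_graph : weighted_graph b (cst 0).
Hypothesis m_gt0 : forall x, 0 < m x.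

Local Notation L2 := (ell2 m).
Local Notation E := (l2space m_gt0).
Local Notation L := (LD b (cst 0) m).
Local Notation A := (@l2operator R V b m m_gt0).
Local Notation T := (hille_yosida A).
Local Notation mu := (@lebesgue_measure R).

Let maA := l2operator_maccretive b_graph m_gt0.
Let csgT := hille_yosida_csemigroup maA.

Let ev (y : V) (f : E) : R := l2fun f y.

Let ev_lim (T' : Type) (F : set_system T') (FF : Filter F) (u : T' -> E) l y :
  u t @[t --> F] --> l -> ev y (u t) @[t --> F] --> ev y l.
Proof.
move=> ul; apply/cvgrPdist_le => e e0.
have e1 : 0 < e * Num.sqrt (m y) by rewrite mulr_gt0// sqrtr_gt0.
move/cvgrPdist_le : ul => /(_ _ e1); apply: filterS => t ht.
rewrite -[_ - _]/(l2fun (l - u t) y); apply: le_trans (l2fun_le _ _) _.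
by rewrite ler_pdivrMr// sqrtr_gt0.
Qed.

Lemma is_derive_hille_yosida (g w : E) (y : V) (t : R) : A g w -> 0 < t ->
  is_derive t (1 : R) (fun s => ev y (T s g)) (- ev y (T t w)).
Proof.
move=> Agw t0.
have lim : h^-1 *: (((fun s => ev y (T s g)) \o shift t) (h *: (1 : R)) -
    ev y (T t g)) @[h --> 0^'] --> - ev y (T t w).
  apply/cvgrPdist_le => e e0.
  have e1 : 0 < e * Num.sqrt (m y) by rewrite mulr_gt0// sqrtr_gt0.
  have := csemigroup_diff csgT (hille_yosida_generates maA Agw) t0 e1 => nd.
  near=> h.
  have h0 : h != 0 by near: h; exact: nbhs_dnbhs_neq.
  have : `|T (h + t) g - T t g - h *: T t (- w)| <= e * Num.sqrt (m y) * `|h|.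
    by near: h.
  move=> hh; have := le_trans (l2fun_le _ y) (ler_wpM2r _ hh).
  rewrite invr_ge0 sqrtr_ge0 => /(_ isT).
  rewrite mulrAC mulfK ?lt0r_neq0 ?sqrtr_gt0//.
  have TwN : T t (- w) = - T t w.
    by rewrite -scaleN1r (csgZ csgT) ?ltW// scaleN1r.
  rewrite TwN -[l2fun _ y]/(ev y (T (h + t) g) - ev y (T t g) - h * - ev y (T t
    w)).
  rewrite /= [h *: 1]mulr1 => h1.
  rewrite -(ler_pM2r (_ : 0 < `|h|)) ?normr_gt0// -normrM.
  apply: le_trans h1; rewrite le_eqVlt; apply/orP; left; apply/eqP.
  rewrite distrC; congr (`|_|); rewrite -[_ *: _]/(_ * _); field.
  exact: h0.
split; first by apply/cvg_ex; exists (- ev y (T t w)).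
exact: cvg_lim lim.
Unshelve. all: by end_near. Qed.

Lemma continuous_hille_yosida (f : E) (y : V) :
  {within `[0, +oo[, continuous (fun t : R => ev y (T t f))}.
Proof.
apply/continuous_within_itvcyP; split.
  move=> t; rewrite in_itv/= andbT => t0.
  by apply: ev_lim; exact: csemigroup_continuous csgT f _ t0.
rewrite hille_yosida0; apply: ev_lim; exact: (csg_cvg csgT).
Qed.

Lemma cvg_expR_bounded (a C : R) (u : R -> R) : 0 < a ->
  (forall t, 0 <= t -> `|u t| <= C) ->
  - (expR (- a * t) * u t) @[t --> +oo] --> (0 : R).
Proof.
move=> a0 uC.
have C0 : 0 <= C by exact: le_trans (uC 0 (lexx 0)).
have h : expR (- a * t) @[t --> +oo] --> (0 : R).
  under eq_fun do rewrite mulNr.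
  apply: (@cvg_comp _ _ _ (fun t => a * t) (fun s => expR (- s)) _ +oo).
    by apply: gt0_cvgMry => //; exact: cvg_id.
  exact: cvgr_expR.
apply/cvgrPdist_le => e e0.
have eC : 0 < e / (C + 1) by rewrite divr_gt0// ltr_wpDl.
near=> t; have t0 : 0 <= t by near: t; apply: nbhs_pinfty_ge; rewrite num_real.
rewrite sub0r opprK normrM gtr0_norm ?expR_gt0//.
have ht : expR (- a * t) <= e / (C + 1).
  have : `|0 - expR (- a * t)| <= e / (C + 1).
    by near: t; move/cvgrPdist_le : h; exact.
  by rewrite sub0r normrN gtr0_norm ?expR_gt0.
apply: le_trans (ler_pM (expR_ge0 _) _ ht (uC _ t0)) _ => //.
by rewrite mulrAC ler_pdivrMr ?ltr_wpDl// ler_wpM2l ?(ltW e0)// lerDl.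
Unshelve. all: by end_near. Qed.

(** An antiderivative is explicit: the derivative of - e^(-a t) T_t g is e^(-a t) T_t (a g + w) =
    e^(-a t) T_t f. It vanishes at infinity and equals - g(y) at 0. Nonnegativity of [f] makes the
    integrand nonnegative. *)
Lemma laplace_resolvent (a : R) (g w f : E) (y : V) : 0 < a ->
  A g w -> a *: g + w = f -> (forall x, 0 <= l2fun f x) ->
  (\int[mu]_(t in `[0%R, +oo[) (expR (- a * t) * ev y (T t f))%:E)%E =
  (ev y g)%:E.
Proof.
move=> a0 Agw gwf f0.
pose F t := - (expR (- a * t) * ev y (T t g)).
have dexp (t : R) : is_derive t (1 : R) (fun t => expR (- a * t)) (- a * expR
  (- a * t)).
  have h := is_derive_expR (- a * t).
  have h2 : is_derive t (1 : R) (fun t => - a * t) (- a).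
    rewrite (_ : (fun s : R => - a * s) = (- a) \*: id)//.
    by apply: is_derive_eq; rewrite -[LHS]/(- a * 1) mulr1.
  by have := is_derive1_comp h h2; rewrite mulrC.
have dF (t : R) : 0 < t ->
    is_derive t (1 : R) F (expR (- a * t) * ev y (T t f)).
  move=> t0; have d1 := is_derive_hille_yosida y Agw t0.
  have d2 := is_deriveN (is_deriveM (dexp t) d1).
  apply: (is_derive_eq d2).
  have -> : ev y (T t f) = a * ev y (T t g) + ev y (T t w).
    by rewrite -gwf (csg_linear csgT)// ltW.
  rewrite -[X in - (X + _)]/(expR (- a * t) * _).
  rewrite -[X in - (_ + X)]/(ev y (T t g) * _); ring.
have cexp : continuous (fun t : R => expR (- a * t)).
  move=> t; apply: differentiable_continuous; apply/derivable1_diffP.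
  by have [] := dexp t.
rewrite (@ge0_continuous_FTC2y _ _ F 0 0).
- by rewrite /F mulr0 expR0 mul1r hille_yosida0 sub0e EFinN oppeK.
- move=> t t0; rewrite mulr_ge0 ?expR_ge0//.
  exact: (hille_yosida_ge0 b_graph).
- move=> t; apply: cvgM.
    by apply: continuous_subspaceT => s; exact: cexp.
  exact: continuous_hille_yosida.
- apply: (@cvg_expR_bounded _ (`|g| / Num.sqrt (m y))) => // t t0.
  apply: le_trans (l2fun_le _ _) _; rewrite ler_wpM2r ?invr_ge0 ?sqrtr_ge0//.
  exact: (csg_norm csgT).
- by move=> t t0; have [] := dF t t0.
- apply: cvgN; apply: cvgM; first exact: cvg_at_right_filter (cexp 0).
  by rewrite hille_yosida0; apply: ev_lim; exact: (csg_cvg csgT).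
- move=> t; rewrite in_itv/= andbT => t0.
  by rewrite derive1E; have [_ ->] := dF t t0.
Qed.

End Green.

Section GreenResolvent.
Variables (R : realType) (V : countType) (b : V -> V -> R) (m : V -> R).
Hypothesis b_graph : weighted_graph b (cst 0).
Hypothesis m_gt0 : forall x, 0 < m x.

Local Notation L := (LD b (cst 0) m).
Local Notation A := (@l2operator R V b m m_gt0).
Local Notation T := (hille_yosida A).
Local Notation mu := (@lebesgue_measure R).

Definition green_approx (a : R) (x : V) (g : V -> R) : Prop :=
  exists2 w, L g w & a *: g + w = delta R x.

(** Dividing by [a] gives the resolvent equation with step 1/a and right-hand side delta / a. *)
Lemma green_approx_exists a x : 0 < a -> exists g, green_approx a x g.
Proof.
move=> a0; have h0 : 0 < a^-1 by rewrite invr_gt0.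
have dS := si_domZ (semi_inner_ell2 m_gt0) a^-1 (sqsum_delta m_gt0 x).
have [g [w [Lgw e _]]] := LD_range b_graph m_gt0 h0 dS.
exists g, w => //; apply: (scalerI (lt0r_neq0 h0)).
by rewrite scalerDr scalerA mulVf ?lt0r_neq0// scale1r.
Qed.

Let f0 x y t := l2fun (T t (to_l2 m_gt0 (sqsum_delta m_gt0 x))) y.

Lemma greenE x y : green b (cst 0) m x y =
  (\int[mu]_(t in `[0%R, +oo[) (f0 x y t)%:E)%E.
Proof.
apply: eq_integral => t; rewrite inE/= in_itv/= andbT => t0.
by rewrite /f0 -(exp_semigroupE b_graph).
Qed.

Let f0_ge0 x y t : 0 <= t -> 0 <= f0 x y t.
Proof.
by move=> t0; apply: hille_yosida_ge0.
Qed.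

Let mf (f : R -> R) : {within `[0, +oo[, continuous f} ->
  measurable_fun (`[0%R, +oo[%classic : set R) f.
Proof.
by move=> cf; exact: subspace_continuous_measurable_fun.
Qed.

Let cexp a : continuous (fun t : R => expR (- a * t)).
Proof.
move=> t; apply: continuous_comp; last exact: continuous_expR.
by apply: cvgMl_tmp.
Qed.

Let mf0 x y : measurable_fun (`[0%R, +oo[%classic : set R) (f0 x y).
Proof. by apply: mf; exact: continuous_hille_yosida. Qed.

Let mfa a x y :
  measurable_fun (`[0%R, +oo[%classic : set R) (fun t => expR (- a * t) * f0 x
    y t).
Proof.
apply: mf => t; apply: cvgM; last exact: continuous_hille_yosida.
by apply: continuous_subspaceT => s; exact: cexp.
Qed.

Let laplace a x y g : 0 < a -> green_approx a x g ->
  (\int[mu]_(t in `[0%R, +oo[) (expR (- a * t) * f0 x y t)%:E)%E = (g y)%:E.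
Proof.
move=> a0 [w Lgw e].
have gS : ell2 m g by case: Lgw => gd _ _; exact: (dom_L2 b_graph m_gt0 gd).
have wS : ell2 m w by case: Lgw.
apply: (@laplace_resolvent _ _ _ _ b_graph m_gt0 a (to_l2 m_gt0 gS) (to_l2
  m_gt0 wS)) => //.
  exact: l2fun_inj.
Qed.

Lemma green_approx_le a x y g : 0 < a -> green_approx a x g ->
  ((g y)%:E <= green b (cst 0%R) m x y)%E.
Proof.
move=> a0 ga; rewrite greenE -(laplace y a0 ga); apply: ge0_le_integral => //.
- move=> t; rewrite /= in_itv/= andbT => t0.
  by rewrite lee_fin; apply: mulr_ge0; [exact: expR_ge0|exact: f0_ge0].
- by have /measurable_EFinP := mfa a x y.
- by have /measurable_EFinP := mf0 x y.
- move=> t; rewrite /= in_itv/= andbT => t0; rewrite lee_fin ler_piMl ?f0_ge0//.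
  by rewrite -expR0 ler_expR mulNr oppr_le0 mulr_ge0// ltW.
Qed.

Lemma green_approx_ge0 a x y g : 0 < a -> green_approx a x g -> 0 <= g y.
Proof.
move=> a0 ga; rewrite -lee_fin -(laplace y a0 ga); apply: integral_ge0.
move=> t; rewrite /= in_itv/= andbT => t0.
by rewrite lee_fin; apply: mulr_ge0; [exact: expR_ge0|exact: f0_ge0].
Qed.

(** Monotone convergence along a = 1/(n+1): the factors e^(-a t) increase to 1 and the semigroup
    kernel is nonnegative. *)
Lemma green_le x y C :
  (forall a g, 0 < a -> green_approx a x g -> g y <= C) ->
  (green b (cst 0%R) m x y <= C%:E)%E.
Proof.
move=> gC; rewrite greenE.
pose u n t := (expR (- n.+1%:R^-1 * t) * f0 x y t)%:E.
have lim t : 0 <= t -> u n t @[n --> \oo] --> (f0 x y t)%:E.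
  move=> t0; apply: cvg_EFin; first by apply: nearW.
  rewrite -[X in _ --> X]mul1r; apply: cvgMr_tmp.
  have h : - n.+1%:R^-1 * t @[n --> \oo] --> (0 : R).
    by rewrite -(mul0r t) -oppr0; apply: cvgMr_tmp; apply: cvgN;
      exact: cvg_harmonic.
  have := continuous_cvg _ (@continuous_expR R 0) h; rewrite expR0; exact.
rewrite (_ : \int[mu]_(t in _) _ = \int[mu]_(t in `[0%R, +oo[) limn (u ^~
  t))%E; last first.
  apply: eq_integral => t; rewrite inE/= in_itv/= andbT => t0.
  by apply/esym/cvg_lim => //; exact: lim.
have cvgI : (\int[mu]_(t in `[0%R, +oo[) u n t)%E @[n --> \oo] -->
    (\int[mu]_(t in `[0%R, +oo[) limn (u ^~ t))%E.
  apply: cvg_monotone_convergence => //.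
  - by move=> n; have /measurable_EFinP := mfa n.+1%:R^-1 x y.
  - move=> n t; rewrite /= in_itv/= andbT => t0.
    by rewrite lee_fin; apply: mulr_ge0; [exact: expR_ge0|exact: f0_ge0].
  - move=> t; rewrite /= in_itv/= andbT => t0 n k nk.
    rewrite lee_fin ler_wpM2r ?f0_ge0//.
    by rewrite ler_expR ler_wpM2r// lerN2 lef_pV2 ?posrE// ler_nat.
rewrite -(cvg_lim _ cvgI)//; apply: lime_le.
  by apply/cvg_ex; eexists; exact: cvgI.
apply: nearW => n; have n0 : 0 < n.+1%:R^-1 :> R by rewrite invr_gt0.
have [g ga] := green_approx_exists x n0.
by rewrite (laplace y n0 ga) lee_fin; exact: gC ga.
Qed.

End GreenResolvent.

(** * Capacity *)

Lemma dist_max_le (R : realDomainType) (a b a' b' d : R) :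
  `|a - a'| <= d -> `|b - b'| <= d -> `|Num.max a b - Num.max a' b'| <= d.
Proof.
rewrite !ler_norml => /andP[h1 h2] /andP[h3 h4]; rewrite /Num.max.
by case: ltP => ?; case: ltP => ?; apply/andP; split; lra.
Qed.

Lemma dist_min_le (R : realDomainType) (a b a' b' d : R) :
  `|a - a'| <= d -> `|b - b'| <= d -> `|Num.min a b - Num.min a' b'| <= d.
Proof.
rewrite !ler_norml => /andP[h1 h2] /andP[h3 h4]; rewrite /Num.min.
by case: ltP => ?; case: ltP => ?; apply/andP; split; lra.
Qed.

Section Capacity.
Variables (R : realType) (V : countType) (b : V -> V -> R).
Hypothesis b_graph : weighted_graph b (cst 0).
Hypothesis b_connected : connected_graph b.

Local Notation D := (Dtilde b (cst 0)).
Local Notation Q := (Defs.form b (cst 0)).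

Let siQ := semi_inner_form b_graph.

(** Capacity zero in a form free of [m], of the form domain and of extended reals; [capacity_eq0]
    identifies the two. *)
Definition null_capacity (x : V) : Prop :=
  forall e, 0 < e -> exists v, [/\ Cc v, v x = 1 & Q v v < e].

(** Chaining along a path with (s + t)^2 <= 2 s^2 + 2 t^2; a single edge contributes (u(x) - u(z))^2
    <= (2 / b(x, z)) Q(u). The constant depends on the path but not on [u]. *)
Lemma sq_sub_le_form x y : exists2 K, 0 <= K &
  forall u, D u -> (u x - u y) ^+ 2 <= K * Q u u.
Proof.
have [p [xp <-]] := b_connected x y.
elim: p x xp => [|z p IH] x /=.
  by exists 0 => // u _; rewrite subrr expr0n/= mul0r.
move=> /andP[bxz /IH[K K0 hK]]; have {}bxz : 0 < b x z := bxz.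
exists (4 / b x z + 2 * K); first by rewrite addr_ge0 ?divr_ge0 ?mulr_ge0// ltW.
move=> u uD; have h1 := sq_le_form b_graph x z uD; have h2 := hK u uD.
have h3 : (u x - u z) ^+ 2 <= 2 / b x z * Q u u.
  by rewrite mulrAC ler_pdivlMr// mulrC.
have -> : (4 / b x z + 2 * K) * Q u u = 2 * (2 / b x z * Q u u) + 2 * (K * Q u
  u).
  by ring.
set q1 := 2 / b x z * Q u u in h3 *; set q2 := K * Q u u in h2 *.
have := sqr_ge0 ((u x - u z) - (u z - u (last z p))).
move: h2 h3; clear; nra.
Qed.

Lemma null_capacity_trans x y : null_capacity x -> null_capacity y.
Proof.
move=> cx e e0; have [K K0 hK] := sq_sub_le_form x y.
(* The second bound forces |1 - v(y)| <= 1/2, hence v(y) >= 1/2. Rescaling to value 1 at [y] then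
   multiplies the energy by at most 4, which the first bound absorbs. *)
have e'0 : 0 < Num.min (e / 4) (4^-1 / (K + 1)).
  by rewrite lt_min !divr_gt0// ltr_wpDl.
have [v [vC vx]] := cx _ e'0.
rewrite lt_min => /andP[ve vK].
have vD := Cc_Dtilde b_graph vC; have Q0 := si_ge0 siQ vD.
have vy : 2^-1 <= v y.
  have := hK v vD; rewrite vx => h.
  have : (1 - v y) ^+ 2 <= (2^-1) ^+ 2.
    apply: le_trans h _; rewrite ltr_pdivlMr ?ltr_wpDl// in vK.
    have -> : (2^-1 : R) ^+ 2 = 4^-1 by field.
    by apply: le_trans (ltW vK); rewrite mulrC ler_wpM2l// lerDl.
  by move=> h'; rewrite leNgt; apply/negP => vlt; nra.
have vy0 : 0 < v y by apply: lt_le_trans vy.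
exists ((v y)^-1 *: v); split.
- by rewrite -[_ *: _]addr0; apply: Cc_lin => //; exact: Cc0.
- by rewrite -[LHS]/((v y)^-1 * v y) mulVf// lt0r_neq0.
- rewrite (si_sqZ siQ)//; apply: (@le_lt_trans _ _ (4 * Q v v)); last by lra.
  apply: ler_wpM2r => //; rewrite exprVn -[4]invrK lef_pV2 ?posrE ?exprn_gt0//.
  have -> : (4^-1 : R) = (2^-1) ^+ 2 by field.
  by rewrite lerXn2r ?nnegrE// ltW.
Qed.

(** Clamping to [0, 1] is a normal contraction that fixes 0 and 1, so it keeps the support finite,
    the value at [x] and the energy bound. *)
Lemma null_capacity_clamp x : null_capacity x -> forall e, 0 < e ->
  exists v, [/\ Cc v, v x = 1, Q v v < e & forall y, 0 <= v y <= 1].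
Proof.
move=> cx e e0; have [v [vC vx ve]] := cx e e0.
pose w y := Num.max 0 (Num.min (v y) 1).
have w01 y : 0 <= w y <= 1.
  by rewrite /w le_max lexx/= ge_max ler01 ge_min lexx orbT.
exists w; split => //.
- by apply: Cc_sub vC => y vy; rewrite /w vy min_l// maxxx.
- by rewrite /w vx minxx max_r.
apply: le_lt_trans ve.
apply: (proj2 (le_form b_graph _ (Cc_Dtilde b_graph vC))) => y z.
apply: dist_max_le; first by rewrite subrr normr0.
by apply: dist_min_le => //; rewrite subrr normr0.
Qed.

End Capacity.

(** * Capacity zero and the Green function *)

Section Recurrence.
Variables (R : realType) (V : countType) (b : V -> V -> R) (m : V -> R).
Hypothesis b_graph : weighted_graph b (cst 0).
Hypothesis b_connected : connected_graph b.
Hypothesis m_gt0 : forall x, 0 < m x.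

Local Notation D := (Dtilde b (cst 0)).
Local Notation Q := (Defs.form b (cst 0)).
Local Notation dom := (dom_QD b (cst 0) m).
Local Notation I2 := (inner2 m).

Let siQ := semi_inner_form b_graph.
Let siI := semi_inner_ell2 m_gt0.

Lemma not_null_capacity x : ~ null_capacity b x ->
  exists2 k, 0 < k & forall v, Cc v -> k * v x ^+ 2 <= Q v v.
Proof.
move=> /existsNP[k /not_implyP[k0 /forallNP hk]]; exists k => // v vC.
have vD := Cc_Dtilde b_graph vC.
have [vx0|vx0] := eqVneq (v x) 0.
  by rewrite vx0 expr0n/= mulr0 (si_ge0 siQ).
rewrite leNgt; apply/negP => hv; apply: (hk ((v x)^-1 *: v)); split.
- by rewrite -[_ *: _]addr0; apply: Cc_lin => //; exact: Cc0.
- by rewrite -[LHS]/((v x)^-1 * v x) mulVf.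
- by rewrite (si_sqZ siQ)// exprVn mulrC ltr_pdivrMr// lt0r sqrf_eq0 vx0
    sqr_ge0.
Qed.

(** The bound is needed at Green approximants, which need not be finitely supported. It extends
    because both the energy and the evaluation at [x] are continuous for the form norm. *)
Lemma dom_capacity_bound x k : 0 < k ->
  (forall v, Cc v -> k * v x ^+ 2 <= Q v v) ->
  forall v, dom v -> k * v x ^+ 2 <= Q v v.
Proof.
move=> k0 hk v vd; have vD := dom_D b_graph m_gt0 vd.
have vS := dom_L2 b_graph m_gt0 vd.
move/(dom_QDP b_graph m_gt0) : vd => [_ _ vh].
have mk f C : 0 <= C -> (Num.sqrt k * `|f| <= C) = (k * f ^+ 2 <= C ^+ 2).
  move=> C0; rewrite -(ler_sqr (x := _ * _)) ?nnegrE ?mulr_ge0 ?sqrtr_ge0//.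
  by rewrite exprMn sqr_sqrtr ?(ltW k0)// real_normK ?num_real.
suff : Num.sqrt k * `|v x| <= Num.sqrt (Q v v).
  by rewrite mk ?sqrtr_ge0// sqr_sqrtr// (si_ge0 siQ).
apply/ler_addgt0Pr => e e0.
(* The 1 accounts for the change in the root of the energy, the other term for the change of the
   value at [x], which [norm2] controls up to the root of [m x]. *)
pose K := 1 + Num.sqrt k / Num.sqrt (m x).
have K0 : 0 < K by rewrite ltr_pwDl// divr_ge0 ?sqrtr_ge0.
have eK : 0 < e / K by rewrite divr_gt0.
have [u uC hu] := vh _ (exprn_gt0 2 eK).
have uD := Cc_Dtilde b_graph uC; have uS := Cc_ell2 m_gt0 uC.
have vuD := si_domB siQ vD uD; have vuS := si_domB siI vS uS.
have Q0 := si_ge0 siQ vuD; have I0 := si_ge0 siI vuS.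
have hQ : Num.sqrt (Q (v - u) (v - u)) <= e / K.
  rewrite -[leRHS]gtr0_norm// -sqrtr_sqr; apply: ler_wsqrtr.
  by apply: le_trans (ltW hu); rewrite lerDl.
have hI : Num.sqrt k * `|(v - u) x| <= Num.sqrt k / Num.sqrt (m x) * (e / K).
  rewrite -mulrA ler_wpM2l ?sqrtr_ge0// mulrC ler_pdivlMr ?sqrtr_gt0// mulrC.
  apply: le_trans (norm2_sq_ge m_gt0 x vuS) _.
  rewrite -[leRHS]gtr0_norm// -sqrtr_sqr /norm2; apply: ler_wsqrtr.
  by apply: le_trans (ltW hu); rewrite lerDr.
have hu1 : Num.sqrt k * `|u x| <= Num.sqrt (Q u u).
  by rewrite mk ?sqrtr_ge0// sqr_sqrtr ?(si_ge0 siQ)// hk.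
have huv : Num.sqrt (Q u u) <= Num.sqrt (Q v v) + Num.sqrt (Q (v - u) (v - u)).
  have := si_triangle siQ vD (si_domN siQ vuD).
  by rewrite opprB subrKC (si_sqBC siQ uD vD).
have tri : `|v x| <= `|(v - u) x| + `|u x|.
  by rewrite -[(v - u) x]/(v x - u x); have := ler_normD (v x - u x) (u x);
    rewrite subrK.
apply: le_trans (ler_wpM2l (sqrtr_ge0 k) tri) _; rewrite mulrDr.
have -> : e = e / K + Num.sqrt k / Num.sqrt (m x) * (e / K).
  by rewrite -{1}[e / K]mul1r -mulrDl -/K mulrC divfK// lt0r_neq0.
move: hI hu1 huv hQ.
move: (e / K) (Num.sqrt k / _) (Num.sqrt (Q v v)) (Num.sqrt (Q u u)) => e1 e2
  q1 q2.
lra.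
Qed.

Lemma green_approx_form a x g v : green_approx b m a x g -> dom v ->
  Q g v + a * I2 g v = m x * v x.
Proof.
move=> [w [gd wS gw] e] vd; have vS := dom_L2 b_graph m_gt0 vd.
have gS := dom_L2 b_graph m_gt0 gd.
rewrite gw// -(siZl siI)// -(siDl siI) ?e ?inner2_delta//; last first.
  exact: (si_domZ siI).
by rewrite addrC e inner2_delta.
Qed.

Lemma green_approx_dom a x g : green_approx b m a x g -> dom g.
Proof. by move=> [w []]. Qed.

Lemma green_approx_energy a x g : 0 < a -> green_approx b m a x g ->
  Q g g <= m x * g x.
Proof.
move=> a0 ga; have gd := green_approx_dom ga.
rewrite -(green_approx_form ga gd) lerDl mulr_ge0 ?(ltW a0)// (si_ge0 siI)//.
exact: (dom_L2 b_graph m_gt0 gd).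
Qed.

(** With positive capacity, k g(x)^2 <= Q(g) <= m(x) g(x), so g(x) <= m(x) / k uniformly in the
    parameter and the Green function is finite at (x, x). *)
Lemma recurrent_null_capacity x :
  green b (cst 0) m x x = +oo%E -> null_capacity b x.
Proof.
move=> goo; apply: contrapT => /not_null_capacity[k k0 hk].
suff : (green b (cst 0%R) m x x <= (m x / k)%:E)%E by rewrite goo leye_eq.
apply: green_le => // a g a0 ga.
have h1 := dom_capacity_bound k0 hk (green_approx_dom ga).
have h2 := green_approx_energy a0 ga.
have g0 : 0 <= g x := green_approx_ge0 b_graph m_gt0 x a0 ga.
rewrite ler_pdivlMr//; have := le_trans h1 h2.
move: g0; rewrite le_eqVlt => /predU1P[<-|g0]; first by rewrite mul0r => _;
  exact: ltW.
by rewrite expr2 mulrA ler_pM2r// mulrC.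
Qed.

(** Cauchy-Schwarz for Q + a <.,.> between [g] and a test function with v(x) = 1 reads m(x)^2 <=
    m(x) g(x) (Q(v) + a |v|^2). First [v], then [a] is chosen to make the last factor small. *)
Lemma null_capacity_green_approx x (C : R) : null_capacity b x ->
  exists a g, [/\ 0 < a, green_approx b m a x g & C < g x].
Proof.
move=> cx; apply: contrapT => no.
pose C' := `|C| + 1; have C'0 : 0 < C' by rewrite ltr_wpDl.
have gC a g : 0 < a -> green_approx b m a x g -> g x <= C'.
  move=> a0 ga; rewrite leNgt; apply/negP => gx; apply: no; exists a, g;
    split => //.
  apply: le_lt_trans gx; apply: le_trans (ler_norm C) _.
  by rewrite lerDl.
(* Q(v) and a |v|^2 each get m(x) / (4 C'); with g(x) <= C' the right-hand side is at most m(x)^2 /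
   2, a contradiction. *)
have e0 : 0 < m x / (4 * C') by rewrite divr_gt0// mulr_gt0.
have [v [vC vx Qv]] := cx _ e0.
have vd := Cc_dom b_graph m_gt0 vC; have vS := Cc_ell2 m_gt0 vC.
have Iv := si_ge0 siI vS.
pose a := m x / (4 * C') / (I2 v v + 1).
have a0 : 0 < a by rewrite divr_gt0// ltr_wpDl.
have [g ga] := green_approx_exists b_graph m_gt0 x a0.
have gd := green_approx_dom ga.
have siB := semi_innerD (ltW a0) siI siQ.
have gIQ : ell2 m g /\ D g.
  by split; [exact: (dom_L2 b_graph m_gt0 gd)|exact: (dom_D b_graph m_gt0 gd)].
have vIQ : ell2 m v /\ D v by split => //; exact: Cc_Dtilde.
have := si_cauchy_schwarz siB gIQ vIQ.
rewrite (addrC (a * I2 g v)) (addrC (a * I2 g g)) (addrC (a * I2 v v)).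
rewrite (green_approx_form ga vd) (green_approx_form ga gd) vx mulr1.
apply/negP; rewrite -ltNge.
have aI : a * I2 v v <= m x / (4 * C').
  by rewrite /a mulrAC ler_pdivrMr ?ltr_wpDl// ler_wpM2l ?(ltW e0)// lerDl.
have h : Q v v + a * I2 v v <= m x / (2 * C').
  have -> : m x / (2 * C') = m x / (4 * C') + m x / (4 * C').
    by field; exact: lt0r_neq0.
  exact: lerD (ltW Qv) aI.
have g0 : 0 <= g x := green_approx_ge0 b_graph m_gt0 x a0 ga.
have mg0 : 0 <= m x * g x by rewrite mulr_ge0// ltW.
have mx := m_gt0 x.
apply: le_lt_trans (ler_wpM2l mg0 h) _.
apply: (@le_lt_trans _ _ (m x * C' * (m x / (2 * C')))).
  rewrite ler_wpM2r//; last by rewrite ler_wpM2l ?(ltW mx)// (gC a g a0 ga).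
  by rewrite divr_ge0 ?mulr_ge0 ?ltW.
have -> : m x * C' * (m x / (2 * C')) = m x ^+ 2 / 2 by field; exact: lt0r_neq0.
by rewrite ltr_pdivrMr// ltr_pMr ?exprn_gt0// ltr1n.
Qed.

Lemma null_capacity_green x y : null_capacity b x ->
  green b (cst 0) m x y = +oo%E.
Proof.
move=> cx; apply/eqP; rewrite -leye_eq leNgt; apply/negP => gfin.
have [C gC] : exists C : R, (green b (cst 0%R) m x y <= C%:E)%E.
  by move: gfin; case: green => [r _||_]; [exists r|rewrite ltxx|exists 0;
    rewrite leNye].
have [K K0 hK] := sq_sub_le_form b_graph b_connected x y.
(* If g(y) <= C < g(x) / 2, then g(x)^2 / 4 <= (g(x) - g(y))^2 <= K m(x) g(x), so g(x) <= 4 K m(x).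
   Exceeding [M] contradicts this: the energy grows only linearly in g(x). *)
pose M := 2 * `|C| + 4 * (K * m x).
have [a [g [a0 ga gx]]] := null_capacity_green_approx M cx.
have gy : g y <= C.
  by rewrite -lee_fin; apply: le_trans gC; apply: green_approx_le ga.
have h1 := hK g (dom_D b_graph m_gt0 (green_approx_dom ga)).
have h2 := ler_wpM2l K0 (green_approx_energy a0 ga).
have h3 := le_trans h1 h2; rewrite mulrA in h3.
have Km : 0 <= K * m x by rewrite mulr_ge0// ltW.
have CC := ler_norm C; have C0 := normr_ge0 C.
move: gx gy h3 Km CC C0; rewrite /M.
move: (K * m x) (g x) (g y) `|C| => k p q c hp hq h3 k0 Cc c0.
have p4 : 0 < p - 4 * k by lra.
have p0 : 0 < p by lra.
have d0 : 0 <= p - q - p / 2 by lra.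
have := mulr_gt0 p0 p4; have := mulr_ge0 d0 (ltW p0); have := mulr_ge0 d0 d0.
lra.
Qed.

End Recurrence.

(** * Density in the Yamasaki space *)

Section Yamasaki.
Variables (R : realType) (V : countType) (b : V -> V -> R) (o : V).
Hypothesis b_graph : weighted_graph b (cst 0).
Hypothesis b_connected : connected_graph b.

Local Notation D := (Dtilde b (cst 0)).
Local Notation Q := (Defs.form b (cst 0)).
Local Notation No := (norm_o b (cst 0) o).

Let siQ := semi_inner_form b_graph.

Lemma Dtilde_cst1 : D (cst 1).
Proof.
apply: (proj1 (le_form b_graph _ (si_dom0 siQ))) => x y.
by rewrite /= subrr normr0.
Qed.

Lemma form_sub_cst1 v : D v -> Q (v - cst 1) (v - cst 1) = Q v v.
Proof.
move=> vD; have vD1 := si_domB siQ vD Dtilde_cst1.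
have e x y : (v - cst 1) x - (v - cst 1) y = v x - v y.
  rewrite -[(v - cst 1) x]/(v x - 1) -[(v - cst 1) y]/(v y - 1); ring.
apply/eqP; rewrite eq_le; apply/andP; split.
  by apply: (proj2 (le_form b_graph _ vD)) => x y; rewrite e.
by apply: (proj2 (le_form b_graph _ vD1)) => x y; rewrite e.
Qed.

Lemma norm_oE u : No u = Num.sqrt (Q u u + u o ^+ 2).
Proof. by rewrite /norm_o /inner_o -expr2. Qed.

Lemma norm_o_sub_cst1 v : D v -> v o = 1 -> No (v - cst 1) = Num.sqrt (Q v v).
Proof.
move=> vD vo; rewrite norm_oE form_sub_cst1//.
by rewrite -[(v - cst 1) o]/(v o - 1) vo subrr expr0n/= addr0.
Qed.

(** Subtracting a constant leaves the energy unchanged, so the energies tend to 0; the values at [o]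
    only tend to 1, hence a rescaling. *)
Lemma yamasaki_cvg_null_capacity (e : nat -> V -> R) :
  (forall n, Cc (e n)) -> yamasaki_cvg b (cst 0) o e (cst 1) ->
  null_capacity b o.
Proof.
move=> eC ecv eps eps0.
(* The first bound gives v(o) > 1/2, the second Q(v) < eps / 4; dividing by v(o) costs a factor
   below 4. *)
have d0 : 0 < Num.min 2^-1 (Num.sqrt eps / 2).
  by rewrite lt_min invr_gt0 ltr0n/= divr_gt0// sqrtr_gt0.
move/cvgrPdist_lt : ecv => /(_ _ d0)[N _ /(_ N (leqnn N))] /=.
rewrite sub0r normrN ger0_norm ?sqrtr_ge0// lt_min => /andP[h1 h2].
have vD := Cc_Dtilde b_graph (eC N); have Q0 := si_ge0 siQ vD.
rewrite -[e N \- cst 1]/(e N - cst 1) norm_oE form_sub_cst1// in h1 h2.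
set v := e N in vD Q0 h1 h2.
rewrite -[(v - cst 1) o]/(v o - 1) in h1 h2.
have s0 := sqr_ge0 (v o - 1).
have h20 : 0 < Num.sqrt eps / 2 by rewrite divr_gt0// sqrtr_gt0.
have h10 : 0 < 2^-1 :> R by [].
rewrite (sqrtr_lt (addr_ge0 Q0 s0) h10) in h1.
rewrite (sqrtr_lt (addr_ge0 Q0 s0) h20) exprMn sqr_sqrtr ?(ltW eps0)// in h2.
have vo : 2^-1 < v o.
  have h : (v o - 1) ^+ 2 < 2^-1 ^+ 2 by apply: le_lt_trans h1; rewrite lerDr.
  by rewrite ltNge; apply/negP => vlt; nra.
have vo0 : 0 < v o by apply: lt_trans vo.
exists ((v o)^-1 *: v); split.
- by rewrite -[_ *: _]addr0; apply: Cc_lin; [exact: eC|exact: Cc0].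
- by rewrite -[LHS]/((v o)^-1 * v o) mulVf// lt0r_neq0.
- rewrite (si_sqZ siQ)// exprVn mulrC ltr_pdivrMr ?exprn_gt0//.
  apply: (@lt_trans _ _ (eps * 2^-1 ^+ 2)).
    by apply: le_lt_trans h2; rewrite lerDl.
  by rewrite ltr_pM2l// ltrXn2r// ltW.
Qed.

Lemma null_capacity_yamasaki_cvg : null_capacity b o ->
  exists e : nat -> V -> R,
    [/\ forall n, Cc (e n), forall n x, 0 <= e n x <= 1 &
        yamasaki_cvg b (cst 0) o e (cst 1)].
Proof.
move=> co.
have ex n : exists v, [/\ Cc v, v o = 1, Q v v < (n.+1%:R^-1) ^+ 2 & forall y,
  0 <= v y <= 1].
  by apply: null_capacity_clamp => //; rewrite exprn_gt0// invr_gt0.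
have [e he] := choice ex; exists e; split.
- by move=> n; have [] := he n.
- by move=> n; have [] := he n.
apply/cvgrPdist_le => eps eps0; have [N hN] := exists_inv_lt 1 eps0.
exists N => // n /= Nn; have [eC eo Qe _] := he n.
rewrite sub0r normrN ger0_norm ?sqrtr_ge0//.
have eD := Cc_Dtilde b_graph eC.
rewrite -[_ \- _]/(e n - cst 1) norm_o_sub_cst1//.
apply: le_trans (ltW (hN n Nn)); rewrite div1r.
have n0 : 0 < n.+1%:R^-1 :> R by rewrite invr_gt0.
by rewrite -[leRHS]gtr0_norm// -sqrtr_sqr; apply/ler_wsqrtr/ltW.
Qed.

(* Truncating [u] to [[- n e_n, n e_n]] gives finitely supported functions
   converging pointwise to [u] whose energy is at most
   [Q u u + n ^ 2 * Q e_n e_n]. *)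
Lemma null_capacity_dense : null_capacity b o -> D0 b (cst 0) o = D.
Proof.
move=> co; apply/seteqP; split => [u []//|u uD]; split => // eps eps0.
(* The cube leaves room for the level n + 1: the energy of [r n] is at most (n+1)^2 / (n+1)^3, which
   still tends to 0. *)
have ex n : exists v, [/\ Cc v, v o = 1, Q v v < (n.+1%:R^-1) ^+ 3 & forall y,
  0 <= v y <= 1].
  by apply: null_capacity_clamp => //; rewrite exprn_gt0// invr_gt0.
have [e he] := choice ex.
pose r n x : R := n.+1%:R * e n x.
pose w n x := Num.max (- r n x) (Num.min (u x) (r n x)).
have rE n : r n = n.+1%:R *: e n by [].
have eD n : D (e n) by have [/(Cc_Dtilde b_graph)] := he n.
have rD n : D (r n) by rewrite rE; exact: (si_domZ siQ).
have wC n : Cc (w n).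
  have [eC _ _ _] := he n; apply: Cc_sub eC => x ex0.
  by rewrite /w /r ex0 mulr0 oppr0 max_l// ge_min lexx orbT.
have n0 n : 0 < n.+1%:R^-1 :> R by rewrite invr_gt0.
have Qw n : D (w n) /\ Q (w n) (w n) <= Q u u + n.+1%:R^-1.
  have [wD wQ] : D (w n) /\ Q (w n) (w n) <= Q u u + Q (r n) (r n).
    apply: le_formD => // x y.
    have [d [d1 d2 d3]] : exists d, [/\ `|u x - u y| <= d, `|r n x - r n y| <=
      d &
        d ^+ 2 <= (u x - u y) ^+ 2 + (r n x - r n y) ^+ 2].
      have [h|h] := leP `|u x - u y| `|r n x - r n y|.
        by exists `|r n x - r n y|; split => //;
          rewrite real_normK ?num_real// lerDr sqr_ge0.
      by exists `|u x - u y|; split; [by []|exact: ltW|by rewrite real_normK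
        ?num_real// lerDl sqr_ge0].
    apply: le_trans d3; rewrite -(real_normK (num_real (w n x - w n y))).
    have dw : `|w n x - w n y| <= d.
      apply: dist_max_le; last exact: dist_min_le.
      by rewrite opprK addrC distrC.
    by rewrite lerXn2r ?nnegrE//; exact: le_trans dw.
  split => //; apply: le_trans wQ _; rewrite lerD2l rE (si_sqZ siQ)//.
  have [_ _ /ltW Qe _] := he n.
  apply: le_trans (ler_wpM2l (sqr_ge0 _) Qe) _.
  by rewrite (exprSr n.+1%:R^-1) mulrA -exprMn divff ?expr1n ?mul1r.
(* Vanishing energy and e_n(o) = 1 push e_n(x) towards 1 by connectedness; 1/2 is enough for the
   level [r n x] to tend to infinity. *)
have ecv x : \forall n \near \oo, 2^-1 <= e n x.
  have [K K0 hK] := sq_sub_le_form b_graph b_connected o x.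
  have q0 : 0 < 4^-1 :> R by [].
  have [N hN] := exists_inv_lt K q0.
  exists N => // n /= Nn; have [_ eo Qe _] := he n.
  have h1 := hK _ (eD n); rewrite eo in h1.
  have h2 : K * Q (e n) (e n) <= K / n.+1%:R.
    rewrite ler_wpM2l//; apply: le_trans (ltW Qe) _.
    by rewrite exprSr ler_piMl ?(ltW (n0 n))// exprn_ile1 ?(ltW (n0 n))//
      invf_le1// ler1n.
  have h3 := le_lt_trans (le_trans h1 h2) (hN n Nn).
  by rewrite leNgt; apply/negP => elt; nra.
(* The truncation is eventually inactive at each vertex. This gives pointwise convergence, and at
   [o] exact equality, so the vertex term of the norm disappears below. *)
have wu x : \forall n \near \oo, w n x = u x.
  have [M hM] := exists_inv_lt (2 * `|u x|) (ltr01 : 0 < 1 :> R).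
  near=> n.
  have en : 2^-1 <= e n x by near: n; exact: ecv.
  have : 2 * `|u x| / n.+1%:R < 1 by apply: hM; near: n; exists M.
  rewrite ltr_pdivrMr// mul1r => un.
  have : `|u x| <= r n x.
    rewrite /r; have nn : 0 <= n.+1%:R :> R by [].
    by have := ler_wpM2l nn en; lra.
  rewrite ler_norml => /andP[l1 l2].
  by rewrite /w min_l// max_r.
have wcv x : w n x @[n --> \oo] --> u x.
  apply: cvg_near_cst; exact: wu.
have e2 : 0 < eps ^+ 2 / 2 by rewrite divr_gt0// exprn_gt0.
have := @form_cvg_of_le _ _ _ b_graph _ _ _ w u uD wcv _ _ e2.
move=> conv.
near \oo => n.
exists (w n) => //.
have wo : w n o = u o by near: n; exact: wu.
have wD : D (w n) by have [] := Qw n.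
rewrite -[_ \- _]/(u - w n) norm_oE -[(u - w n) o]/(u o - w n o) wo subrr.
have Q0 := si_ge0 siQ (si_domB siQ uD wD).
rewrite expr0n/= addr0 sqrtr_lt// (si_sqBC siQ)//.
apply: (@le_lt_trans _ _ (eps ^+ 2 / 2)).
  near: n; apply: conv => e' e'0.
  have [N hN] := exists_inv_lt 1 e'0.
  exists N => // k /= Nk; have [wkD wkQ] := Qw k; split => //.
  apply: le_trans wkQ _; rewrite lerD2l -div1r.
  exact/ltW/hN.
by rewrite ltr_pdivrMr// ltr_pMr ?exprn_gt0// ltr1n.
Unshelve. all: by end_near. Qed.

(** Finitely supported functions lie in the form domain, so the infinite value in [QD] never enters
    the infimum. *)
Lemma capacity_eq0 (m : V -> R) : (forall x, 0 < m x) ->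
  capacity b (cst 0) m o = 0%E <-> null_capacity b o.
Proof.
move=> m_gt0.
have QDE v : Cc v -> QD b (cst 0) m v = (Q v v)%:E.
  move=> vC; rewrite /QD mem_set ?energyE//; first exact: Cc_Dtilde.
  exact: Cc_dom.
split=> [c0 e e0|co].
- apply: contrapT => /forallNP no.
  suff : (e%:E <= capacity b (cst 0%R) m o)%E by rewrite c0 lee_fin leNgt e0.
  apply: le_ereal_inf_tmp => _ [v [vC vo] <-]; rewrite QDE// lee_fin leNgt.
  by apply/negP => Qv; apply: (no v).
- apply/eqP; rewrite eq_le; apply/andP; split.
    apply/lee_addgt0Pr => e e0; rewrite add0e.
    have [v [vC vo Qv]] := co e e0.
    apply: (@le_trans _ _ (Q v v)%:E); last by rewrite lee_fin ltW.
    by rewrite -QDE//; apply: ereal_inf_lbound; exists v.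
  apply: le_ereal_inf_tmp => _ [v [vC vo] <-]; rewrite QDE// lee_fin.
  exact/(si_ge0 siQ)/Cc_Dtilde.
Qed.

End Yamasaki.

Theorem theorem4p3 (R : realType) (V : countType) (b : V -> V -> R)
    (m : V -> R) (o : V)
    (V_infinite : infinite_set [set: V])
    (b_graph : weighted_graph b (cst 0))
    (b_connected : connected_graph b)
    (m_gt0 : forall x, 0 < m x) :
  [<-> recurrent b (cst 0) m;
       D0 b (cst 0) o = Dtilde b (cst 0);
       exists e : nat -> V -> R,
         (forall n, Cc (e n)) /\ yamasaki_cvg b (cst 0) o e (cst 1);
       capacity b (cst 0) m o = 0%E]
  /\
  ((exists e : nat -> V -> R,
      (forall n, Cc (e n)) /\ yamasaki_cvg b (cst 0) o e (cst 1)) ->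
   exists e : nat -> V -> R,
     [/\ forall n, Cc (e n),
         forall n x, 0 <= e n x <= 1 &
         yamasaki_cvg b (cst 0) o e (cst 1)]).
Proof.
split; last first.
  by move=> [e [eC ecv]]; apply: null_capacity_yamasaki_cvg
    (yamasaki_cvg_null_capacity _ eC ecv).
tfae.
- move=> rec; apply: null_capacity_dense => //.
  exact: recurrent_null_capacity (rec o o).
- move=> dense.
  have ex n : exists v, Cc v /\ norm_o b (cst 0) o (cst 1 \- v) < n.+1%:R^-1.
    have : D0 b (cst 0) o (cst 1) by rewrite dense; exact: Dtilde_cst1.
    move=> [_ /(_ n.+1%:R^-1)]; rewrite invr_gt0 ltr0n => /(_ isT)[v vC hv].
    by exists v.
  have [e he] := choice ex; exists e; split; first by move=> n; have [] := he n.
  apply/cvgrPdist_le => eps eps0; have [N hN] := exists_inv_lt 1 eps0.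
  exists N => // n /= Nn; have [eC hn] := he n.
  rewrite sub0r normrN ger0_norm ?sqrtr_ge0//.
  apply: le_trans (ltW (hN n Nn)); rewrite div1r; apply: le_trans (ltW hn).
  (* Closure is measured by [cst 1 - e n], Yamasaki convergence by the opposite difference. *)
  have eD := Cc_Dtilde b_graph eC; have oD := Dtilde_cst1 b_graph.
  rewrite /norm_o -[_ \- cst 1]/(e n - cst 1) -[_ \- e n]/(cst 1 - e n).
  by rewrite (si_sqBC (semi_inner_o b_graph o)).
- move=> [e [eC ecv]]; apply/(capacity_eq0 o b_graph m_gt0).
  exact: yamasaki_cvg_null_capacity eC ecv.
(* Connectedness enters twice: to move capacity zero from [o] to [x], then to spread the blow-up of
   the approximants from [x] to [y]. *)
- move=> /(capacity_eq0 o b_graph m_gt0) co x y.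
  by apply: null_capacity_green => //; exact: null_capacity_trans co.
Qed.
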